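(* Let $n\ge 3$. If $\mathcal{A}$ is an Artin group of finite type $A_n$ or $B_n=C_n$, then $\operatorname{asdim}\mathcal{A}\le n$. If $\mathcal{A}$ is an Artin group of affine type $\tilde A_{n-1}$ or $\tilde C_{n-1}$, then $\operatorname{asdim}\mathcal{A}=n-1$.
   Context: Let $S$ be a finite set. A Coxeter matrix is a symmetric function $m:S\times S\to\{1,2,3,\dots\}\cup\{\infty\}$ with $m(s,s)=1$ and $m(s,s')=m(s',s)\ge 2$ for $s\ne s'$. The associated Artin group is the group generated by $S$ with, for each pair $s\neq s'$ with $m(s,s')<\infty$, the relation $ss's\cdots=s'ss'\cdots$, where both sides are alternating words of length $m(s,s')$. The types are the standard Coxeter types: $A_n$ has $S=\{s_1,\dots,s_n\}$ with $m(s_i,s_{i+1})=3$ and $m(s_i,s_j)=2$ for $|i-j|\ge 2$; $B_n=C_n$ is the same except that $m(s_{n-1},s_n)=4$; $\tilde A_{n-1}$ has $S=\{s_i\mid i\in\mathbb{Z}/n\}$ with $m(s_i,s_{i+1})=3$ for all $i\in\mathbb{Z}/n$ and $m=2$ for all other pairs of distinct generators; $\tilde C_{n-1}$ has $S=\{s_1,\dots,s_n\}$ with $m(s_1,s_2)=m(s_{n-1},s_n)=4$, $m(s_i,s_{i+1})=3$ for $2\le i\le n-2$, and $m(s_i,s_j)=2$ for $|i-j|\ge 2$. Asymptotic dimension: for a metric space $X$ and integer $k\ge 0$, $\operatorname{asdim}X\le k$ if for every $r\in\mathbb{N}$ there is a cover $\{U_i\}_i$ of $X$ by subsets of uniformly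 bounded diameter such that every ball of radius $r$ in $X$ meets at most $k+1$ of the sets $U_i$; $\operatorname{asdim}X$ is the least such $k$ (or $\infty$). For a finitely generated group $G$, $\operatorname{asdim}G$ is the asymptotic dimension of $G$ with the word metric of any finite symmetric generating set (it does not depend on the choice). *)

(* Defs.v *)
From HB Require Import structures.
From mathcomp Require Import all_boot all_classical.

Set Implicit Arguments.
Unset Strict Implicit.
Unset Printing Implicit Defensive.

Local Open Scope quotient_scope.
Local Open Scope classical_set_scope.
Local Open Scope card_scope.

(* Groups given by generators and relations: <X | u = v for R u v>.  A word is
   a list of letters; the letter (x, false) stands for x and (x, true) for the
   inverse of x. *)

Definition letter (X : Type) := (X * bool)%type.

Definition inv_letter X (a : letter X) : letter X := (a.1, ~~ a.2).

Definition inv_word X (w : seq (letter X)) := rev (map (@inv_letter X) w).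

Inductive pres_eq X (R : seq (letter X) -> seq (letter X) -> Prop) :
    seq (letter X) -> seq (letter X) -> Prop :=
| PresRefl u : pres_eq R u u
| PresSym u v : pres_eq R u v -> pres_eq R v u
| PresTrans v u w : pres_eq R u v -> pres_eq R v w -> pres_eq R u w
| PresCat u u' v v' :
    pres_eq R u u' -> pres_eq R v v' -> pres_eq R (u ++ v) (u' ++ v')
| PresCancel a : pres_eq R [:: a; inv_letter a] [::]
| PresRel u v : R u v -> pres_eq R u v.

Section PresentedGroup.
Variables (X : choiceType) (R : seq (letter X) -> seq (letter X) -> Prop).

Definition pres_eqb : rel (seq (letter X)) := fun u v => `[< pres_eq R u v >].

Lemma pres_eqb_refl : reflexive pres_eqb.
Proof. by move=> u; apply/asboolP; exact: PresRefl. Qed.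

Lemma pres_eqb_sym : symmetric pres_eqb.
Proof. by move=> u v; apply/asboolP/asboolP; exact: PresSym. Qed.

Lemma pres_eqb_trans : transitive pres_eqb.
Proof.
by move=> v u w /asboolP uv /asboolP vw; apply/asboolP; exact: PresTrans vw.
Qed.

Canonical pres_equiv :=
  EquivRel pres_eqb pres_eqb_refl pres_eqb_sym pres_eqb_trans.

Definition presented_group := {eq_quot pres_equiv}.
HB.instance Definition _ := Choice.on presented_group.
HB.instance Definition _ := Quotient.on presented_group.
HB.instance Definition _ := EqQuotient.on presented_group.

Definition pres_class (w : seq (letter X)) : presented_group := \pi w.

Lemma pres_classP u v : pres_class u = pres_class v <-> pres_eq R u v.
Proof.
split=> [/eqP|uv]; first by rewrite eqmodE => /asboolP.
by apply/eqP; rewrite eqmodE; apply/asboolP.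
Qed.

Lemma pres_class_repr x : pres_class (repr x) = x.
Proof. exact: reprK. Qed.

Lemma pres_eq_repr u : pres_eq R (repr (pres_class u)) u.
Proof. by apply/pres_classP; rewrite pres_class_repr. Qed.

Lemma inv_letterK : involutive (@inv_letter X).
Proof. by case=> x b; rewrite /inv_letter /= negbK. Qed.

Lemma inv_wordK : involutive (@inv_word X).
Proof.
by move=> w; rewrite /inv_word map_rev revK mapK //; exact: inv_letterK.
Qed.

Lemma inv_word_cat u v :
  inv_word (u ++ v) = inv_word v ++ inv_word u :> seq (letter X).
Proof. by rewrite /inv_word map_cat rev_cat. Qed.

Lemma pres_mulwV w : pres_eq R (w ++ inv_word w) [::].
Proof.
elim: w => [|a w IHw]; first exact: PresRefl.
rewrite -cat1s inv_word_cat -catA [w ++ _]catA.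
apply: PresTrans (PresCancel R a).
rewrite -[RHS in pres_eq R _ RHS]/([:: a] ++ [:: inv_letter a]).
apply: PresCat; first exact: PresRefl.
rewrite -[RHS in pres_eq R _ RHS]cat0s; apply: PresCat => //; exact: PresRefl.
Qed.

Lemma pres_mulVw w : pres_eq R (inv_word w ++ w) [::].
Proof. by rewrite -{2}[w]inv_wordK; exact: pres_mulwV. Qed.

Lemma pres_inv u v : pres_eq R u v -> pres_eq R (inv_word u) (inv_word v).
Proof.
move=> uv; apply: (@PresTrans _ _ (inv_word u ++ (v ++ inv_word v))).
  rewrite -[X in pres_eq R X _]cats0.
  by apply: PresCat; [exact: PresRefl | apply/PresSym/pres_mulwV].
rewrite catA -[X in pres_eq R _ X]cat0s.
apply: PresCat (PresRefl _ _); apply: PresTrans (pres_mulVw u).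
by apply: PresCat (PresSym uv); exact: PresRefl.
Qed.

Definition pres_mul (x y : presented_group) := pres_class (repr x ++ repr y).
Definition pres_inverse (x : presented_group) := pres_class (inv_word (repr x)).

Lemma pres_mulE u v :
  pres_mul (pres_class u) (pres_class v) = pres_class (u ++ v).
Proof. by apply/pres_classP/PresCat; exact: pres_eq_repr. Qed.

Lemma pres_invE u : pres_inverse (pres_class u) = pres_class (inv_word u).
Proof. by apply/pres_classP/pres_inv; exact: pres_eq_repr. Qed.

Lemma pres_mulA : associative pres_mul.
Proof.
move=> x y z.
rewrite -[x]pres_class_repr -[y]pres_class_repr -[z]pres_class_repr.
by rewrite !pres_mulE catA.
Qed.

Lemma pres_mul1 : left_id (pres_class [::]) pres_mul.
Proof. by move=> x; rewrite -[x]pres_class_repr pres_mulE. Qed.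

Lemma pres_mulr1 : right_id (pres_class [::]) pres_mul.
Proof. by move=> x; rewrite -[x]pres_class_repr pres_mulE cats0. Qed.

Lemma pres_mulV : left_inverse (pres_class [::]) pres_inverse pres_mul.
Proof.
move=> x; rewrite -[x]pres_class_repr pres_invE pres_mulE.
by apply/pres_classP/pres_mulVw.
Qed.

Lemma pres_mulrV : right_inverse (pres_class [::]) pres_inverse pres_mul.
Proof.
move=> x; rewrite -[x]pres_class_repr pres_invE pres_mulE.
by apply/pres_classP/pres_mulwV.
Qed.

HB.instance Definition _ := isGroup.Build presented_group
  pres_mulA pres_mul1 pres_mulr1 pres_mulV pres_mulrV.

End PresentedGroup.

(* [None] encodes the value infinity. *)
Record coxeter_matrix (S : finType) := CoxeterMatrix {
  coxeter_fun :> S -> S -> option nat;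
  coxeter_diag : forall s, coxeter_fun s s = Some 1;
  coxeter_sym : forall s t, coxeter_fun s t = coxeter_fun t s;
  coxeter_ge2 : forall s t m, s != t -> coxeter_fun s t = Some m -> 2 <= m
}.

(* The word s t s ... of length k. *)
Fixpoint alternating X (s t : X) (k : nat) : seq X :=
  if k is k'.+1 then s :: alternating t s k' else [::].

Definition positive_word X (w : seq X) : seq (letter X) :=
  [seq (x, false) | x <- w].

Section Artin.
Variables (S : finType) (M : coxeter_matrix S).

Definition artin_rel (u v : seq (letter S)) : Prop :=
  exists s t m, [/\ s != t, M s t = Some m,
    u = positive_word (alternating s t m) &
    v = positive_word (alternating t s m)].

Definition artin_group := presented_group artin_rel.
HB.instance Definition _ := Group.on artin_group.

Definition artin_gen (a : letter S) : artin_group :=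
  pres_class artin_rel [:: a].

End Artin.

(* Diagram with vertices 0, ..., n-1 in a line, edge {k, k+1} labelled e k. *)
Definition path_coxeter_fun (e : nat -> nat) n (i j : 'I_n) : option nat :=
  Some (if i == j then 1
        else if j == i.+1 :> nat then e i
        else if i == j.+1 :> nat then e j
        else 2).

Lemma path_coxeter_diag e n (i : 'I_n) : path_coxeter_fun e i i = Some 1.
Proof. by rewrite /path_coxeter_fun eqxx. Qed.

Lemma path_coxeter_sym e n (i j : 'I_n) :
  path_coxeter_fun e i j = path_coxeter_fun e j i.
Proof.
rewrite /path_coxeter_fun [j == i]eq_sym; congr Some.
by do 3![case: eqP => //] => ->/eqP; rewrite -{1}[val j]addn0 -addn2 eqn_add2l.
Qed.

Lemma path_coxeter_ge2 (e : nat -> nat) n (i j : 'I_n) m :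
  (forall k, 2 <= e k) -> i != j -> path_coxeter_fun e i j = Some m -> 2 <= m.
Proof.
move=> e_ge2 /negPf ij [<-]; rewrite ij.
by case: ifP => // _; case: ifP.
Qed.

Definition path_coxeter (e : nat -> nat) (e_ge2 : forall k, 2 <= e k) n :
    coxeter_matrix 'I_n :=
  CoxeterMatrix (@path_coxeter_diag e n) (@path_coxeter_sym e n)
    (fun i j m => @path_coxeter_ge2 e n i j m e_ge2).

(* Types A_n, B_n and affine C_{n-1}, all on n vertices; the vertex s_i is the
   ordinal i - 1, so the edge {s_{n-1}, s_n} is the one with k.+2 = n. *)
Definition edges_A (k : nat) := 3.
Definition edges_B (n k : nat) := if k.+2 == n then 4 else 3.
Definition edges_affine_C (n k : nat) :=
  if (k == 0) || (k.+2 == n) then 4 else 3.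

Lemma edges_A_ge2 k : 2 <= edges_A k. Proof. by []. Qed.
Lemma edges_B_ge2 n k : 2 <= edges_B n k.
Proof. by rewrite /edges_B; case: ifP. Qed.
Lemma edges_affine_C_ge2 n k : 2 <= edges_affine_C n k.
Proof. by rewrite /edges_affine_C; case: ifP. Qed.

Definition coxeter_A n := path_coxeter edges_A_ge2 n.
Definition coxeter_B n := path_coxeter (edges_B_ge2 n) n.
Definition coxeter_affine_C n := path_coxeter (edges_affine_C_ge2 n) n.

(* Type affine A_{n-1}: a cycle on n vertices ([ordS] is i |-> i + 1 mod n). *)
Definition cycle_coxeter_fun n (i j : 'I_n) : option nat :=
  Some (if i == j then 1
        else if (j == ordS i) || (i == ordS j) then 3
        else 2).

Lemma cycle_coxeter_diag n (i : 'I_n) : cycle_coxeter_fun i i = Some 1.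
Proof. by rewrite /cycle_coxeter_fun eqxx. Qed.

Lemma cycle_coxeter_sym n (i j : 'I_n) :
  cycle_coxeter_fun i j = cycle_coxeter_fun j i.
Proof. by rewrite /cycle_coxeter_fun eq_sym orbC. Qed.

Lemma cycle_coxeter_ge2 n (i j : 'I_n) m :
  i != j -> cycle_coxeter_fun i j = Some m -> 2 <= m.
Proof. by move=> /negPf ij [<-]; rewrite ij; case: ifP. Qed.

Definition coxeter_affine_A n : coxeter_matrix 'I_n :=
  CoxeterMatrix (@cycle_coxeter_diag n) (@cycle_coxeter_sym n)
    (@cycle_coxeter_ge2 n).

(* Metrics are nat-valued, which is all that word metrics require; the last
   clause says that every ball of radius r meets at most k + 1 of the U i. *)
Definition metric_asdim_le X (d : X -> X -> nat) (k : nat) : Prop :=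
  forall r : nat, exists (I : Type) (U : I -> set X),
    [/\ forall x, exists i, U i x,
        exists D : nat, forall i x y, U i x -> U i y -> d x y <= D &
        forall x, [set i | exists2 y, U i y & d x y <= r] #<= `I_k.+1].

Definition metric_asdim_eq X (d : X -> X -> nat) (k : nat) : Prop :=
  metric_asdim_le d k /\ forall j, metric_asdim_le d j -> k <= j.

Section WordMetric.
Variable G : groupType.

Definition product_of_length (T : set G) (g : G) : pred nat := fun n =>
  `[< exists w : seq G,
        [/\ size w = n, forall x, x \in w -> T x & (\prod_(x <- w) x)%g = g] >].

Record generating_set := GeneratingSet {
  gens :> set G;
  gens_finite : finite_set gens;
  gens_inv : forall g, gens g -> gens g^-1%g;
  gens_generate : forall g, exists n, product_of_length gens g n
}.

Definition word_length (T : generating_set) (g : G) : nat :=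
  ex_minn (gens_generate T g).

Definition word_metric (T : generating_set) (g h : G) : nat :=
  word_length T (g^-1 * h)%g.

(* The asymptotic dimension does not depend on the generating set, so it is
   bounded for all of them at once; vacuous unless G is finitely generated. *)
Definition asdim_le (k : nat) : Prop :=
  forall T : generating_set, metric_asdim_le (word_metric T) k.

Definition asdim_eq (k : nat) : Prop :=
  forall T : generating_set, metric_asdim_eq (word_metric T) k.

End WordMetric.

(* The standard generators and their inverses witness that [asdim_le] and
   [asdim_eq] are not vacuous for Artin groups. *)
Section ArtinGenerators.
Variables (S : finType) (M : coxeter_matrix S).

Lemma artin_gens_finite : finite_set (range (@artin_gen S M)).
Proof. by apply: finite_image; exact: (@finite_finset (S * bool)%type). Qed.

Lemma artin_genV a : (artin_gen M a)^-1%g = artin_gen M (inv_letter a).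
Proof. exact: pres_invE. Qed.

Lemma artin_gens_inv g :
  range (@artin_gen S M) g -> range (@artin_gen S M) g^-1%g.
Proof. by case=> a _ <-; exists (inv_letter a) => //; rewrite artin_genV. Qed.

Lemma prod_artin_gen w :
  (\prod_(a <- w) artin_gen M a)%g = pres_class (artin_rel M) w.
Proof.
elim: w => [|a w IHw]; first by rewrite big_nil.
by rewrite big_cons IHw -cat1s; exact: pres_mulE.
Qed.

Lemma artin_gens_generate (g : artin_group M) :
  exists n, product_of_length (range (@artin_gen S M)) g n.
Proof.
exists (size (repr g)); apply/asboolP.
exists (map (artin_gen M) (repr g)); split; first by rewrite size_map.
- by move=> x /mapP[a _ ->]; exists a.
- by rewrite big_map prod_artin_gen pres_class_repr.
Qed.

Definition artin_gens : generating_set (artin_group M) :=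
  GeneratingSet artin_gens_finite artin_gens_inv artin_gens_generate.

End ArtinGenerators.

(* Main.v *)
(* Upper bounds.  By a Hurewicz-type theorem, a surjection of groups whose kernel
   has asymptotic dimension at most 1 raises the dimension by at most 1.  Let
   Q_l be the braid group on l + 1 strands modulo its centre, and G_n the group
   of type B_n (the braids of the annulus) modulo its centre.  Filling in the
   central puncture gives G_n -> Q_(n-1); the Artin action on the free group of
   rank n identifies its kernel with the inner automorphisms, which form a free
   group.  Q_n contains G_n with finite index, as the stabiliser of a marked
   strand; hence G_n has dimension at most n - 1, by induction.  The affine group A~_(n-1) embeds in G_n as the normal closure of
   the generators other than s_0, and the affine group C~_(n-1) fibres over
   G_(n-1) with free kernel, so both have dimension at most n - 1.  Finally B_n
   is a retract of C~_n, and the braid group A_n contains B_n with finite index,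
   again as the stabiliser of a marked strand.

   Lower bounds.  Both affine groups contain n - 1 commuting Jucys-Murphy
   elements, which generate a free abelian group: linking numbers with a fixed
   strand or puncture separate them.  The map from Z^(n-1) to the group is
   therefore a coarse embedding, and a covering of low multiplicity would
   contradict a cubical Sperner lemma. *)
Require Import Defs.
From HB Require Import structures.
From mathcomp Require Import all_boot all_classical zify.

Set Implicit Arguments.
Unset Strict Implicit.
Unset Printing Implicit Defensive.

Local Open Scope classical_set_scope.
Local Open Scope group_scope.

(** * Asymptotic dimension of groups and extensions *)

(** Dimension is stated for subsets of a group, with finite sets of differences [x^-1 * y] as
    scales, because the kernels and preimages of an extension carry no word metric of their own;
    word metrics enter only in the final comparison and in the lower bounds. Centres are divided out
    because each would cost one dimension: with the power [n] of the Coxeter element killed in type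
    B and the power [n + 1] in type A, the induction starts at a trivial group and gains exactly one
    at each filling of a puncture. Two facts that usually rest on topology are replaced by explicit
    actions. Freeness: the candidate generators of a kernel act on a free group as the corresponding
    inner automorphisms, and a free group of rank at least 2 has trivial centre, so any relation
    among them already holds in the free group. Finite index: a presented group acts on pairs of a
    coset and a subgroup element, and its relations are checked on such pairs. That a kernel is no
    larger than the candidate follows from the presentation of the quotient, whose relators lift
    into it. *)

Section FiniteSets.
Variable G : groupType.
Implicit Types A B : set G.

Lemma finite_set_mulg A B :
  finite_set A -> finite_set B -> finite_set [set x * y | x in A & y in B].
Proof. exact: finite_image2. Qed.

Lemma finite_set_invg A : finite_set A -> finite_set [set x^-1 | x in A].
Proof. exact: finite_image. Qed.

Lemma finite_set_symm A : finite_set A ->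
  exists B, [/\ finite_set B, A `<=` B, B 1 & forall x, B x -> B x^-1].
Proof.
move=> finA; exists ([set 1] `|` (A `|` [set x^-1 | x in A])); split.
- by rewrite !finite_setU; split=> //; split=> //; exact: finite_set_invg.
- by move=> x Ax; right; left.
- by left.
- move=> x [->|[Ax|[y Ay <-]]]; first by left; rewrite invg1.
  + by right; right; exists x.
  + by right; left; rewrite invgK.
Qed.

End FiniteSets.

Section Chains.
Variable G : groupType.
Implicit Types (S E : set G) (x y z : G).

Inductive chain S E x : G -> Prop :=
| Chain0 : S x -> chain S E x x
| ChainS y z : chain S E x y -> S z -> E (y^-1 * z) -> chain S E x z.

Lemma chain_last S E x y : chain S E x y -> S y.
Proof. by case. Qed.

Lemma chain_first S E x y : chain S E x y -> S x.
Proof. by elim. Qed.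

Lemma chain_sub S S' E E' x y :
  (forall z, S z -> S' z) -> E `<=` E' -> chain S E x y -> chain S' E' x y.
Proof.
move=> SS EE; elim=> [Sx|{}y z _ IH Sz Ez]; first exact/Chain0/SS.
by apply: ChainS IH _ _; [exact: SS | exact: EE].
Qed.

Lemma chain_trans S E y x z : chain S E x y -> chain S E y z -> chain S E x z.
Proof. by move=> xy; elim=> // w v _ IH Sv; apply: ChainS. Qed.

Lemma chain_sym S E x y : (forall e, E e -> E e^-1) ->
  chain S E x y -> chain S E y x.
Proof.
move=> Esym; elim=> [Sx|{}y z xy IH Sz Ez]; first exact: Chain0.
apply: chain_trans IH; apply: ChainS (Chain0 _ Sz) (chain_last xy) _.
by move/Esym: Ez; rewrite invgM invgK.
Qed.

End Chains.

Lemma chain_map (G H : groupType) (f : G -> H) (S E : set G) (S' E' : set H)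
    x y :
  (forall z, S z -> S' (f z)) ->
  (forall u v, S u -> S v -> E (u^-1 * v) -> E' ((f u)^-1 * f v)) ->
  chain S E x y -> chain S' E' (f x) (f y).
Proof.
move=> SS EE; elim=> [Sx|{}y z xy IH Sz Ez]; first exact/Chain0/SS.
by apply: ChainS IH (SS _ Sz) _; apply: EE => //; exact: chain_last xy.
Qed.

Section Dimension.
Variable G : groupType.
Implicit Types (A E B : set G).

(** The pieces of a colour are its components under [E]-chains, so two pieces of one colour are
    [E]-disjoint by construction and no family of sets has to be carried along. *)
Definition chain_bounded N (C : G -> {set 'I_N}) A E B :=
  forall (i : 'I_N) x y,
    chain (fun z => A z /\ i \in C z) E x y -> B (x^-1 * y).

(* Asymptotic dimension of a subset of a group for its intrinsic coarse
   structure, in which the entourages are the sets of pairs [(x, y)] such that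
   [x^-1 * y] lies in a given finite set; [kdim A c N] asks for [N] colours,
   each point having at least [c] of them. *)
Definition kdim A c N := forall E, finite_set E ->
  exists (C : G -> {set 'I_N}) B, [/\ finite_set B,
    forall x, A x -> c <= #|C x| & chain_bounded C A E B].

Definition dim_le A k := kdim A 1 k.+1.

(* Kolmogorov's trick. *)
Lemma kdimS A k N : k < N -> kdim A (N - k) N -> kdim A (N.+1 - k) N.+1.
Proof.
move=> ltkN dimA E /finite_set_symm[E1 [finE1 EE1 E11 E1V]].
(* Each old colour will be widened to its [E1]-neighbourhood [T]; an [E]-step between widened points
   is an [E3]-step between nearby points of the old colour. *)
pose E3 := [set a * b | a in E1 & b in [set a * b | a in E1 & b in E1]].
have [C [B [finB cov bndC]]] : exists (C : G -> {set 'I_N}) B, [/\ finite_set B,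
    forall x, A x -> N - k <= #|C x| & chain_bounded C A E3 B].
  by apply: dimA; do 2!apply: finite_set_mulg => //.
pose nb x (i : 'I_N) := `[< exists2 e, E1 e & A (x * e) /\ i \in C (x * e) >].
pose T x : {set 'I_N} := [set i | nb x i]%SET.
have CT x : A x -> C x \subset T x.
  by move=> Ax; apply/fintype.subsetP=> i Ci; rewrite inE; apply/asboolP; exists 1;
     rewrite ?mulg1.
(* Either widening already gives more than [N - k] colours, or it adds nothing to [C x] and the new
   colour makes up the number. *)
pose C' x : {set 'I_N.+1} := [set i | if unlift ord_max i is Some j
  then j \in T x else #|T x| <= N - k]%SET.
exists C'.
exists (B `|` [set a * b | a in E1 & b in [set a * b | a in B & b in E1]]).
split.
- by rewrite finite_setU; split=> //; do 2!apply: finite_set_mulg => //.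
- move=> x Ax.
  have sub : (lift ord_max @: T x)%SET \subset C' x.
    by apply/fintype.subsetP=> _ /imsetP[j Tj ->]; rewrite inE liftK.
  case: (leqP #|T x| (N - k)) => [leT|ltT].
    have maxC : ord_max \in C' x by rewrite inE unlift_none.
    have : (ord_max |: lift ord_max @: T x)%SET \subset C' x by rewrite finset.subUset finset.sub1set maxC.
    move/subset_leq_card; apply: leq_trans.
    rewrite cardsU1 card_imset; last exact: lift_inj.
    have -> : ord_max \notin (lift ord_max @: T x)%SET.
      by apply/imsetP=> -[j _ /eqP]; rewrite (negPf (neq_lift _ _)).
    rewrite add1n subSn ?(ltnW ltkN) // ltnS.
    exact: leq_trans (cov x Ax) (subset_leq_card (CT x Ax)).
  rewrite subSn ?(ltnW ltkN) //; apply: leq_trans ltT _.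
  by rewrite -(card_imset (T x) (@lift_inj _ ord_max)); exact: subset_leq_card.
- move=> i x y; case: (unliftP ord_max i) => [j ->|->] xy.
    right.
    have {}xy : chain (fun z => A z /\ j \in T z) E x y.
      by apply: chain_sub xy => // z; rewrite inE liftK.
    have start z : A z /\ j \in T z ->
        exists2 e, E1 e & A (z * e) /\ j \in C (z * e).
      by case=> _; rewrite inE => /asboolP.
    have [e E1e Se] := start _ (chain_first xy).
    have [f E1f [Sf xyf]] : exists2 f, E1 f & (A (y * f) /\ j \in C (y * f)) /\
        chain (fun z => A z /\ j \in C z) E3 (x * e) (y * f).
      elim: xy => [_|{}y z xy [f E1f [Sf IH]] Sz Ez].
        by exists e => //; split => //; exact: Chain0.
      have [g E1g Sg] := start _ Sz; exists g => //; split=> //.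
      apply: ChainS IH Sg _.
      exists f^-1; first exact: E1V.
      exists (y^-1 * z * g); last by rewrite invgM !mulgA.
      by exists (y^-1 * z); [exact: EE1 | exists g].
    exists e => //; exists ((x * e)^-1 * (y * f) * f^-1).
      exists ((x * e)^-1 * (y * f)); first by move: xyf => /bndC.
      by exists f^-1 => //; exact: E1V.
    by rewrite invgM !mulgA mulgV mul1g mulgK.
  left.
  have {}xy : chain (fun z => A z /\ #|T z| <= N - k) E x y.
    by apply: chain_sub xy => // z; rewrite inE unlift_none.
  (* Where the new colour is used, [C] and [T] agree and have exactly [N - k] elements. Hence [C] is
     constant along a chain of that colour, which therefore lies in one piece of an old colour
     [j]. *)
  have CTE z : A z -> #|T z| <= N - k -> C z = T z.
    move=> Az leT; apply/eqP; rewrite eqEcard CT //=.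
    exact: leq_trans leT (cov _ Az).
  have [Ax _] := chain_first xy.
  have /card_gt0P[j Cj] : 0 < #|C x|.
    by apply: leq_trans (cov x Ax); rewrite subn_gt0.
  apply: (bndC j).
  have Ezz : E `<=` E3.
    move=> e /EE1 E1e; exists e => //; exists 1; last by rewrite mulg1.
    by exists 1 => //; exists 1; rewrite ?mulg1.
  elim: xy => [_|{}y z xy IH [Az Tz] Ez]; first exact: Chain0.
  have [Ay Ty] := chain_last xy.
  apply: (ChainS IH _ (Ezz _ Ez)); split=> //.
  have [_ Cjy] := chain_last IH.
  suff -> : C z = C y by [].
  apply/eqP; rewrite eqEcard; apply/andP; split; last first.
    by rewrite (CTE y) //; exact: leq_trans Ty (cov z Az).
  rewrite (CTE y Ay Ty); apply/fintype.subsetP=> l Cl; rewrite inE; apply/asboolP.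
  by exists (y^-1 * z); [exact: EE1 | rewrite mulVKg].
Qed.

(** A point misses at most [k] colours however many there are, which is what makes colourings of a
    base and of a fibre overlap. *)
Lemma dim_le_kdim A k N : dim_le A k -> k < N -> kdim A (N - k) N.
Proof.
move=> dimA; elim: N => // N IH; rewrite ltnS leq_eqVlt => /predU1P[<-|ltkN].
  by rewrite subSnn.
by apply: kdimS => //; exact: IH.
Qed.

End Dimension.

(** A colouring is pulled back along a coarse embedding. In the applications [f] is often no
    morphism: it chooses kernel parts, preimages or Schreier rewritings. *)
Lemma dim_le_coarse (G H : groupType) (f : G -> H) (A : set G) (A' : set H) k :
  (forall x, A x -> A' (f x)) ->
  (forall E, finite_set E -> exists2 E', finite_set E' &
     forall x y, A x -> A y -> E (x^-1 * y) -> E' ((f x)^-1 * f y)) ->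
  (forall E', finite_set E' -> exists2 E, finite_set E &
     forall x y, A x -> A y -> E' ((f x)^-1 * f y) -> E (x^-1 * y)) ->
  dim_le A' k -> dim_le A k.
Proof.
move=> fA fE fV dimA' E /fE[E' finE' EE'].
have [C [B' [/fV[B finB B'B] cov bndC]]] := dimA' _ finE'.
exists (C \o f), B; split=> //= [x Ax|i x y xy]; first exact/cov/fA.
apply: B'B; [by case: (chain_first xy) | by case: (chain_last xy) |].
apply: (bndC i); apply: chain_map xy => [z [Az Cz]|u v [Au _] [Av _]].
- by split=> //; exact: fA.
- exact: EE'.
Qed.

Lemma dim_le_sub (G : groupType) (A A' : set G) k :
  A `<=` A' -> dim_le A' k -> dim_le A k.
Proof. by move=> AA; apply: (@dim_le_coarse _ _ id) => // E ?; exists E. Qed.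

Lemma dim_le_inj (G H : groupType) (f : G -> H) k :
  {morph f : x y / x * y} -> injective f ->
  dim_le [set: H] k -> dim_le [set: G] k.
Proof.
move=> fM f_inj; have f1 : f 1 = 1 by apply: (@mulgI _ (f 1)); rewrite -fM !mulg1.
have fV x : f x^-1 = (f x)^-1.
  by apply: (@mulgI _ (f x)); rewrite -fM !mulgV.
apply: (@dim_le_coarse _ _ f) => //.
- move=> E finE; exists (f @` E); first exact: finite_image.
  by move=> x y _ _ Exy; exists (x^-1 * y) => //; rewrite fM fV.
- move=> E' finE'; exists (f @^-1` E').
    by apply: finite_preimage => // x y _ _; exact: f_inj.
  by move=> x y _ _; rewrite /= fM fV.
Qed.

Section Union.
Variables (G : groupType) (E : set G).

(** A chain in the union visits [S2] with excursions into [S1]. An excursion is displaced by [B1],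
    so successive visits differ by [E] or [E B1 E], which make up [E2]. The order of the quantifiers
    is the point: [E2] depends on [S1] only through [B1], so [S2] can be coloured afterwards at that
    scale. *)
Lemma chain_bounded_setU (B1 : set G) : finite_set E -> finite_set B1 ->
  exists2 E2, finite_set E2 & forall B2, finite_set B2 ->
  exists2 B, finite_set B & forall S1 S2,
   (forall x y, chain S1 E x y -> B1 (x^-1 * y)) ->
   (forall x y, chain S2 E2 x y -> B2 (x^-1 * y)) ->
   forall x y, chain (S1 `|` S2) E x y -> B (x^-1 * y).
Proof.
move=> finE finB1; pose X (A : set G) (B : set G) := [set a * b | a in A & b in B].
pose BE := [set 1] `|` X B1 E; pose EB := [set 1] `|` X E B1.
have finX A B : finite_set A -> finite_set B -> finite_set (X A B).
  exact: finite_set_mulg.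
exists (E `|` X E (X B1 E)).
  by rewrite finite_setU; split=> //; apply: (finX) => //; exact: finX.
move=> B2 finB2; exists (B1 `|` X BE (X B2 EB)).
  rewrite finite_setU; split=> //; apply: (finX); last apply: (finX) => //.
    by rewrite finite_setU; split=> //; exact: finX.
  by rewrite finite_setU; split=> //; exact: finX.
move=> S1 S2 bnd1 bnd2 x y xy.
set E2 := E `|` X E (X B1 E) in bnd2.
(* A chain stays in [S1], or it splits into a start of displacement [BE], an [E2]-chain in [S2] from
   its first visit [u] to its latest visit [v], and perhaps a tail in [S1]. *)
suff: chain S1 E x y \/ exists u v, [/\ BE (x^-1 * u), chain S2 E2 u v &
    v = y \/ exists w, E (v^-1 * w) /\ chain S1 E w y].
  move=> [/bnd1|[u [v [xu /bnd2 uv vy]]]]; first by left.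
  right; exists (x^-1 * u) => //; exists (u^-1 * y); last by rewrite !mulgA mulgK.
  exists (u^-1 * v) => //; exists (v^-1 * y); last by rewrite !mulgA mulgK.
  case: vy => [->|[w [vw wy]]]; first by left; rewrite mulVg.
  right; exists (v^-1 * w) => //; exists (w^-1 * y); last by rewrite !mulgA mulgK.
  exact: bnd1.
elim: xy => [[S1x|S2x]|{}y z xy IH Sz Ez].
- by left; exact: Chain0.
- by right; exists x, x; split; [left; rewrite mulVg|exact: Chain0|left].
case: IH => [IH|[u [v [xu uv vy]]]].
  case: Sz => [S1z|S2z]; first by left; exact: ChainS IH S1z Ez.
  right; exists z, z; split; [|exact: Chain0|by left].
  right; exists (x^-1 * y); first exact: bnd1.
  by exists (y^-1 * z) => //; rewrite !mulgA mulgK.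
case: Sz => [S1z|S2z].
  right; exists u, v; split=> //; right.
  case: vy => [->|[w [vw wy]]].
    by exists z; split=> //; exact: Chain0.
  by exists w; split=> //; exact: ChainS wy S1z Ez.
right; exists u, z; split=> //; last by left.
apply: ChainS uv S2z _; case: vy => [->|[w [vw wy]]]; first by left.
right; exists (v^-1 * w) => //; exists (w^-1 * z); last by rewrite !mulgA mulgK.
exists (w^-1 * y); first exact: bnd1.
by exists (y^-1 * z) => //; rewrite !mulgA mulgK.
Qed.

End Union.

Section Extension.
Variables (G Q : groupType) (p : G -> Q) (h : Q -> G).
Hypotheses (pM : {morph p : x y / x * y}) (hK : cancel h p).

Let p1 : p 1 = 1. Proof. by apply: (@mulgI _ (p 1)); rewrite -pM !mulg1. Qed.

Let pV x : p x^-1 = (p x)^-1.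
Proof. by apply: (@mulgI _ (p x)); rewrite -pM !mulgV. Qed.

(** Differences are left invariant, so right multiplication by one of finitely many inverse lifts is
    a bounded move; it brings the preimage of [B] into the kernel. *)
Lemma dim_le_preimage (B : set Q) k : finite_set B ->
  dim_le [set x | p x = 1] k -> dim_le (p @^-1` B) k.
Proof.
move=> finB; pose X (A : set G) (B : set G) := [set a * b | a in A & b in B].
have finX A1 A2 : finite_set A1 -> finite_set A2 -> finite_set (X A1 A2).
  exact: finite_set_mulg.
have finV (A : set G) : finite_set A -> finite_set [set x^-1 | x in A].
  exact: finite_set_invg.
have finh : finite_set (h @` B) by exact: finite_image.
apply: (@dim_le_coarse _ _ (fun x => x * (h (p x))^-1)).
- by move=> x _; rewrite /= pM pV hK mulgV.
- move=> E finE; exists (X (h @` B) (X E [set x^-1 | x in h @` B])).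
    by apply: (finX) => //; apply: (finX) => //; exact: finV.
  move=> x y Bx By Exy; exists (h (p x)); first by exists (p x).
  exists (x^-1 * y * (h (p y))^-1); last by rewrite invgM invgK !mulgA.
  exists (x^-1 * y) => //; exists (h (p y))^-1 => //.
  by exists (h (p y)) => //; exists (p y).
- move=> E finE; exists (X [set x^-1 | x in h @` B] (X E (h @` B))).
    by apply: (finX); [exact: finV | exact: (finX)].
  move=> x y Bx By Exy; exists (h (p x))^-1.
    by exists (h (p x)) => //; exists (p x).
  exists ((x / h (p x))^-1 * (y / h (p y)) * h (p y)).
    by exists ((x / h (p x))^-1 * (y / h (p y))) => //; exists (h (p y)) => //;
      exists (p y).
  by rewrite invgM invgK !mulgA mulVg mul1g mulgVK.
Qed.

(* Colours that work simultaneously for all the preimages of translates of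
   [R]: cut [Q] into bounded pieces with [m.+1] colours such that distinct
   pieces of the same colour are [R]-far apart, treat the colours one after the
   other, and use for each colour a scale that exceeds the bounds obtained for
   the previous ones. *)
Lemma fibrewise_colouring m k N (E : set G) (R : set Q) :
  dim_le [set: Q] m -> dim_le [set x | p x = 1] k -> k < N ->
  finite_set E -> finite_set R ->
  exists (C : G -> {set 'I_N}) (B : set G),
    [/\ finite_set B, forall x, N - k <= #|C x| & forall i x0 x y,
      chain (fun z => i \in C z /\ R ((p x0)^-1 * p z)) E x y -> B (x^-1 * y)].
Proof.
move=> dimQ dimK ltkN finE finR.
pose RR := [set a^-1 * b | a in R & b in R].
have finRR : finite_set RR by exact: finite_image2.
have [F [finF RRF F1 FV]] := finite_set_symm finRR.
have [c [B1 [finB1 cov bndc]]] := dimQ F finF.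
have {}cov q : exists i, i \in c q by apply/card_gt0P/cov.
pose col q := xchoose (cov q).
have colP q : col q \in c q by exact: xchooseP.
pose piece q q' := chain (fun z => col z = col q) F q q'.
pose rep q := xget 1 [set q' | piece q q'].
have rep_piece q : piece q (rep q).
  by apply: (@xgetI _ 1 [set z | piece q z] q); exact: Chain0.
have repE q q' : col q = col q' -> F (q^-1 * q') -> rep q = rep q'.
  move=> Ecol Fqq'; have qq' : piece q q'.
    by apply: ChainS (Chain0 _ (erefl _)) _ Fqq'; rewrite Ecol.
  have Fsym : chain (fun z => col z = col q) F = chain (fun z => col z = col q') F.
    by rewrite Ecol.
  congr xget; apply/seteqP; split=> z; rewrite /= /piece; rewrite Fsym => qz.
    by apply: chain_trans qz; apply: chain_sym => //; rewrite -Fsym.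
  by apply: chain_trans qz; rewrite -Fsym.
have repB q : B1 ((rep q)^-1 * q).
  apply: (bndc (col q)); have : piece q (rep q) by [].
  by move/(chain_sym FV); apply: chain_sub => // z <-; split.
suff IH a : exists (C : G -> {set 'I_N}) (B : set G), [/\ finite_set B,
    forall x, col (p x) < a -> N - k <= #|C x| & forall i x0 x y,
    chain (fun z => [/\ col (p z) < a, i \in C z & R ((p x0)^-1 * p z)]) E x y ->
      B (x^-1 * y)].
  have [C [B [finB Ccov Cbnd]]] := IH m.+1; exists C, B; split=> // [x|i x0 x y xy].
    exact: Ccov.
  by apply: (Cbnd i x0); apply: chain_sub xy => // z [].
elim: a => [|a [C [B [finB Ccov Cbnd]]]].
  exists (fun=> finset.set0), set0; split=> // i x0 x y xy.
  by case: (chain_first xy).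
have [E2 finE2 union2] := chain_bounded_setU finE finB.
have [D [B2 [finB2 Dcov Dbnd]]] :=
  dim_le_kdim (dim_le_preimage finB1 dimK) ltkN finE2.
have [B' finB' bndB'] := union2 _ finB2.
(* Left translation by a lift of the base point of the piece brings all pieces over the one finite
   set [B1] and leaves differences within a piece unchanged, so a single colouring [D] serves them
   all. *)
pose shift x := (h (rep (p x)))^-1 * x.
exists (fun x => if col (p x) == a :> nat then D (shift x) else C x), B'.
split=> // [x|i x0 x y xy].
  rewrite ltnS leq_eqVlt; case: eqP => [_ _|_ /= lt_a]; last exact: Ccov.
  by apply: Dcov; rewrite /shift /= pM pV hK.
apply: (bndB' [set z | [/\ col (p z) < a, i \in C z & R ((p x0)^-1 * p z)]]
  [set z | [/\ col (p z) = a :> nat, i \in D (shift z) & R ((p x0)^-1 * p z)]]).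
- exact: Cbnd.
- move=> {xy}x {}y xy.
  have sh u v : col (p u) = a :> nat /\ R ((p x0)^-1 * p u) ->
      col (p v) = a :> nat /\ R ((p x0)^-1 * p v) ->
      (shift u)^-1 * shift v = u^-1 * v.
    move=> [cu Ru] [cv Rv]; rewrite /shift (repE (p u) (p v)).
    + by rewrite invgM !mulgA mulgVK.
    + by apply: val_inj; rewrite /= cu cv.
    + apply: RRF; exists ((p x0)^-1 * p u) => //; exists ((p x0)^-1 * p v) => //.
      by rewrite invgM invgK !mulgA mulgK.
  rewrite -sh; last 2 first.
  + by case: (chain_first xy).
  + by case: (chain_last xy).
  apply: (Dbnd i); apply: chain_map xy => [z [cz Dz Rz]|u v [cu _ Ru] [cv _ Rv]].
    by split=> //; rewrite /shift /= pM pV hK.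
  by rewrite sh.
- apply: chain_sub xy => // z [cz Cz Rz].
  move: cz Cz; rewrite ltnS leq_eqVlt; case: eqP => [cz _ Dz|_ /= cz Cz].
    by right.
  by left.
Qed.

(** Of [m + k + 1] colours each point gets at least [m + 1] from the fibrewise colouring and [k + 1]
    from the base, so some colour is shared. A chain of shared colour projects into one piece of the
    base, hence over a translate of [R], where the fibrewise bound applies. *)
Theorem dim_le_extension m k :
  dim_le [set: Q] m -> dim_le [set x | p x = 1] k -> dim_le [set: G] (m + k).
Proof.
move=> dimQ dimK E finE; pose N := (m + k).+1.
have [|c [R [finR ccov cbnd]]] :=
  dim_le_kdim (N := N) dimQ _ (finite_image p finE).
  by rewrite ltnS leq_addr.
have [|C [B [finB Ccov Cbnd]]] :=
  fibrewise_colouring (N := N) dimQ dimK _ finE finR.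
  by rewrite ltnS leq_addl.
exists (fun x => C x :&: c (p x))%SET, B; split=> // [x _|i x y xy].
  rewrite card_gt0; apply/eqP=> E0.
  have := max_card (C x :|: c (p x))%SET.
  rewrite cardsU E0 cards0 subn0 card_ord leqNgt; apply/negP/negPn.
  apply: leq_trans (leq_add (Ccov x) (ccov (p x) I)).
  have -> : N - k = m.+1 by rewrite /N -addSn addnK.
  have -> : N - m = k.+1 by rewrite /N -addnS addKn.
  by rewrite addSn addnS.
apply: (Cbnd i x).
elim: xy => [[_ ix]|{}y z xy IH [_ iz] Ez].
  apply: Chain0; move: ix; rewrite inE => /andP[Cx cx]; split=> //.
  by apply: (cbnd i); exact: Chain0.
apply: (ChainS IH _ Ez); have [Cz cz] : i \in C z /\ i \in c (p z).
  by apply/andP; move: iz; rewrite inE.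
split=> //; apply: (cbnd i).
have : chain (fun z => [set: G] z /\ i \in (C z :&: c (p z))%SET) E x z.
  exact: ChainS xy _ Ez.
apply: chain_map => [w [_]|u v _ _ Euv]; first by rewrite inE => /andP[].
by exists (u^-1 * v) => //; rewrite pM pV.
Qed.

End Extension.

(** * Comparison with word metrics *)

Section WordMetric.
Variables (G : groupType) (T : generating_set G).

Lemma finite_word_ball r : finite_set [set g | word_length T g <= r].
Proof.
pose F := fix F n := if n is m.+1
  then F m `|` [set a * b | a in (T : set G) & b in F m] else [set 1].
have finF n : finite_set (F n).
  elim: n => //= n IH; rewrite finite_setU; split=> //.
  exact: finite_set_mulg (gens_finite T) IH.
apply: sub_finite_set (finF r) => g /=.
rewrite /word_length; case: ex_minnP => n /asboolP[w [<- Tw <-]] _ lewr.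
have monoF a b : a <= b -> F a `<=` F b.
  elim: b => [|b IH]; first by rewrite leqn0 => /eqP->.
  by rewrite leq_eqVlt => /predU1P[->//|/IH sub] x /sub; left.
apply: monoF lewr _ _; elim: w Tw => [|a w IH] Tw; first by rewrite big_nil.
rewrite big_cons; right; exists a; first by apply: Tw; rewrite mem_head.
exists (\prod_(j <- w) j) => //.
by apply: IH => x xw; apply: Tw; rewrite inE xw orbT.
Qed.

Lemma word_length_bounded (B : set G) : finite_set B ->
  exists D, forall g, B g -> word_length T g <= D.
Proof.
move=> /finite_seqP[s ->]; exists (\max_(g <- s) word_length T g)%N => g /= gs.
exact: leq_bigmax_seq.
Qed.

End WordMetric.

(** The scale [E] holds the differences of any two points of an [r]-ball, so the points of a ball
    that share a colour lie in one chain component: a ball meets at most one piece per colour. *)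
Lemma dim_le_asdim (G : groupType) k : dim_le [set: G] k -> asdim_le G k.
Proof.
move=> dimG T r; pose ball := [set g | word_length T g <= r].
pose E := [set a^-1 * b | a in ball & b in ball].
have finE : finite_set E by apply: finite_image2; exact: finite_word_ball.
have [C [B [finB cov bnd]]] := dimG E finE.
pose comp (i : 'I_k.+1) x := chain (fun z => [set: G] z /\ i \in C z) E x.
have [D leD] := word_length_bounded T finB.
exists ('I_k.+1 * set G)%type,
  (fun a => [set x | a.1 \in C x /\ a.2 = comp a.1 x]); split.
- by move=> x; have /card_gt0P[i Ci] := cov x I; exists (i, comp i x).
- exists D => -[i S] x y /= [Cx ->] [Cy Exy]; apply: leD; apply: (bnd i).
  by rewrite -/(comp i x) Exy; exact: Chain0.
- move=> x; apply/pcard_leP/injfunPex.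
  exists (fun a => val a.1) => [[i S] _ /=|[i S] [j S']]; first exact: ltn_ord.
  rewrite !inE /= => -[y [Cy ->] xy] [z [Cz ->] xz] /val_inj Eij.
  rewrite -{j}Eij in Cz *; congr pair.
  have step u v : i \in C u -> i \in C v -> word_metric T x u <= r ->
      word_metric T x v <= r -> comp i v `<=` comp i u.
    move=> Cu Cv xu xv w; apply: chain_trans.
    apply: ChainS (Chain0 _ (conj I Cu)) (conj I Cv) _.
    exists (x^-1 * u) => //; exists (x^-1 * v) => //.
    by rewrite invgM invgK !mulgA mulgK.
  by apply/seteqP; split; apply: step.
Qed.

(** * Presentations, actions and free groups *)

Section Morphism.
Variables (G H : groupType) (f : G -> H).
Hypothesis fM : {morph f : x y / x * y}.

Lemma morph1g : f 1 = 1.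
Proof. by apply: (@mulgI _ (f 1)); rewrite -fM !mulg1. Qed.

Lemma morphVg x : f x^-1 = (f x)^-1.
Proof. by apply: (@mulgI _ (f x)); rewrite -fM !mulgV morph1g. Qed.

Lemma morphXg x k : f (x ^+ k) = f x ^+ k.
Proof. by elim: k => [|k IH]; rewrite ?morph1g // !expgS fM IH. Qed.

Lemma morph_prodg k (s : nat -> G) :
  f (\prod_(i < k) s i) = \prod_(i < k) f (s i).
Proof.
by elim: k => [|k IH]; rewrite ?big_ord0 ?morph1g // !big_ord_recr /= fM IH.
Qed.

End Morphism.

Section Presentation.
Variables (X : choiceType) (R : seq (letter X) -> seq (letter X) -> Prop).
Local Notation G := (presented_group R).
Implicit Types (u v w : seq (letter X)) (x y : G).

Lemma pres_classM u v : pres_class R (u ++ v) = pres_class R u * pres_class R v.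
Proof. by symmetry; exact: pres_mulE. Qed.

Lemma pres_class1 : pres_class R [::] = 1. Proof. by []. Qed.

Lemma pres_classV a : pres_class R [:: inv_letter a] = (pres_class R [:: a])^-1.
Proof. by symmetry; exact: pres_invE. Qed.

Lemma pres_ind (P : G -> Prop) :
  P 1 -> (forall a x, P x -> P (pres_class R [:: a] * x)) -> forall x, P x.
Proof.
move=> P1 PM x; rewrite -[x]pres_class_repr.
by elim: (repr x) => [|a w IH]; rewrite ?pres_class1 // -cat1s pres_classM; apply: PM.
Qed.

Section Evaluation.
Variables (H : groupType) (g : X -> H).

Definition eval_word w := \prod_(a <- w) (if a.2 then (g a.1)^-1 else g a.1).

Lemma eval_word_cat u v : eval_word (u ++ v) = eval_word u * eval_word v.
Proof. exact: big_cat. Qed.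

Definition pres_hom x := eval_word (repr x).

Hypothesis gR : forall u v, R u v -> eval_word u = eval_word v.

Lemma pres_homE w : pres_hom (pres_class R w) = eval_word w.
Proof.
suff H0 u v : pres_eq R u v -> eval_word u = eval_word v by exact/H0/pres_eq_repr.
elim=> // {u v} [v u s _ -> _ ->|u u' v v' _ IHu _ IHv|[a []]] //.
- by rewrite !eval_word_cat IHu IHv.
- by rewrite /eval_word !big_cons big_nil /= mulg1 mulVg.
- by rewrite /eval_word !big_cons big_nil /= mulg1 mulgV.
Qed.

Lemma pres_homM : {morph pres_hom : x y / x * y}.
Proof.
move=> x y; rewrite -[x]pres_class_repr -[y]pres_class_repr.
by rewrite -pres_classM !pres_homE eval_word_cat.
Qed.

End Evaluation.

Section Action.
Variables (T : Type) (f f' : X -> T -> T).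

Definition act_letter (a : letter X) := if a.2 then f' a.1 else f a.1.
Definition act_word w t := foldr act_letter t w.
Definition pres_act x t := act_word (repr x) t.

Hypotheses (ff' : forall a, cancel (f' a) (f a)) (f'f : forall a, cancel (f a) (f' a)).
Hypothesis fR : forall u v, R u v -> forall t, act_word u t = act_word v t.

Lemma act_word_cat u v t : act_word (u ++ v) t = act_word u (act_word v t).
Proof. exact: foldr_cat. Qed.

Lemma pres_actE w t : pres_act (pres_class R w) t = act_word w t.
Proof.
suff H0 u v : pres_eq R u v -> forall s, act_word u s = act_word v s.
  exact/H0/pres_eq_repr.
elim=> [//|{}u {}v _ IH s|{}v {}u {}w _ IH1 _ IH2 s|{}u u' {}v v' _ IHu _ IHv s|[a []] s|//].
- by rewrite IH.
- by rewrite IH1.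
- by rewrite !act_word_cat IHu IHv.
- exact: f'f.
- exact: ff'.
Qed.

Lemma pres_actM x y t : pres_act (x * y) t = pres_act x (pres_act y t).
Proof.
rewrite -[x]pres_class_repr -[y]pres_class_repr.
by rewrite -pres_classM !pres_actE act_word_cat.
Qed.

Lemma pres_act1 t : pres_act 1 t = t. Proof. exact: (pres_actE [::]). Qed.

End Action.

End Presentation.

(* Presentations with generators numbered by [0, ..., n - 1]; out of range
   [gen R k] is 1. *)
Section NumberedGenerators.
Variables (n : nat) (R : seq (letter 'I_n) -> seq (letter 'I_n) -> Prop).
Local Notation G := (presented_group R).

Definition gen (k : nat) : G :=
  if insub k is Some i then pres_class R [:: (i, false)] else 1.

Lemma gen_ord (i : 'I_n) : gen i = pres_class R [:: (i, false)].
Proof. by rewrite /gen valK. Qed.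

Lemma gen_ordV (i : 'I_n) : (gen i)^-1 = pres_class R [:: (i, true)].
Proof. by rewrite gen_ord -pres_classV. Qed.

Lemma gen_ind (P : G -> Prop) : P 1 ->
  (forall k x, k < n -> P x -> P (gen k * x)) ->
  (forall k x, k < n -> P x -> P ((gen k)^-1 * x)) -> forall x, P x.
Proof.
move=> P1 Pg PV; apply: pres_ind => // -[i []] x Px.
- by rewrite -gen_ordV; exact: PV.
- by rewrite -gen_ord; exact: Pg.
Qed.

Lemma gen_morph_ext (H : groupType) (f g : G -> H) :
  {morph f : x y / x * y} -> {morph g : x y / x * y} ->
  (forall k, k < n -> f (gen k) = g (gen k)) -> f =1 g.
Proof.
move=> fM gM fg; apply: gen_ind => [|k x ltkn IH|k x ltkn IH].
- by rewrite !morph1g.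
- by rewrite fM gM IH fg.
- by rewrite fM gM IH !morphVg // fg.
Qed.

Lemma eval_word_gen w :
  eval_word (fun i : 'I_n => gen i) w = pres_class R w.
Proof.
elim: w => [|[i b] w IH]; first by rewrite /eval_word big_nil.
rewrite -cat1s eval_word_cat IH pres_classM; congr (_ * _).
by rewrite /eval_word big_seq1 /=; case: b; rewrite ?gen_ordV ?gen_ord.
Qed.

Definition gen_hom (H : groupType) (g : nat -> H) : G -> H :=
  pres_hom (fun i : 'I_n => g i).

Section Homomorphism.
Variables (H : groupType) (g : nat -> H).
Hypothesis gR : forall u v, R u v ->
  eval_word (fun i : 'I_n => g i) u = eval_word (fun i : 'I_n => g i) v.

Lemma gen_homM : {morph gen_hom g : x y / x * y}.
Proof. exact: pres_homM. Qed.

Lemma gen_homE k : k < n -> gen_hom g (gen k) = g k.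
Proof.
move=> ltkn; rewrite -[k]/(val (Ordinal ltkn)) gen_ord /gen_hom pres_homE //.
by rewrite /eval_word big_seq1.
Qed.

End Homomorphism.

Definition gen_act (T : Type) (f f' : nat -> T -> T) : G -> T -> T :=
  pres_act (fun i : 'I_n => f i) (fun i : 'I_n => f' i).

Section GenAction.
Variables (T : Type) (f f' : nat -> T -> T).
Hypotheses (ff' : forall k, k < n -> cancel (f' k) (f k))
           (f'f : forall k, k < n -> cancel (f k) (f' k)).
Hypothesis fR : forall u v, R u v -> forall t,
  act_word (fun i : 'I_n => f i) (fun i : 'I_n => f' i) u t =
  act_word (fun i : 'I_n => f i) (fun i : 'I_n => f' i) v t.

Let ff'o (i : 'I_n) : cancel (f' i) (f i). Proof. exact: ff'. Qed.
Let f'fo (i : 'I_n) : cancel (f i) (f' i). Proof. exact: f'f. Qed.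

Lemma gen_actM x y t : gen_act f f' (x * y) t = gen_act f f' x (gen_act f f' y t).
Proof. exact: pres_actM. Qed.

Lemma gen_act1 t : gen_act f f' 1 t = t. Proof. exact: pres_act1. Qed.

Lemma gen_actE k t : k < n -> gen_act f f' (gen k) t = f k t.
Proof. by move=> ltkn; rewrite -[k]/(val (Ordinal ltkn)) gen_ord /gen_act pres_actE. Qed.

Lemma gen_actVE k t : k < n -> gen_act f f' (gen k)^-1 t = f' k t.
Proof. by move=> ltkn; rewrite -[k]/(val (Ordinal ltkn)) gen_ordV /gen_act pres_actE. Qed.

End GenAction.

End NumberedGenerators.

Section CoxeterRelations.
Variables (n : nat).
Implicit Types (P : seq (letter 'I_n) -> seq (letter 'I_n) -> Prop).
Local Notation pw := positive_word.

(** The form in which relations are checked throughout: [P] is an equality of values or of actions,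
    and its symmetry leaves only pairs [i < j]. *)
Lemma path_relP (e : nat -> nat) (e2 : forall k, 2 <= e k) P :
  (forall u v, P u v -> P v u) ->
  (forall k, k.+1 < n -> e k = 3 \/ e k = 4) ->
  (forall i j : 'I_n, i.+1 < j -> P (pw [:: i; j]) (pw [:: j; i])) ->
  (forall i j : 'I_n, j = i.+1 :> nat -> e i = 3 ->
    P (pw [:: i; j; i]) (pw [:: j; i; j])) ->
  (forall i j : 'I_n, j = i.+1 :> nat -> e i = 4 ->
    P (pw [:: i; j; i; j]) (pw [:: j; i; j; i])) ->
  forall u v, artin_rel (path_coxeter e2 n) u v -> P u v.
Proof.
move=> Psym e34 P2 P3 P4 u v [i [j [m [neq [<-] -> ->]]]].
wlog ltij : i j neq / i < j => [th|].
  case: (ltngtP i j) => [||/val_inj eij]; first exact: th.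
    move=> ltji; have neq' : j != i by rewrite eq_sym.
    have /Psym := th j i neq' ltji.
    have := path_coxeter_sym e i j.
    by rewrite /path_coxeter_fun => -[->].
  by rewrite eij eqxx in neq.
rewrite (negPf neq); case: (eqVneq (val j) i.+1) => [Eji|neji].
  have lt_i : i.+1 < n by rewrite -Eji; exact: ltn_ord.
  by case: (e34 i lt_i) => ei; rewrite ei; [exact: P3 | exact: P4].
have -> : (val i == j.+1) = false by apply/negbTE; rewrite neq_ltn ltnS (ltnW ltij).
by apply: P2; rewrite ltn_neqAle eq_sym neji.
Qed.

Lemma cycle_relP P : 2 < n ->
  (forall u v, P u v -> P v u) ->
  (forall i j : 'I_n, i.+1 < j -> (i > 0) || (j.+1 < n) ->
    P (pw [:: i; j]) (pw [:: j; i])) ->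
  (forall i j : 'I_n, j = i.+1 :> nat -> P (pw [:: i; j; i]) (pw [:: j; i; j])) ->
  (forall i j : 'I_n, i = 0 :> nat -> j.+1 = n -> P (pw [:: i; j; i]) (pw [:: j; i; j])) ->
  forall u v, artin_rel (coxeter_affine_A n) u v -> P u v.
Proof.
move=> n2 Psym P2 P3 P0 u v [i [j [m [neq [<-] -> ->]]]].
wlog ltij : i j neq / i < j => [th|].
  case: (ltngtP i j) => [||/val_inj eij]; first exact: th.
    move=> ltji; have neq' : j != i by rewrite eq_sym.
    have /Psym := th j i neq' ltji.
    have := cycle_coxeter_sym i j.
    by rewrite /cycle_coxeter_fun => -[->].
  by rewrite eij eqxx in neq.
rewrite (negPf neq) -!val_eqE /=.
have ltSi : i.+1 < n by exact: leq_ltn_trans ltij _.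
rewrite (modn_small ltSi); case: eqP => [Eji|/eqP neji]; first exact: P3.
case: (ltnP j.+1 n) => [ltSj|geSj].
  rewrite (modn_small ltSj) (ltn_eqF (leqW ltij)).
  by apply: P2; rewrite ?ltSj ?orbT // ltn_neqAle eq_sym neji.
have ESj : j.+1 = n by apply/eqP; rewrite eqn_leq ltn_ord.
rewrite ESj modnn; case: eqP => [i0|/eqP i0]; first exact: P0.
by apply: P2; rewrite ?lt0n ?i0 // ltn_neqAle eq_sym neji.
Qed.

End CoxeterRelations.

(** * Free groups: normal forms, centre and dimension *)

Definition free_group k := presented_group (fun _ _ : seq (letter 'I_k) => False).
HB.instance Definition _ k := Group.on (free_group k).

Section FreeGroup.
Variable k : nat.
Local Notation F := (free_group k).
Local Notation L := (letter 'I_k).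
Implicit Types (a b c : L) (s t u : seq L) (x y : F).

Definition reduced s := sorted (fun a b => b != inv_letter a) s.

Definition push a s :=
  if s is b :: s' then if b == inv_letter a then s' else a :: s else [:: a].

Lemma push_reduced a s : reduced s -> reduced (push a s).
Proof.
case: s => //= b s bs; case: ifP => [_|/negbT ab]; first exact: path_sorted bs.
by rewrite /= ab.
Qed.

Lemma pushK a s : reduced s -> push (inv_letter a) (push a s) = s.
Proof.
case: s => [|b s] /=; first by rewrite inv_letterK eqxx.
case: (eqVneq b (inv_letter a)) => [->|_] /=; last by rewrite inv_letterK eqxx.
by case: s => //= c s /andP[/negPf->].
Qed.

(** Van der Waerden's trick: pushing a letter permutes the reduced words, so the free group acts on
    them, and the image of the empty word is a normal form. *)
Definition reduced_push a (s : {s | reduced s}) : {s | reduced s} :=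
  exist _ (push a (val s)) (push_reduced a (valP s)).

Let pushf (i : 'I_k) := reduced_push (i, false).
Let pushf' (i : 'I_k) := reduced_push (i, true).

Let pushfK i : cancel (pushf i) (pushf' i).
Proof. by move=> s; apply: val_inj; exact: (@pushK (i, false) _ (valP s)). Qed.

Let pushf'K i : cancel (pushf' i) (pushf i).
Proof. by move=> s; apply: val_inj; exact: (@pushK (i, true) _ (valP s)). Qed.

Definition normal_form x : seq L := val (pres_act pushf pushf' x (exist _ [::] isT)).

Lemma normal_form_mul s x :
  normal_form (pres_class _ s * x) = foldr push (normal_form x) s.
Proof.
rewrite /normal_form pres_actM // pres_actE //.
elim: s => //= -[i b] s <-.
by case: b.
Qed.

Lemma normal_formE s : normal_form (pres_class _ s) = foldr push [::] s.
Proof. by rewrite -[pres_class _ s]mulg1 normal_form_mul /normal_form pres_act1. Qed.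

Lemma normal_form_reduced x : reduced (normal_form x).
Proof. exact: valP. Qed.

Lemma normal_formK x : pres_class _ (normal_form x) = x.
Proof.
elim/pres_ind: x => [|a x IH]; first by rewrite -(pres_class1 (fun _ _ => False)) normal_formE.
rewrite normal_form_mul /=; move: IH; case: (normal_form x) => [<-|b s <-] /=.
  by rewrite -pres_classM.
rewrite -pres_classM /=; case: eqP => // ->.
by rewrite -(cat1s a) -(cat1s (inv_letter a)) !pres_classM pres_classV mulVKg.
Qed.

(** Letters are pushed from the inner end of a reduced word. The only possible cancellation is that
    of [c] with the last letter, so it could reach [a] only for [s] empty, which [c.1 != a.1]
    excludes. *)
Lemma head_push_word a s c : reduced (a :: s) -> c.1 != a.1 ->
  exists t, foldr push [:: c] (a :: s) = a :: t.
Proof.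
move=> red_as nca.
suff H s0 b : reduced (b :: s0) ->
    (exists t, foldr push [:: c] (b :: s0) = b :: t) \/
    (foldr push [:: c] (b :: s0) = [::] /\ (s0 = [::] /\ c = inv_letter b)).
  by case: (H s a red_as) => // -[_ [_ Ec]]; rewrite Ec eqxx in nca.
elim: s0 b => [|d s0 IH] b /=.
  by case: eqP => [->|_ _]; [right | left; exists [:: c]].
move=> /andP[db red]; case: (IH d red) => [[t /= ->] /=|[/= -> _]].
  by rewrite (negPf db); left; exists (d :: t).
by left; exists [::].
Qed.

(** If the normal form of [x] starts with [a], take a letter [c] over another generator: [x * c]
    still starts with [a], whereas [c * x] starts with [c]. *)
Lemma free_group_center x : 1 < k -> (forall y, x * y = y * x) -> x = 1.
Proof.
move=> k2 xC; rewrite -[x]normal_formK.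
have := normal_form_reduced x.
case Enf: (normal_form x) => [|a s] // red_as.
pose i0 := Ordinal (ltnW k2); pose i1 := Ordinal k2.
pose c : L := (if a.1 == i0 then i1 else i0, false).
have nca : c.1 != a.1 by rewrite /c /=; case: (eqVneq a.1 i0) => [->|]; rewrite // eq_sym.
have := congr1 normal_form (xC (pres_class _ [:: c])).
rewrite normal_form_mul /= Enf -{1}[x]normal_formK Enf normal_form_mul normal_formE.
have [t ->] := head_push_word red_as nca; rewrite /=.
case: (eqVneq a (inv_letter c)) => [ac|_ [ac]]; last by rewrite ac eqxx in nca.
by rewrite ac eqxx in nca.
Qed.

Lemma free_group_inner_inj x y : 1 < k ->
  (forall z, x * z * x^-1 = y * z * y^-1) -> x = y.
Proof.
move=> k2 xy; apply: (@mulgI _ y^-1); rewrite mulVg; apply: free_group_center => // z.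
apply: (@mulgI _ y); apply: (@mulIg _ x^-1).
by rewrite !mulgA mulgV mul1g mulgK xy.
Qed.

Lemma size_push a s : size (push a s) <= (size s).+1 /\ size s <= (size (push a s)).+1.
Proof. by case: s => //= b s; case: ifP => _ /=; split=> //; rewrite ltnW. Qed.

Definition tail m s := drop (size s - m) s.

Lemma tail_push m a s : m < size s -> tail m (push a s) = tail m s.
Proof.
rewrite /tail; case: s => //= b s; rewrite ltnS => lems.
by case: ifP => _ /=; rewrite subSn ?(leqW lems) // subSn.
Qed.

Lemma push_word s u : [/\ size (foldr push s u) <= size u + size s,
  size s <= size u + size (foldr push s u) &
  forall m, m + size u <= size s -> tail m (foldr push s u) = tail m s].
Proof.
elim: u => [|a u [IH1 IH2 IH3]]; first by split.
have [ps1 ps2] := size_push a (foldr push s u).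
split=> /= [||m le_m].
- exact: leq_trans ps1 _.
- by apply: leq_trans IH2 _; rewrite addSnnS leq_add2l.
- rewrite addnS in le_m.
  rewrite tail_push; first by rewrite IH3 // ltnW.
  by rewrite -(leq_add2l (size u)) addnS addnC (leq_trans le_m).
Qed.

Lemma finite_short_words n : finite_set [set (pres_class _ s : F) | s in [set s : seq L | size s <= n]].
Proof.
pose W := fix W n : set F := if n is m.+1 then
  W m `|` [set a * b | a in range (fun a => pres_class _ [:: a] : F) & b in W m]
  else [set 1].
have finW m : finite_set (W m).
  elim: m => //= m IH; rewrite finite_setU; split=> //.
  apply: finite_set_mulg => //; apply: finite_image.
  exact: (@finite_finset ('I_k * bool)%type).
apply: sub_finite_set (finW n) => _ [s /= les <-].
elim: n s les => [|n IH] [|a s] //= les; first by left; apply: (IH [::]).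
right; exists (pres_class _ [:: a]); first by exists a.
by exists (pres_class _ s); [exact: IH | rewrite -pres_classM].
Qed.

(* The Cayley graph is a tree: cut it into annuli around [1]; the elements of
   an annulus that are close to each other share a long prefix. *)
Lemma dim_le_free_group : dim_le [set: F] 1.
Proof.
(* Differences act on the right end of [x]. Inverting puts that end at the head of the list, where
   letters are pushed, and turns a common prefix into a common [tail]. *)
move=> E finE; pose nf x := normal_form x^-1.
have [r lt_r] : exists r, forall e, E e -> size (nf e) <= r.
  move/finite_seqP: finE => [s ->]; exists (\max_(e <- s) size (nf e))%N.
  by move=> e /= es; exact: leq_bigmax_seq.
have step x y : E (x^-1 * y) -> [/\ size (nf y) <= r + size (nf x),
    size (nf x) <= r + size (nf y) &
    forall m, m + r <= size (nf x) -> tail m (nf y) = tail m (nf x)].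
  move=> /lt_r; set e := x^-1 * y => le_e.
  have -> : nf y = foldr push (nf x) (nf e).
    by rewrite -normal_form_mul normal_formK /e invgM invgK mulgK.
  have [p1 p2 p3] := push_word (nf x) (nf e); split.
  - by apply: leq_trans p1 _; rewrite leq_add2r.
  - by apply: leq_trans p2 _; rewrite leq_add2r.
  - by move=> m le_m; apply: p3; apply: leq_trans le_m; rewrite leq_add2l.
pose annulus x := (size (nf x) %/ r.+1)%N.
pose short := [set (pres_class _ s : F) | s in [set s : seq L | size s <= r.+1 + r]].
have annS (l l1 : nat) : l <= r + l1 -> l %/ r.+1 <= (l1 %/ r.+1).+1.
  move=> le_l; rewrite -ltnS ltn_divLR // mulSn.
  apply: leq_ltn_trans le_l _; rewrite addSn ltnS leq_add2l.
  exact/ltnW/ltn_ceil.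
exists (fun x => [set i : 'I_2 | odd (annulus x) == odd i]%SET),
  [set a * b | a in short & b in [set b^-1 | b in short]]; split.
- apply: finite_set_mulg; last apply: finite_set_invg; exact: finite_short_words.
- move=> x _; apply/card_gt0P; exists (inord (odd (annulus x))).
  by rewrite inE inordK; case: odd.
move=> i x y xy.
(* Words of the annulus have length at least [annulus x * r.+1] and a step touches at most [r]
   letters at the head, so a tail of this length never changes; truncated subtraction makes it empty
   in annulus 0. *)
have [Ea Et] : annulus y = annulus x /\
    tail (annulus x * r.+1 - r) (nf y) = tail (annulus x * r.+1 - r) (nf x).
  elim: xy => // {}y z xy [IHa IHt] [_ iz] Eyz.
  have [_ iy] := chain_last xy.
  have [s1 s2 s3] := step _ _ Eyz.
  have odd_yz : odd (annulus z) = odd (annulus y).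
    by move: iz iy; rewrite !inE => /eqP-> /eqP->.
  have Ea : annulus z = annulus y.
    have := annS _ _ s1; have := annS _ _ s2; rewrite -/(annulus y) -/(annulus z).
    rewrite leq_eqVlt => /predU1P[E1|lt1]; first by rewrite E1 /= in odd_yz; case: odd odd_yz.
    rewrite leq_eqVlt => /predU1P[E1|lt2]; first by rewrite E1 /= in odd_yz; case: odd odd_yz.
    by apply/eqP; rewrite eqn_leq -ltnS lt2 -ltnS lt1.
  split; first by rewrite Ea.
  rewrite -IHt; case: (leqP (annulus x * r.+1) r) => [le_r|lt_r'].
    by move: le_r; rewrite -subn_eq0 => /eqP->; rewrite /tail !subn0 !drop_size.
  by apply: s3; rewrite subnK ?(ltnW lt_r') // -IHa leq_divM.
pose m := (annulus x * r.+1 - r)%N; pose t := tail m (nf x).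
have headP z : annulus z = annulus x -> tail m (nf z) = t ->
    exists2 u, size u <= r.+1 + r & z = (pres_class _ (u ++ t))^-1.
  move=> Ez tz; exists (take (size (nf z) - m) (nf z)).
    rewrite size_take_min; apply: leq_trans (geq_minl _ _) _.
    have lt_z : size (nf z) < annulus x * r.+1 + r.+1.
      by rewrite -Ez -mulSnr; exact: ltn_ceil.
    rewrite leq_subLR; apply: leq_trans (ltnW lt_z) _.
    by rewrite addnCA [leqLHS]addnC leq_add2l addnC -leq_subLR.
  by rewrite -tz /tail cat_take_drop normal_formK invgK.
have [u ux ->] := headP x (erefl _) (erefl _).
have [v vy ->] := headP y Ea Et.
rewrite invgK !pres_classM invgM mulgA mulgK.
exists (pres_class _ u); first by exists u.
by exists (pres_class _ v)^-1 => //; exists (pres_class _ v) => //; exists v.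
Qed.

End FreeGroup.

(** * Braid relations *)

Section Commute.
Variable H : groupType.
Implicit Types a b c d r x y z : H.

Lemma commuteAC x y z : commute x y -> z * x * y = z * y * x.
Proof. by move=> xy; rewrite -mulgA xy mulgA. Qed.

Lemma intertwine_commute r a a' b b' :
  r * a = a' * r -> r * b = b' * r -> commute a b -> commute a' b'.
Proof.
move=> ra rb ab; apply: (@mulIg _ r).
by rewrite -!mulgA -rb -ra !mulgA -ra -rb -!mulgA ab.
Qed.

Lemma intertwineV r a a' : r * a = a' * r -> r * a^-1 = a'^-1 * r.
Proof. by move=> ra; apply: (@mulIg _ a); rewrite mulgVK -mulgA ra mulKg. Qed.

Lemma intertwineM r a a' b b' :
  r * a = a' * r -> r * b = b' * r -> r * (a * b) = a' * b' * r.
Proof. by move=> ra rb; rewrite mulgA ra -mulgA rb mulgA. Qed.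

Lemma intertwine_prod r (f g : nat -> H) n :
  (forall i, i < n -> r * f i = g i * r) ->
  r * (\prod_(i < n) f i) = (\prod_(i < n) g i) * r.
Proof.
elim: n => [|n IH] rfg; first by rewrite !big_ord0 mulg1 mul1g.
rewrite !big_ord_recr /=; apply: intertwineM; last exact: rfg.
by apply: IH => i lt_i; apply: rfg; rewrite ltnW.
Qed.

Lemma commute_prod_ord x (f : nat -> H) n :
  (forall i, i < n -> commute x (f i)) -> commute x (\prod_(i < n) f i).
Proof. exact: intertwine_prod. Qed.

Definition braid3 a b := a * b * a = b * a * b.
Definition braid4 a b := a * b * a * b = b * a * b * a.

(** [a * b] conjugates [a] to [b], and the other element to [c]. *)
Lemma braid3_conj a b c : braid3 a b -> commute b c ->
  commute a (b^-1 * (a^-1 * c * a) * b).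
Proof.
move=> ab bc; rewrite /commute; apply: (@mulgI _ (a * b)); rewrite !mulgA.
rewrite [a * b * a]ab !mulgK mulgV mul1g bc.
by rewrite -!mulgA; congr (_ * _); rewrite !mulgA.
Qed.

End Commute.

Section Systems.
Variable H : groupType.
Implicit Types (s : nat -> H) (n : nat).

(* Images of the standard generators of the Artin groups of types A_n and B_n
   (with the label 4 on the edge {0, 1}). *)
Definition A_system n s :=
  (forall i j, i.+1 < j -> j < n -> commute (s i) (s j)) /\
  (forall i, i.+1 < n -> braid3 (s i) (s i.+1)).

Definition B_system n s :=
  [/\ forall i j, i.+1 < j -> j < n -> commute (s i) (s j),
      forall i, 0 < i -> i.+1 < n -> braid3 (s i) (s i.+1) &
      1 < n -> braid4 (s 0) (s 1%N)].

Lemma B_system_tail n s : B_system n.+1 s -> A_system n (fun i => s i.+1).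
Proof.
by move=> [c3 b3 _]; split=> [i j ltij ltj|i lt_i]; [exact: c3 | exact: b3].
Qed.

Lemma A_system_cox n s k l : A_system n s -> k.+1 < l -> l <= n ->
  (\prod_(i < l) s i) * s k = s k.+1 * \prod_(i < l) s i.
Proof.
move=> [c3 b3]; elim: l => // l IH; rewrite ltnS leq_eqVlt => /predU1P[<-|lt_kl] le_ln.
  rewrite !big_ord_recr /=.
  have ck : commute (s k.+1) (\prod_(i < k) s i).
    by apply: (commute_prod_ord (f := s)) => i lt_i; apply: commute_sym; exact: c3.
  by rewrite -!mulgA [s k * _]mulgA (b3 k) // !mulgA ck.
rewrite big_ord_recr /= mulgA -IH ?(ltnW le_ln) //.
by rewrite (commuteAC _ (c3 _ _ lt_kl le_ln)).
Qed.

Lemma A_system_cox_cox n s l : A_system n s -> l < n ->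
  (\prod_(i < l.+1) s i) * (\prod_(i < l) s i) =
  (\prod_(i < l) s i.+1) * (\prod_(i < l.+1) s i).
Proof.
move=> sA lt_ln.
apply: (intertwine_prod (f := s) (g := fun i => s i.+1)) => i lt_il.
exact: A_system_cox sA _ lt_ln.
Qed.

Section B.
Variables (n : nat) (s : nat -> H).
Hypothesis sB : B_system n s.

Let c3 i j : i.+1 < j -> j < n -> commute (s i) (s j). Proof. by case: sB => + _ _; apply. Qed.
Let b3 i : 0 < i -> i.+1 < n -> braid3 (s i) (s i.+1). Proof. by case: sB => _ + _; apply. Qed.
Let b4 : 1 < n -> braid4 (s 0) (s 1%N). Proof. by case: sB. Qed.

(** In the annular braid group this is the rotation of the [n] points by one place around the
    puncture; hence the shifts of indices below and the centrality of its [n]-th power. *)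
Definition cox_elt := \prod_(i < n) s i.
Local Notation rho := cox_elt.

Lemma cox_eltE : 0 < n -> rho = s 0 * \prod_(i < n.-1) s i.+1.
Proof. by rewrite /cox_elt; case: n => // m _; rewrite big_ord_recl. Qed.

Lemma cox_shift i : 0 < i -> i.+1 < n -> rho * s i = s i.+1 * rho.
Proof.
move=> i0 lt_i; have n0 : 0 < n by exact: leq_ltn_trans lt_i.
have tA : A_system n.-1 (fun i => s i.+1).
  by apply: B_system_tail; rewrite prednK.
rewrite cox_eltE // -mulgA; case: i i0 lt_i => // i _ lt_i.
rewrite (A_system_cox tA (k := i)) //; last by rewrite -ltnS prednK.
by rewrite !mulgA [s 0 * _]c3.
Qed.

(** The rotation carries [s n.-1] to the crossing of the last point with the first, which is not a
    generator, and that one to [s 1]; the square avoids naming it. *)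
Lemma cox_sqr : 1 < n -> rho ^+ 2 * s n.-1 = s 1%N * rho ^+ 2.
Proof.
move=> n1; have n0 := ltnW n1.
have tA : A_system n.-1 (fun i => s i.+1).
  by apply: B_system_tail; rewrite prednK.
have n10 : 0 < n.-1 by rewrite -ltnS prednK.
pose P := \prod_(i < n.-1) s i.+1.
pose P' := \prod_(i < n.-2) s i.+2.
pose P'' := \prod_(i < n.-2) s i.+1.
have En : n.-2.+1 = n.-1 by rewrite prednK.
have EP : P = s 1%N * P' by rewrite /P -En big_ord_recl.
have EP2 : P = P'' * s n.-1 by rewrite /P -En big_ord_recr.
have PP : P * P'' = P' * P.
  by have := A_system_cox_cox (l := n.-2) tA; rewrite En; apply; rewrite -En.
have cP' : commute (s 0) P'.
  apply: (commute_prod_ord (f := fun i => s i.+2)) => i lt_i.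
  by apply: c3 => //; rewrite -ltn_predRL -ltn_predRL.
have E2 : rho ^+ 2 = s 0 * s 1%N * s 0 * P' * P.
  rewrite expg2 cox_eltE // -/P {1}EP !mulgA; congr (_ * _).
  by rewrite -!mulgA cP'.
rewrite {1}E2 -(mulgA _ P' P) -PP -!mulgA -EP2 E2 {1}EP !mulgA.
by congr (_ * _ * _); exact: b4.
Qed.

Lemma cox_iter k : k.+1 < n -> rho ^+ k * s 1%N = s k.+1 * rho ^+ k.
Proof.
elim: k => [|k IH] lt_k; first by rewrite expg0 mul1g mulg1.
by rewrite expgS -mulgA IH ?(ltnW lt_k) // mulgA cox_shift // -mulgA.
Qed.

Lemma cox_pow_commute1 : 1 < n -> commute (rho ^+ n) (s 1%N).
Proof.
move=> n1; have [m Em] : exists m, n = m.+2.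
  by case: n n1 => [|[|m]] // _; exists m.
have En : n = (2 + m)%N by rewrite Em.
have lt_m : m.+1 < n by rewrite Em.
have cm := cox_iter lt_m; have c2 := cox_sqr n1; rewrite Em /= in c2.
rewrite /commute En expgnDr -mulgA cm mulgA c2.
by rewrite -!mulgA.
Qed.

Lemma cox_pow_central k : k < n -> commute (rho ^+ n) (s k).
Proof.
have cS i : i.+1 < n -> commute (rho ^+ n) (s i.+1).
  move=> lt_i; have n1 : 1 < n by exact: leq_ltn_trans lt_i.
  apply: (intertwine_commute (r := rho ^+ i) _ (cox_iter lt_i) (cox_pow_commute1 n1)).
  by rewrite -!expgnDr addnC.
case: k => [n0|k]; last exact: cS.
have <- : rho * (\prod_(i < n.-1) s i.+1)^-1 = s 0 by rewrite cox_eltE // mulgK.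
apply: commuteM; first by apply/commute_sym/commuteX/commute_refl.
apply: commuteV; apply: (commute_prod_ord (f := fun i => s i.+1)) => i lt_i.
by apply: cS; rewrite -ltn_predRL.
Qed.

(** The conjugates of [s 0] by the products of [s 1] to [s k]: loops of the puncture around the
    successive points, which become free generators of the kernel of filling the puncture. *)
Fixpoint orbit_elt_rec k := if k is k'.+1
  then (s k)^-1 * orbit_elt_rec k' * s k else s 0.
(* Locked, lest rewriting with [mulgA] unfold it. *)
Definition orbit_elt := locked orbit_elt_rec.
Local Notation x := orbit_elt.

Lemma orbit_elt0 : x 0 = s 0. Proof. by rewrite /x -lock. Qed.

Lemma orbit_eltE k : x k.+1 = (s k.+1)^-1 * x k * s k.+1.
Proof. by rewrite /x -lock. Qed.

Lemma orbit_eltS k : s k.+1 * x k.+1 = x k * s k.+1.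
Proof. by rewrite orbit_eltE !mulgA mulgV mul1g. Qed.

Lemma cox_orbit k : k.+1 < n -> rho * x k = x k.+1 * rho.
Proof.
elim: k => [|k IH] lt_k.
  apply: (@mulgI _ (s 1%N)); rewrite [RHS]mulgA orbit_eltS orbit_elt0.
  have n1 : n.-1 = n.-2.+1 by rewrite prednK // -ltnS prednK // ltnW.
  rewrite cox_eltE ?(ltnW lt_k) // n1 big_ord_recl /=.
  set P' := \prod_(i < _) _.
  have cP' : commute (s 0) P'.
    apply: (commute_prod_ord (f := fun i => s i.+2)) => i lt_i.
    by apply: c3 => //; rewrite -ltn_predRL -ltn_predRL.
  rewrite -!mulgA -cP' !mulgA; congr (_ * _); exact/esym/b4.
rewrite [x k.+1]orbit_eltE [x k.+2]orbit_eltE.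
have sh : rho * s k.+1 = s k.+2 * rho by exact: cox_shift.
apply: intertwineM (sh); exact: intertwineM (intertwineV sh) (IH (ltnW lt_k)).
Qed.

Lemma orbit_commute_above k i : i.+1 < k -> k < n -> commute (s k) (x i).
Proof.
elim: i => [|i IH] lt_ik ltkn; first by rewrite orbit_elt0; apply/commute_sym/c3.
rewrite orbit_eltE.
have c := commute_sym (c3 lt_ik ltkn).
by apply: commuteM => //; apply: commuteM; [exact: commuteV | exact: IH (ltnW lt_ik) _].
Qed.

Lemma orbit_commute_below k i : 0 < k -> k < i -> i < n -> commute (s k) (x i).
Proof.
move=> k0; elim: i => // i IH; rewrite ltnS leq_eqVlt => /predU1P[<-|ltki] lt_in; last first.
  have c := c3 (_ : k.+1 < i.+1) lt_in.
  rewrite orbit_eltE.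
  by apply: commuteM; [apply: commuteM; [apply/commuteV/c | apply: IH => //; exact: ltnW] | exact: c].
case: k k0 lt_in {IH} => // k _ lt_in.
have cx : commute (s k.+2) (x k) by exact: orbit_commute_above.
rewrite orbit_eltE [x k.+1]orbit_eltE; exact: braid3_conj (b3 (ltn0Sn k) lt_in) cx.
Qed.

(** For [k = 0] this is the relation of length 4; the rotation carries it to every [k]. *)
Lemma orbit_pair_commute k : k.+1 < n -> commute (s k.+1) (x k.+1 * x k).
Proof.
elim: k => [|k IH] lt_k; last first.
  have lt_k' := ltnW lt_k.
  apply: (intertwine_commute (cox_shift (ltn0Sn k) lt_k) _ (IH lt_k')).
  exact: intertwineM (cox_orbit lt_k) (cox_orbit lt_k').
rewrite /commute !mulgA orbit_eltS; apply: (@mulgI _ (s 1%N)).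
by rewrite !mulgA orbit_eltS orbit_elt0; exact/esym/b4.
Qed.

(** With [orbit_eltS], this is Artin's formula for the action of a crossing, reproduced by
    [aut_fun]. *)
Lemma orbit_braid_conj k : k.+1 < n ->
  s k.+1 * x k * (s k.+1)^-1 = (x k)^-1 * x k.+1 * x k.
Proof.
move=> lt_k; apply: (@mulgI _ (x k)); rewrite !mulgA mulgV mul1g -orbit_eltS.
by rewrite -[X in X * _^-1]mulgA orbit_pair_commute // mulgK.
Qed.

Lemma prod_orbit k : (\prod_(i < k) s i.+1) * x k = \prod_(i < k.+1) s i.
Proof.
elim: k => [|k IH]; first by rewrite big_ord0 big_ord1 mul1g orbit_elt0.
rewrite big_ord_recr /= -mulgA orbit_eltS mulgA IH.
by rewrite [RHS]big_ord_recr.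
Qed.
End B.
End Systems.

Definition edges_B0 (k : nat) := if k == 0%N then 4 else 3.
Lemma edges_B0_ge2 k : 2 <= edges_B0 k. Proof. by rewrite /edges_B0; case: ifP. Qed.
(* The label 4 is on the first edge, unlike in [coxeter_B]. *)
Definition coxeter_B0 n := path_coxeter edges_B0_ge2 n.

Section SystemEvaluation.
Variables (H : groupType) (n : nat) (s : nat -> H).
Local Notation ev := (eval_word (fun i : 'I_n => s i)).

Lemma eval_positive_word (w : seq 'I_n) : ev (positive_word w) = \prod_(i <- w) s i.
Proof. by rewrite /eval_word big_map. Qed.

Lemma A_system_eval : A_system n s ->
  forall u v, artin_rel (coxeter_A n) u v -> ev u = ev v.
Proof.
move=> [c3 b3]; apply: path_relP => //.
- by move=> k _; left.
- move=> i j lt_ij; rewrite !eval_positive_word !big_cons !big_nil !mulg1.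
  exact: c3.
- move=> i j Eij _; rewrite !eval_positive_word !big_cons !big_nil !mulg1 !mulgA Eij.
  by apply: b3; rewrite -Eij.
Qed.

Lemma B_system_eval : B_system n s ->
  forall u v, artin_rel (coxeter_B0 n) u v -> ev u = ev v.
Proof.
move=> [c3 b3 b4]; apply: path_relP => //.
- by move=> k _; rewrite /edges_B0; case: ifP; [right | left].
- move=> i j lt_ij; rewrite !eval_positive_word !big_cons !big_nil !mulg1.
  exact: c3.
- move=> i j Eij; rewrite /edges_B0; case: eqP => // /eqP; rewrite -lt0n => i0 _.
  rewrite !eval_positive_word !big_cons !big_nil !mulg1 !mulgA Eij.
  by apply: b3; rewrite -?Eij.
- move=> i j Eij; rewrite /edges_B0; case: eqP => // i0 _.
  rewrite !eval_positive_word !big_cons !big_nil !mulg1 !mulgA Eij i0.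
  by apply: b4; rewrite -[1%N]/(0.+1) -i0 -Eij.
Qed.

End SystemEvaluation.

Section GeneratorSystems.
Variables (n : nat) (R : seq (letter 'I_n) -> seq (letter 'I_n) -> Prop).
Local Notation s := (gen R).

Lemma gen_rel (u v : seq 'I_n) : R (positive_word u) (positive_word v) ->
  \prod_(i <- u) s i = \prod_(i <- v) s i.
Proof.
move=> /PresRel/pres_classP; rewrite -!eval_word_gen.
by rewrite !eval_positive_word.
Qed.

Lemma gen_path_rel e (e2 : forall k, 2 <= e k) (i j : 'I_n) m :
  (forall u v, artin_rel (path_coxeter e2 n) u v -> R u v) ->
  i < j -> m = (if j == i.+1 :> nat then e i else 2) ->
  \prod_(k <- alternating i j m) s k = \prod_(k <- alternating j i m) s k.
Proof.
move=> eR lt_ij Em; apply: gen_rel; apply: eR; exists i, j, m; split=> //.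
  by rewrite neq_ltn lt_ij.
rewrite Em /= /path_coxeter_fun -val_eqE (ltn_eqF lt_ij) /=; case: eqP => // _.
by rewrite (ltn_eqF (leqW lt_ij)).
Qed.

Lemma gen_path_commute e (e2 : forall k, 2 <= e k) i j :
  (forall u v, artin_rel (path_coxeter e2 n) u v -> R u v) ->
  i.+1 < j -> j < n -> commute (s i) (s j).
Proof.
move=> eR lt_ij lt_j; have lt_i : i < n by exact: ltn_trans (ltnW lt_ij) lt_j.
have := @gen_path_rel e e2 (Ordinal lt_i) (Ordinal lt_j) 2 eR (ltnW lt_ij).
by rewrite /= gtn_eqF // !big_cons !big_nil !mulg1; apply.
Qed.

Lemma gen_path_braid3 e (e2 : forall k, 2 <= e k) i :
  (forall u v, artin_rel (path_coxeter e2 n) u v -> R u v) ->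
  i.+1 < n -> e i = 3 -> braid3 (s i) (s i.+1).
Proof.
move=> eR lt_i ei.
have := @gen_path_rel e e2 (Ordinal (ltnW lt_i)) (Ordinal lt_i) 3 eR (ltnSn i).
by rewrite /= eqxx !big_cons !big_nil !mulg1 !mulgA; apply.
Qed.

Lemma gen_path_braid4 e (e2 : forall k, 2 <= e k) i :
  (forall u v, artin_rel (path_coxeter e2 n) u v -> R u v) ->
  i.+1 < n -> e i = 4 -> braid4 (s i) (s i.+1).
Proof.
move=> eR lt_i ei.
have := @gen_path_rel e e2 (Ordinal (ltnW lt_i)) (Ordinal lt_i) 4 eR (ltnSn i).
by rewrite /= eqxx !big_cons !big_nil !mulg1 !mulgA; apply.
Qed.

Lemma gen_A_system : (forall u v, artin_rel (coxeter_A n) u v -> R u v) ->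
  A_system n s.
Proof.
move=> eR; split=> [i j|i lt_i]; first exact: gen_path_commute eR.
exact: gen_path_braid3 eR lt_i _.
Qed.

Lemma gen_B_system : (forall u v, artin_rel (coxeter_B0 n) u v -> R u v) ->
  B_system n s.
Proof.
move=> eR; split=> [i j|i i0 lt_i|lt_n]; first exact: gen_path_commute eR.
  by apply: gen_path_braid3 eR lt_i _; rewrite /edges_B0 gtn_eqF.
exact: gen_path_braid4 eR lt_n _.
Qed.

End GeneratorSystems.

(** * Quotients by a power of the Coxeter element *)

Section CoxeterQuotient.
Variables (n : nat) (M : coxeter_matrix 'I_n) (k : nat).

Definition cox_power_word : seq (letter 'I_n) :=
  flatten (nseq k (positive_word (enum 'I_n))).

Definition cox_quot_rel u v :=
  artin_rel M u v \/ (u = cox_power_word /\ v = [::]).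

Definition cox_quot := presented_group cox_quot_rel.
HB.instance Definition _ := Group.on cox_quot.

Lemma eval_cox_power_word (H : groupType) (s : nat -> H) :
  eval_word (fun i : 'I_n => s i) cox_power_word = (\prod_(i < n) s i) ^+ k.
Proof.
rewrite /cox_power_word; elim: k => [|l IH]; first by rewrite /eval_word big_nil.
by rewrite /= eval_word_cat IH eval_positive_word enumT expgS [index_enum _]unlock.
Qed.

Lemma cox_quot_eval (H : groupType) (s : nat -> H) :
  (forall u v, artin_rel M u v ->
     eval_word (fun i : 'I_n => s i) u = eval_word (fun i : 'I_n => s i) v) ->
  (\prod_(i < n) s i) ^+ k = 1 ->
  forall u v, cox_quot_rel u v ->
     eval_word (fun i : 'I_n => s i) u = eval_word (fun i : 'I_n => s i) v.
Proof.
move=> sM s1 u v [/sM //|[-> ->]].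
by rewrite eval_cox_power_word s1 /eval_word big_nil.
Qed.

Lemma cox_quot_power : (\prod_(i < n) gen cox_quot_rel i) ^+ k = 1.
Proof.
rewrite -eval_cox_power_word eval_word_gen -pres_class1.
by apply/pres_classP/PresRel; right.
Qed.

End CoxeterQuotient.

(** The elements killed are the full twist in type A and the full rotation in type B; for [n >= 2]
    they generate the centres of the Artin groups. *)
Definition braid_quot n := cox_quot (coxeter_A n) n.+1.
Definition annular_quot n := cox_quot (coxeter_B0 n) n.
HB.instance Definition _ n := Group.on (braid_quot n).
HB.instance Definition _ n := Group.on (annular_quot n).

(* A subgroup that is the image of a free group [F], and on which some action
   on [F] restricts to the action by inner automorphisms, is free. *)
Lemma dim_le_free_range (G : groupType) k (psi : free_group k -> G)
    (Phi : G -> free_group k -> free_group k) : 1 < k ->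
  {morph psi : x y / x * y} ->
  (forall w v, Phi (psi w) v = w * v * w^-1) ->
  dim_le (range psi) 1.
Proof.
move=> k1 psiM Phi_psi.
have psi_inj : injective psi.
  move=> w w' Ew; apply: free_group_inner_inj => // z.
  by rewrite -!Phi_psi Ew.
pose f g := xget 1 [set w | psi w = g].
have fK g : range psi g -> psi (f g) = g.
  by move=> [w _ <-]; apply: (@xgetI _ 1 [set w' | psi w' = psi w] w).
have psif x y : range psi x -> range psi y -> psi ((f x)^-1 * f y) = x^-1 * y.
  by move=> Rx Ry; rewrite psiM (morphVg psiM) !fK.
apply: (dim_le_coarse (f := f) (A' := [set: free_group k])) (@dim_le_free_group k).
- by [].
- move=> E finE; exists (psi @^-1` E).
    by apply: finite_preimage => // x y _ _; exact: psi_inj.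
  by move=> x y Rx Ry; rewrite /= psif.
- move=> E finE; exists (psi @` E); first exact: finite_image.
  by move=> x y Rx Ry; exists ((f x)^-1 * f y) => //; exact: psif.
Qed.

Section KernelOfPresentation.
Variables (l : nat) (R : seq (letter 'I_l) -> seq (letter 'I_l) -> Prop).
Local Notation Q := (presented_group R).
Variables (G : groupType) (p : G -> Q) (N : set G) (lam : nat -> G).
Hypotheses (pM : {morph p : x y / x * y}).
Hypotheses (pN : forall x, N x -> p x = 1) (p_lam : forall k, k < l -> p (lam k) = gen R k).
Hypotheses (N1 : N 1) (NM : forall x y, N x -> N y -> N (x * y)).
Hypotheses (NV : forall x, N x -> N x^-1) (NJ : forall g x, N x -> N (g * x * g^-1)).
Local Notation ev := (eval_word (fun i : 'I_l => lam i)).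
Hypothesis RN : forall u v, R u v -> N (ev u * (ev v)^-1).

Lemma eval_inv_word u : ev (inv_word u) = (ev u)^-1.
Proof.
elim: u => [|[i b] u IH]; first by rewrite /eval_word !big_nil invg1.
rewrite -cat1s inv_word_cat !eval_word_cat IH invgM; congr (_ * _).
by rewrite /eval_word !big_seq1; case: b; rewrite /= ?invgK.
Qed.

Lemma section_hom u : p (ev u) = pres_class R u.
Proof.
elim: u => [|[i b] u IH]; first by rewrite /eval_word big_nil (morph1g pM).
rewrite -cat1s eval_word_cat pM IH pres_classM; congr (_ * _).
rewrite /eval_word big_seq1; case: b => /=.
  by rewrite (morphVg pM) p_lam // gen_ordV.
by rewrite p_lam // gen_ord.
Qed.

(** Stands for the morphism that [lam] induces from [Q] to the quotient of [G] by [N], a quotient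
    that is never formed. *)
Lemma pres_eq_N u v : pres_eq R u v -> N (ev u * (ev v)^-1).
Proof.
elim=> {u v} [u|u v _ IH|v u w _ IH1 _ IH2|u u' v v' _ IHu _ IHv|[i b]|u v /RN //].
- by rewrite mulgV.
- by have := NV IH; rewrite invgM invgK.
- by have := NM IH1 IH2; rewrite mulgA mulgVK.
- rewrite !eval_word_cat invgM.
  have := NM (NJ (ev u) IHv) IHu; rewrite !mulgA.
  by rewrite mulgVK.
- rewrite -[[:: _; _]]cat1s -[[:: inv_letter _]]/(inv_word [:: (i, b)]) eval_word_cat.
  by rewrite eval_inv_word mulgV mul1g /eval_word big_nil invg1.
Qed.

Definition liftable (g : G) := exists u, N (g * (ev u)^-1).

Lemma liftable1 : liftable 1.
Proof. by exists [::]; rewrite /eval_word big_nil invg1 mulg1. Qed.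

Lemma liftableM g h : liftable g -> liftable h -> liftable (g * h).
Proof.
move=> [u Nu] [v Nv]; exists (u ++ v); rewrite eval_word_cat invgM.
by have := NM (NJ g Nv) Nu; rewrite !mulgA mulgVK.
Qed.

Lemma liftableV g : liftable g -> liftable g^-1.
Proof.
move=> [u Nu]; exists (inv_word u); rewrite eval_inv_word invgK.
by have := NJ (ev u)^-1 (NV Nu); rewrite invgM !invgK !mulgA mulVg mul1g.
Qed.

Hypothesis lift : forall g, liftable g.

(** Modulo [N] every [g] is a word in the [lam]. If [p g = 1], that word is trivial in [Q], and its
    derivation from the relations of [Q] can be repeated in [G] modulo [N]. *)
Lemma kernel_sub g : p g = 1 -> N g.
Proof.
have [u Nu] := lift g => pg.
have : pres_eq R u [::].
  apply/pres_classP; rewrite -section_hom pres_class1 -pg.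
  by apply/esym/eqP; rewrite -divg_eq1 -(morphVg pM) -pM pN.
move/pres_eq_N; rewrite {2}/eval_word big_nil invg1 mulg1 => Nev.
by have := NM Nu Nev; rewrite mulgVK.
Qed.

Lemma dim_le_presented_quotient m k :
  dim_le [set: Q] m -> dim_le N k -> dim_le [set: G] (m + k).
Proof.
move=> dimQ dimN; apply: (dim_le_extension (p := p) (h := fun q => ev (repr q))) => //.
  by move=> q; rewrite section_hom pres_class_repr.
by apply: dim_le_sub dimN => g; exact: kernel_sub.
Qed.

End KernelOfPresentation.

(** * The annular braid group over the braid group *)

Section ArtinAction.
Variable n : nat.
Local Notation F := (free_group n).
Local Notation f := (gen (fun _ _ : seq (letter 'I_n) => False)).

(** The effect of conjugation by [s i] on the orbit elements, written with [f j] for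
    [orbit_elt s j]. This is Artin's representation, extended by the inner automorphism of [f 0] for
    [s 0], which is itself the orbit element of index 0. *)
Definition aut_fun i j : F :=
  if i == 0%N then f 0 * f j * (f 0)^-1
  else if j == i then f i.-1
  else if j.+1 == i then (f j)^-1 * f i * f j else f j.

Definition autV_fun i j : F :=
  if i == 0%N then (f 0)^-1 * f j * f 0
  else if j == i then f i * f i.-1 * (f i)^-1
  else if j.+1 == i then f i else f j.

Definition aut i : F -> F := gen_hom (aut_fun i).
Definition autV i : F -> F := gen_hom (autV_fun i).

Lemma autM i : {morph aut i : x y / x * y}. Proof. exact: gen_homM. Qed.
Lemma autVM i : {morph autV i : x y / x * y}. Proof. exact: gen_homM. Qed.
Lemma aut_inv i : {morph aut i : x / x^-1}.
Proof. exact: morphVg (@autM i). Qed.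
Lemma autV_inv i : {morph autV i : x / x^-1}.
Proof. exact: morphVg (@autVM i). Qed.

Lemma autE i j : j < n -> aut i (f j) = aut_fun i j. Proof. exact: gen_homE. Qed.
Lemma autVE i j : j < n -> autV i (f j) = autV_fun i j. Proof. exact: gen_homE. Qed.

Lemma aut0 w : aut 0 w = f 0 * w * (f 0)^-1.
Proof.
move: w; apply: gen_morph_ext; first exact: autM.
  by move=> x y; rewrite !mulgA mulgVK.
by move=> k ltk; rewrite autE.
Qed.

Lemma autV0 w : autV 0 w = (f 0)^-1 * w * f 0.
Proof.
move: w; apply: gen_morph_ext; first exact: autVM.
  by move=> x y; rewrite !mulgA mulgK.
by move=> k ltk; rewrite autVE.
Qed.

Lemma aut_at i : i.+1 < n -> aut i.+1 (f i.+1) = f i.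
Proof. by move=> lti; rewrite autE // /aut_fun /= eqxx. Qed.

Lemma aut_pred i : i.+1 < n -> aut i.+1 (f i) = (f i)^-1 * f i.+1 * f i.
Proof. by move=> lti; rewrite autE ?(ltnW lti) // /aut_fun /= eqxx ltn_eqF. Qed.

Lemma aut_other i j : j < n -> j != i -> j != i.+1 -> aut i.+1 (f j) = f j.
Proof. by move=> ltj /negPf ji /negPf jSi; rewrite autE // /aut_fun /= jSi eqSS ji. Qed.

Lemma autV_at i : i.+1 < n -> autV i.+1 (f i.+1) = f i.+1 * f i * (f i.+1)^-1.
Proof. by move=> lti; rewrite autVE // /autV_fun /= eqxx. Qed.

Lemma autV_pred i : i.+1 < n -> autV i.+1 (f i) = f i.+1.
Proof. by move=> lti; rewrite autVE ?(ltnW lti) // /autV_fun /= eqxx ltn_eqF. Qed.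

Lemma autV_other i j : j < n -> j != i -> j != i.+1 -> autV i.+1 (f j) = f j.
Proof. by move=> ltj /negPf ji /negPf jSi; rewrite autVE // /autV_fun /= jSi eqSS ji. Qed.

Lemma compM (g h : F -> F) : {morph g : x y / x * y} -> {morph h : x y / x * y} ->
  {morph (fun w => g (h w)) : x y / x * y}.
Proof. by move=> gM hM x y; rewrite hM gM. Qed.

Lemma idM : {morph (fun w : F => w) : x y / x * y}. Proof. by []. Qed.

Lemma autK i : i < n -> cancel (aut i) (autV i).
Proof.
case: i => [_ w|i lti]; first by rewrite aut0 autV0 !mulgA mulVg mul1g mulgVK.
apply: gen_morph_ext (compM (@autVM _) (@autM _)) idM _ => j ltj.
case: (eqVneq j i) => [->|ji]; last case: (eqVneq j i.+1) => [->|jSi].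
- rewrite aut_pred // !autVM autV_inv autV_at // autV_pred //.
  by rewrite !mulgA mulVg mul1g mulgVK.
- by rewrite aut_at // autV_pred.
- by rewrite aut_other // autV_other.
Qed.

Lemma autVK i : i < n -> cancel (autV i) (aut i).
Proof.
case: i => [_ w|i lti]; first by rewrite aut0 autV0 !mulgA mulgV mul1g mulgK.
apply: gen_morph_ext (compM (@autM _) (@autVM _)) idM _ => j ltj.
case: (eqVneq j i) => [->|ji]; last case: (eqVneq j i.+1) => [->|jSi].
- by rewrite autV_pred // aut_at.
- rewrite autV_at // !autM aut_inv aut_at // aut_pred //.
  by rewrite !mulgA mulgV mul1g mulgK.
- by rewrite autV_other // aut_other.
Qed.

Lemma aut_comm i j w : i.+1 < j -> j < n -> aut i (aut j w) = aut j (aut i w).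
Proof.
case: j => // j; rewrite ltnS => lt_ij ltj.
have n0 : 0 < n by exact: leq_ltn_trans ltj.
have j_n : j < n by exact: ltnW.
case: i lt_ij => [|i] lt_ij.
  by rewrite !aut0 !autM aut_inv aut_other // ltn_eqF // ltnW.
have i_n : i < n by apply: ltn_trans j_n; exact: ltnW.
move: w; apply: gen_morph_ext; [exact: compM (@autM _) (@autM _)..|] => k ltk.
have [ij iSj Sij SiSj] : [/\ i != j, i != j.+1, i.+1 != j & i.+1 != j.+1].
  by split; lia.
case: (eqVneq k i) => [->|ki]; last case: (eqVneq k i.+1) => [->|kSi].
- by rewrite (aut_other (j := i)) // aut_pred ?(ltn_trans lt_ij) // !autM aut_inv !aut_other // (ltn_trans lt_ij).
- by rewrite (aut_other (j := i.+1)) ?(ltn_trans lt_ij) // aut_at ?(ltn_trans lt_ij) // aut_other.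
rewrite (aut_other (i := i)) //.
case: (eqVneq k j) => [->|kj]; last case: (eqVneq k j.+1) => [->|kSj].
- rewrite aut_pred // !autM aut_inv !aut_other //; by rewrite eq_sym.
- by rewrite aut_at // aut_other // eq_sym.
- by rewrite aut_other // aut_other.
Qed.

Lemma aut_braid3 i w : i.+2 < n ->
  aut i.+1 (aut i.+2 (aut i.+1 w)) = aut i.+2 (aut i.+1 (aut i.+2 w)).
Proof.
move=> lti; have lti1 := ltnW lti; have lti0 := ltnW lti1.
have [n1 n2 n3 n4] : [/\ i != i.+1, i != i.+2, i.+2 != i & i.+2 != i.+1].
  by split; lia.
move: w; apply: gen_morph_ext; [exact: compM (@autM _) (compM (@autM _) (@autM _))..|] => k ltk.
case: (eqVneq k i) => [->|ki]; last case: (eqVneq k i.+1) => [->|kSi];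
  last case: (eqVneq k i.+2) => [->|kSSi].
- rewrite (aut_other (i := i.+1) (j := i)) // aut_pred //.
  rewrite !autM !aut_inv aut_pred // (aut_other (i := i.+1) (j := i)) // .
  rewrite !autM !aut_inv aut_pred // aut_at // (aut_other (j := i.+2)) //.
  by rewrite !invgM !invgK !mulgA !(mulgK, mulgVK).
- rewrite aut_at // aut_other // aut_pred // aut_pred //.
  rewrite !autM !aut_inv aut_at // (aut_other (j := i.+2)) //.
  by rewrite aut_at // aut_other.
- by rewrite aut_other // aut_at // aut_at // aut_other.
- by rewrite !aut_other.
Qed.

Lemma aut_braid4 w : 1 < n ->
  aut 0 (aut 1%N (aut 0 (aut 1%N w))) = aut 1%N (aut 0 (aut 1%N (aut 0 w))).
Proof.
move=> n1; rewrite !aut0 !autM !aut_inv !aut_pred // !autM !aut_inv !aut_pred // aut_at //.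
by rewrite !invgM !invgK !mulgA !(mulgK, mulgVK) mulgV mulVg.
Qed.

End ArtinAction.

Lemma gen_act_morph n (R : seq (letter 'I_n) -> seq (letter 'I_n) -> Prop)
    (F : groupType) (f f' : nat -> F -> F) :
  (forall k, k < n -> cancel (f' k) (f k)) ->
  (forall k, k < n -> cancel (f k) (f' k)) ->
  (forall u v, R u v -> forall t,
    act_word (fun i : 'I_n => f i) (fun i : 'I_n => f' i) u t =
    act_word (fun i : 'I_n => f i) (fun i : 'I_n => f' i) v t) ->
  (forall k, k < n -> {morph f k : x y / x * y}) ->
  forall g : presented_group R, {morph gen_act f f' g : x y / x * y}.
Proof.
move=> ff' f'f fR fM; apply: gen_ind => [x y|k g ltk IH x y|k g ltk IH x y].
- by rewrite !gen_act1.
- by rewrite !gen_actM // !gen_actE // IH fM.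
- rewrite !gen_actM // !gen_actVE // IH; apply: (can_inj (f'f k ltk)).
  by rewrite fM // !ff'.
Qed.

Section ArtinActionOfGroup.
Variables (G : groupType) (n : nat).
Local Notation F := (free_group n).
Local Notation f := (gen (fun _ _ : seq (letter 'I_n) => False)).
Variables (Phi : G -> F -> F).
Hypotheses (PhiM : forall x y w, Phi (x * y) w = Phi x (Phi y w)).
Hypotheses (Phi1 : forall w, Phi 1 w = w) (Phi_morph : forall g, {morph Phi g : x y / x * y}).

Lemma Phi_inner_conj x u g : (forall v, Phi x v = u * v * u^-1) ->
  forall v, Phi (g * x * g^-1) v = Phi g u * v * (Phi g u)^-1.
Proof.
move=> Phix v; rewrite !PhiM Phix !Phi_morph (morphVg (Phi_morph g)).
by rewrite -(PhiM g) mulgV Phi1.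
Qed.

Lemma Phi_psi (x : nat -> G) :
  (forall k, k < n -> forall v, Phi (x k) v = f k * v * (f k)^-1) ->
  forall w v, Phi (gen_hom x w : G) v = w * v * w^-1.
Proof.
move=> Phix; have xM : {morph (gen_hom x : F -> G) : y z / y * z} by exact: gen_homM.
have xE k : k < n -> (gen_hom x : F -> G) (f k) = x k by exact: gen_homE.
apply: gen_ind => [v|k w ltk IH v|k w ltk IH v].
- by rewrite (morph1g xM) Phi1 invg1 mulg1 mul1g.
- by rewrite xM PhiM IH xE // Phix // invgM !mulgA.
- rewrite xM PhiM IH (morphVg xM) xE // invgM invgK !mulgA.
  have -> z : Phi (x k)^-1 z = (f k)^-1 * z * f k; last by rewrite !mulgA.
  have {1}-> : z = Phi (x k) ((f k)^-1 * z * f k).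
    by rewrite Phix // !mulgA mulgV mul1g mulgK.
  by rewrite -PhiM mulVg Phi1.
Qed.

Variables (l : nat) (s : nat -> G).
Hypotheses (le_ln : l <= n) (Phis : forall k, k < l -> Phi (s k) =1 @aut n k).

Lemma Phi_sV k w : k < l -> Phi (s k)^-1 w = autV k w.
Proof.
move=> ltk; apply: (can_inj (autK (leq_trans ltk le_ln))).
by rewrite autVK ?(leq_trans ltk) // -Phis // -PhiM mulgV Phi1.
Qed.

(** From the inner automorphism of [f 0], each [autV k.+1] leads from [f k] to [f k.+1]. The slack
    [l <= n] serves affine type C, where the free group has one generator more than there are orbit
    elements. *)
Lemma Phi_orbit k : k < l -> forall v, Phi (orbit_elt s k) v = f k * v * (f k)^-1.
Proof.
elim: k => [l0 v|k IH ltk v]; first by rewrite orbit_elt0 Phis // aut0.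
have := Phi_inner_conj (s k.+1)^-1 (IH (ltnW ltk)).
rewrite invgK orbit_eltE Phi_sV // autV_pred; last exact: leq_trans le_ln.
by apply.
Qed.

End ArtinActionOfGroup.

Section AnnularBraids.
Variable n : nat.
Local Notation F := (free_group n).
Local Notation f := (gen (fun _ _ : seq (letter 'I_n) => False)).

Lemma aut_B0_rel u v : artin_rel (coxeter_B0 n) u v -> forall t : F,
  act_word (fun i : 'I_n => aut i) (fun i : 'I_n => autV i) u t =
  act_word (fun i : 'I_n => aut i) (fun i : 'I_n => autV i) v t.
Proof.
move: u v; apply: path_relP => //.
- by move=> k _; rewrite /edges_B0; case: ifP; [right | left].
- by move=> i j lt_ij t; exact: aut_comm.
- move=> i j Eij; rewrite /edges_B0; case: eqP => // i0 _ t.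
  have i_gt0 : 0 < i by lia.
  rewrite /act_word /= /act_letter /= Eij -(prednK i_gt0).
  by apply: aut_braid3; rewrite prednK // -Eij.
- move=> i j Eij; rewrite /edges_B0; case: eqP => // i0 _ t.
  rewrite /act_word /= /act_letter /= Eij i0.
  by apply: aut_braid4; rewrite -[1%N]/(0.+1) -i0 -Eij.
Qed.

(* The central element acts trivially: its action fixes the inner automorphism
   of each generator, and inner automorphisms determine the element. *)
Lemma aut_cox_power : 1 < n -> forall t : F,
  act_word (fun i : 'I_n => aut i) (fun i : 'I_n => autV i) (cox_power_word n n) t = t.
Proof.
move=> n1; pose G := artin_group (coxeter_B0 n).
pose s : nat -> G := gen (artin_rel (coxeter_B0 n)).
pose Phi : G -> F -> F := gen_act (@aut n) (@autV n).
have ff' k : k < n -> cancel (@autV n k) (@aut n k) by exact: autVK.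
have f'f k : k < n -> cancel (@aut n k) (@autV n k) by exact: autK.
have sB : B_system n s by exact: gen_B_system.
have PhiM x y w : Phi (x * y) w = Phi x (Phi y w) by exact: (gen_actM ff' f'f aut_B0_rel).
have Phi1 w : Phi 1 w = w by exact: (gen_act1 ff' f'f aut_B0_rel).
have Phi_morph : forall g, {morph Phi g : x y / x * y}.
  by apply: (gen_act_morph ff' f'f aut_B0_rel) => k _; exact: autM.
have Phis k : k < n -> Phi (s k) =1 @aut n k.
  by move=> ltk w; exact: (gen_actE ff' f'f aut_B0_rel).
have Phix := Phi_orbit PhiM Phi1 Phi_morph (leqnn n) Phis.
move=> t; have <- : Phi (pres_class _ (cox_power_word n n)) t =
    act_word (fun i : 'I_n => aut i) (fun i : 'I_n => autV i) (cox_power_word n n) t.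
  by apply: pres_actE; [move=> i; exact: ff' | move=> i; exact: f'f | exact: aut_B0_rel].
rewrite -eval_word_gen eval_cox_power_word -/(cox_elt n s).
move: t; apply: gen_morph_ext => // k ltk.
apply: free_group_inner_inj => // v.
rewrite -(Phi_inner_conj PhiM Phi1 Phi_morph _ (Phix k ltk)) -Phix //.
suff -> : cox_elt n s ^+ n * orbit_elt s k = orbit_elt s k * cox_elt n s ^+ n.
  by rewrite mulgK.
elim: k ltk => [n0|k IH ltk]; first by rewrite orbit_elt0; exact: cox_pow_central.
have c : commute (cox_elt n s ^+ n) (s k.+1) by exact: cox_pow_central.
rewrite orbit_eltE; apply: commuteM => //; apply: commuteM; last exact/IH/ltnW.
exact: commuteV.
Qed.

End AnnularBraids.

(* Filling in the puncture: the kernel is free on the orbit of [s 0]. *)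
Theorem dim_le_annular_quot m d : 0 < m ->
  dim_le [set: braid_quot m] d -> dim_le [set: annular_quot m.+1] (d + 1).
Proof.
move=> m0; set n := m.+1; pose G := annular_quot n.
pose R := cox_quot_rel (coxeter_B0 n) n.
pose s : nat -> G := gen R.
pose Phi : G -> free_group n -> free_group n := gen_act (@aut n) (@autV n).
have n1 : 1 < n by [].
have ff' k : k < n -> cancel (@autV n k) (@aut n k) by exact: autVK.
have f'f k : k < n -> cancel (@aut n k) (@autV n k) by exact: autK.
have fR u v : R u v -> forall t : free_group n,
    act_word (fun i : 'I_n => aut i) (fun i : 'I_n => autV i) u t =
    act_word (fun i : 'I_n => aut i) (fun i : 'I_n => autV i) v t.
  by move=> [/aut_B0_rel //|[-> ->]] t; rewrite aut_cox_power.
have sB : B_system n s by apply: gen_B_system => u v uv; left.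
have PhiM x y w : Phi (x * y) w = Phi x (Phi y w) by exact: (gen_actM ff' f'f fR).
have Phi1 w : Phi 1 w = w by exact: (gen_act1 ff' f'f fR).
have Phi_morph : forall g, {morph Phi g : x y / x * y}.
  by apply: (gen_act_morph ff' f'f fR) => k _; exact: autM.
have Phis k : k < n -> Phi (s k) =1 @aut n k.
  by move=> ltk w; exact: (gen_actE ff' f'f fR).
have Phix := Phi_orbit PhiM Phi1 Phi_morph (leqnn n) Phis.
pose psi : free_group n -> G := gen_hom (orbit_elt s).
have psiM : {morph psi : x y / x * y} by exact: gen_homM.
have psiE k : k < n -> psi (gen _ k) = orbit_elt s k by exact: gen_homE.
have PhiPsi := Phi_psi PhiM Phi1 Phix; rewrite -/psi in PhiPsi.
(* [psi] intertwines [Phi] with conjugation, so its range is normal; on generators this compares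
   [aut_fun] with the conjugation rules of the orbit elements. *)
have equiv g w : g * psi w * g^-1 = psi (Phi g w).
  move: g w; suff equivs k w : k < n -> s k * psi w * (s k)^-1 = psi (Phi (s k) w).
    apply: gen_ind => [w|k g ltk IH w|k g ltk IH w].
    - by rewrite Phi1 mul1g invg1 mulg1.
    - by rewrite PhiM -equivs // -IH invgM !mulgA.
    - rewrite PhiM; set w' := Phi _ (Phi g w).
      have Ew : Phi g w = Phi (s k) w' by rewrite /w' -PhiM mulgV Phi1.
      have := IH w; rewrite Ew -equivs // => Ew'.
      have -> : (s k)^-1 * g * psi w * ((s k)^-1 * g)^-1 =
          (s k)^-1 * (g * psi w * g^-1) * s k by rewrite invgM invgK !mulgA.
      by rewrite Ew' !mulgA mulVg mul1g mulgVK.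
  move=> ltk; move: w; apply: gen_morph_ext.
  - by move=> x y; rewrite psiM !mulgA mulgVK.
  - by move=> x y; rewrite Phi_morph psiM.
  move=> j ltj; rewrite Phis // autE // /aut_fun psiE //.
  case: k ltk => [_|k ltk] /=.
    by rewrite !psiM (morphVg psiM) !psiE // orbit_elt0.
  case: eqP => [->|/eqP jSk]; first by rewrite psiE ?(ltnW ltk) // orbit_eltS mulgK.
  case: eqP => [[Ej]|/eqP jk].
    rewrite Ej !psiM (morphVg psiM) !psiE ?(ltnW ltk) //.
    exact: (orbit_braid_conj sB).
  rewrite psiE //; suff -> : s k.+1 * orbit_elt s j = orbit_elt s j * s k.+1 by rewrite mulgK.
  case: (ltngtP j k) => [ltjk|ltkj|Ej]; last by rewrite Ej eqxx in jk.
  - exact: (orbit_commute_above sB).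
  - by apply: (orbit_commute_below sB) => //; rewrite ltn_neqAle eq_sym jSk.
pose N := range psi.
pose q k : braid_quot m := if k is k'.+1 then gen (cox_quot_rel (coxeter_A m) m.+1) k' else 1.
pose p : G -> braid_quot m := gen_hom q.
have qR u v : R u v -> eval_word (fun i : 'I_n => q i) u = eval_word (fun i : 'I_n => q i) v.
  have [c3 b3] : A_system m (gen (cox_quot_rel (coxeter_A m) m.+1)).
    by apply: gen_A_system => ? ? ?; left.
  apply: cox_quot_eval.
    apply: B_system_eval; split=> [i j|i|_].
    - case: i => [|i]; case: j => // j lt_ij lt_j; first by rewrite /commute /= mul1g mulg1.
      exact: c3.
    - by case: i => // i _; exact: b3.
    - by rewrite /braid4 /= !mul1g !mulg1.
  by rewrite big_ord_recl mul1g; exact: cox_quot_power.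
have pM : {morph p : x y / x * y} by exact: gen_homM.
have pE k : k < n -> p (s k) = q k by exact: gen_homE.
have pN x : N x -> p x = 1.
  move=> [w _ <-]; move: w; apply: (gen_morph_ext (g := fun=> 1)).
  - by move=> x' y'; rewrite psiM pM.
  - by move=> ? ?; rewrite mulg1.
  elim=> [|k IH] ltk; first by rewrite psiE // orbit_elt0 pE.
  rewrite psiE // orbit_eltE !pM -psiE ?(ltnW ltk) // IH ?(ltnW ltk) //.
  by rewrite mulg1 (morphVg pM) mulVg.
have NJ g x : N x -> N (g * x * g^-1).
  by move=> [w _ <-]; exists (Phi g w); rewrite // equiv.
have NM x y : N x -> N y -> N (x * y).
  by move=> [w _ <-] [w' _ <-]; exists (w * w').
have NV x : N x -> N x^-1.
  by move=> [w _ <-]; exists w^-1 => //; exact: (morphVg psiM).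
have N1 : N 1 by exists 1; rewrite ?(morph1g psiM).
pose lam k := s k.+1.
have lamR u v : cox_quot_rel (coxeter_A m) m.+1 u v ->
    N (eval_word (fun i : 'I_m => lam i) u * (eval_word (fun i : 'I_m => lam i) v)^-1).
  move=> [|[-> ->]].
    have lamA : A_system m lam by exact: B_system_tail.
    by move/(A_system_eval lamA) ->; rewrite mulgV.
  rewrite eval_cox_power_word [eval_word _ [::]]big_nil invg1 mulg1.
  (* Modulo [N] the product of the [lam] is the rotation, killed by the power [n = m.+1]: the
     exponents of the two quotients agree. *)
  have -> : \prod_(i < m) lam i = (s 0)^-1 * cox_elt n s by rewrite cox_eltE // mulKg.
  have N0 : N (s 0)^-1 by exists (gen _ 0)^-1; rewrite // (morphVg psiM) psiE // orbit_elt0.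
  have pow k : exists2 y, N y & ((s 0)^-1 * cox_elt n s) ^+ k = y * cox_elt n s ^+ k.
    elim: k => [|k [y Ny IH]]; first by exists 1; rewrite // !expg0 mulg1.
    exists ((s 0)^-1 * (cox_elt n s * y * (cox_elt n s)^-1)); first by apply: NM => //; exact: NJ.
    by rewrite !expgS IH !mulgA mulgVK.
  by have [y Ny ->] := pow n; rewrite cox_quot_power mulg1.
have p_lam k : k < m -> p (lam k) = gen (cox_quot_rel (coxeter_A m) m.+1) k.
  by move=> ltk; rewrite pE.
have Lg k : k < n -> liftable m N lam (s k).
  case: k => [_|k ltk].
    exists [::]; rewrite /eval_word big_nil invg1 mulg1.
    by exists (gen _ 0); rewrite // psiE // orbit_elt0.
  exists [:: (Ordinal (ltk : k < m), false)].
  by rewrite /eval_word big_seq1 /= mulgV.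
have lift g : liftable m N lam g.
  move: g; apply: gen_ind => [|k g ltk LLg|k g ltk LLg].
  - exact: liftable1.
  - by apply: liftableM => //; exact: Lg.
  - by apply: liftableM => //; apply: liftableV => //; exact: Lg.
move=> dimQ; have dimN := dim_le_free_range n1 psiM PhiPsi.
exact: (dim_le_presented_quotient pM pN p_lam N1 NM NV NJ lamR lift dimQ dimN).
Qed.

(** * Braid groups inside annular braid groups *)

(* Reidemeister-Schreier: the braid group on [n.+1] strands acts on the right
   on pairs of a position of a marked strand and an element of the group of
   braids in which the marked strand stays at position 0, which is of type
   B_n.  Strands other than the marked one are numbered from 1, in order. *)
Section MarkedStrand.
Variables (H : groupType) (n : nat) (s : nat -> H).
Hypothesis sB : B_system n s.
Local Notation T := (nat * H)%type.
Local Notation x := (orbit_elt s).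

Let c3 i j : i.+1 < j -> j < n -> commute (s i) (s j). Proof. by case: sB => + _ _; apply. Qed.
Let b3 i : 0 < i -> i.+1 < n -> braid3 (s i) (s i.+1). Proof. by case: sB => _ + _; apply. Qed.

(** With coset representatives [P j = s_0 ... s_(j-1)] in the braid group, the cases write
    [P j * s_i] as a subgroup element times a representative. The subgroup element is [s_i] for
    [j < i], 1 for [j = i], the orbit element for [j = i + 1], and [s_(i+1)] above. Positions beyond
    [n] are fixed, so that the step is a bijection of the whole type. *)
Definition schreier_step (i : nat) (t : T) : T :=
  if t.1 < i then (t.1, t.2 * s i)
  else if t.1 == i then (i.+1, t.2)
  else if t.1 == i.+1 then (i, t.2 * x i)
  else if t.1 <= n then (t.1, t.2 * s i.+1) else t.

Definition schreier_stepV (i : nat) (t : T) : T :=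
  if t.1 < i then (t.1, t.2 * (s i)^-1)
  else if t.1 == i then (i.+1, t.2 * (x i)^-1)
  else if t.1 == i.+1 then (i, t.2)
  else if t.1 <= n then (t.1, t.2 * (s i.+1)^-1) else t.

Lemma step_below i j h : j < i -> schreier_step i (j, h) = (j, h * s i).
Proof. by rewrite /schreier_step /= => ->. Qed.

Lemma step_at i h : schreier_step i (i, h) = (i.+1, h).
Proof. by rewrite /schreier_step /= ltnn eqxx. Qed.

Lemma step_next i h : schreier_step i (i.+1, h) = (i, h * x i).
Proof. by rewrite /schreier_step /= ltnNge leqnSn /= gtn_eqF // eqxx. Qed.

Lemma step_above i j h : i.+1 < j -> j <= n -> schreier_step i (j, h) = (j, h * s i.+1).
Proof.
move=> lt_ij lejn; rewrite /schreier_step /= lejn ltnNge (ltnW (ltnW lt_ij)) /=.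
by rewrite !gtn_eqF // ltnW.
Qed.

Lemma step_out i j h : i < n -> n < j -> schreier_step i (j, h) = (j, h).
Proof.
move=> lt_in ltnj; rewrite /schreier_step /= [j <= n]leqNgt ltnj /=.
have -> : (j < i) = false by lia.
have -> : (j == i) = false by lia.
by have -> : (j == i.+1) = false by lia.
Qed.

Lemma stepK i : cancel (schreier_step i) (schreier_stepV i).
Proof.
move=> [j h]; rewrite /schreier_step /schreier_stepV /=; case: (ltngtP j i) => [lt_ji|lt_ij|->] /=.
- by rewrite lt_ji mulgK.
- case: (eqVneq j i.+1) => [->|jSi] /=; first by rewrite ltnn eqxx mulgK.
  case: (leqP j n) => lejn /=.
    by rewrite ltnNge (ltnW lt_ij) gtn_eqF // (negPf jSi) lejn mulgK.
  by rewrite ltnNge (ltnW lt_ij) gtn_eqF // (negPf jSi) leqNgt lejn.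
- by rewrite ltnNge leqnSn gtn_eqF // eqxx.
Qed.

Lemma stepVK i : cancel (schreier_stepV i) (schreier_step i).
Proof.
move=> [j h]; rewrite /schreier_step /schreier_stepV /=; case: (ltngtP j i) => [lt_ji|lt_ij|->] /=.
- by rewrite lt_ji mulgVK.
- case: (eqVneq j i.+1) => [->|jSi] /=; first by rewrite ltnn eqxx.
  case: (leqP j n) => lejn /=.
    by rewrite ltnNge (ltnW lt_ij) gtn_eqF // (negPf jSi) lejn mulgVK.
  by rewrite ltnNge (ltnW lt_ij) gtn_eqF // (negPf jSi) leqNgt lejn.
- by rewrite ltnNge leqnSn gtn_eqF // eqxx mulgVK.
Qed.

Lemma step_comm i k t : i.+1 < k -> k < n ->
  schreier_step i (schreier_step k t) = schreier_step k (schreier_step i t).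
Proof.
case: t => j h lt_ik lt_kn.
case: (ltngtP j i) => [lt_ji|lt_ij|->].
- have lt_jk : j < k by lia.
  rewrite (step_below _ lt_ji) !(step_below _ lt_jk) (step_below _ lt_ji).
  by rewrite (commuteAC _ (c3 lt_ik lt_kn)).
- case: (ltngtP j i.+1) => [|lt_Sij|->]; first by lia.
    case: (leqP j n) => [lejn|ltnj]; last by rewrite !step_out //; lia.
    rewrite (step_above _ lt_Sij lejn); case: (ltngtP j k) => [lt_jk|lt_kj|->].
    + rewrite !(step_below _ lt_jk) (step_above _ lt_Sij lejn).
      by rewrite (commuteAC _ (c3 _ lt_kn)) //; lia.
    + case: (ltngtP j k.+1) => [|lt_Skj|->]; first by lia.
        rewrite !(step_above _ lt_Skj lejn) (step_above _ lt_Sij lejn).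
        by rewrite (commuteAC _ (c3 (i := i.+1) (j := k.+1) _ _)) //; lia.
      rewrite !step_next step_above //; last exact: ltnW.
      congr pair; apply: commuteAC; apply: commute_sym.
      exact: (orbit_commute_below sB).
    + by rewrite !step_at step_above // ltnW.
  have lt_Sik : i.+1 < k by [].
  rewrite step_below // !step_next step_below; last by lia.
  congr pair; apply: commuteAC.
  exact: (orbit_commute_above sB).
- have lt_ik' : i < k by lia.
  by rewrite (step_below _ lt_ik') !step_at step_below.
Qed.

Lemma step_braid3 i t : i.+1 < n ->
  schreier_step i (schreier_step i.+1 (schreier_step i t)) =
  schreier_step i.+1 (schreier_step i (schreier_step i.+1 t)).
Proof.
case: t => j h lt_in.
case: (ltngtP j i) => [lt_ji|lt_ij|->].
- have lt_jSi : j < i.+1 by lia.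
  rewrite !(step_below _ lt_ji, step_below _ lt_jSi); congr pair.
  by rewrite -!mulgA; congr (_ * _); rewrite !mulgA; apply: b3 => //; lia.
- case: (ltngtP j i.+1) => [|lt_Sij|->]; first by lia.
    case: (ltngtP j i.+2) => [|lt_SSij|->]; first by lia.
      case: (leqP j n) => [lejn|ltnj]; last by rewrite !step_out //; lia.
      rewrite !(step_above _ lt_Sij lejn, step_above _ lt_SSij lejn); congr pair.
      rewrite -!mulgA; congr (_ * _); rewrite !mulgA; apply: b3 => //; lia.
    rewrite step_above // !step_next step_below //; congr pair.
    by rewrite -!mulgA; congr (_ * _); rewrite (orbit_pair_commute sB) // !mulgA.
  by rewrite step_next (step_below _ (ltnSn i)) !step_at step_above // step_next -!mulgA orbit_eltS.
- by rewrite !step_at step_above // step_below // step_at step_at.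
Qed.

Definition steps (l : nat) (t : T) : T := foldl (fun t i => schreier_step i t) t (iota 0 l).

Lemma stepsS l t : steps l.+1 t = schreier_step l (steps l t).
Proof. by rewrite /steps -addn1 iotaD foldl_cat. Qed.

Lemma steps0 l h : l <= n -> steps l (0, h) = (l, h).
Proof.
elim: l => // l IH ltln; rewrite stepsS IH ?(ltnW ltln) //.
by rewrite step_at.
Qed.

Lemma steps_pos l j h : j <= n -> l <= n -> 0 < j ->
  steps l (j, h) = if l < j then (j, h * \prod_(i < l) s i.+1)
                   else (j.-1, h * \prod_(i < l) s i).
Proof.
move=> lejn + j0; elim: l => [_|l IH ltln].
  by rewrite j0 big_ord0 mulg1.
rewrite stepsS IH ?(ltnW ltln) //; case: (ltngtP l.+1 j) => [lt_lj|lt_jl|Elj].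
- by rewrite step_above // big_ord_recr /= mulgA.
- rewrite step_below; last by lia.
  by rewrite big_ord_recr /= mulgA.
- by rewrite -Elj step_next /= -mulgA prod_orbit.
Qed.

Lemma steps_full j h : j <= n ->
  steps n (j, h) = if j == 0%N then (n, h) else (j.-1, h * cox_elt n s).
Proof.
move=> lejn; case: eqP => [->|/eqP]; first exact: steps0.
by rewrite -lt0n => j0; rewrite steps_pos // ltnNge lejn.
Qed.

Lemma steps_out j h : n < j -> steps n (j, h) = (j, h).
Proof.
move=> ltnj; suff H1 l : l <= n -> steps l (j, h) = (j, h) by exact: H1.
elim: l => // l IH ltln; rewrite stepsS IH ?(ltnW ltln) //.
exact: step_out.
Qed.

Lemma iter_steps_down k j h : k <= j -> j <= n ->
  iter k (steps n) (j, h) = ((j - k)%N, h * cox_elt n s ^+ k).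
Proof.
elim: k => [|k IH] ltkj lejn; first by rewrite subn0 mulg1.
rewrite iterS IH ?(ltnW ltkj) // steps_full; last by lia.
have -> : (j - k == 0)%N = false by lia.
by rewrite -subnS expgSr mulgA.
Qed.

(** In [n.+1] rounds the marked strand jumps once from 0 to [n], at no cost, and comes down [n]
    times by one place, each time with a factor [cox_elt]. Hence the exponent [n.+1] on one side and
    [n] on the other. *)
Lemma iter_steps t : cox_elt n s ^+ n = 1 -> iter n.+1 (steps n) t = t.
Proof.
case: t => j h cox1; case: (leqP j n) => [lejn|ltnj]; last first.
  by elim: n.+1 => // k IH; rewrite iterS IH steps_out.
have -> : n.+1 = ((n - j) + 1 + j)%N by lia.
rewrite !iterD iter_steps_down // subnn /= steps0 // iter_steps_down //; last by lia.
by rewrite -mulgA -expgnDr subnKC // cox1 mulg1 subKn.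
Qed.

End MarkedStrand.

Section MarkedStrandEmbedding.
Variables (H : groupType) (n : nat) (s : nat -> H).
Hypothesis sB : B_system n s.
Variable (R : seq (letter 'I_n) -> seq (letter 'I_n) -> Prop).
Local Notation G := (presented_group R).
Local Notation sg := (gen R).
Local Notation x := (orbit_elt s).
Local Notation step := (schreier_step n s).
Local Notation stepV := (schreier_stepV n s).
Hypothesis stepR : forall u v, R u v -> forall t,
  act_word (fun i : 'I_n => stepV i) (fun i : 'I_n => step i) u t =
  act_word (fun i : 'I_n => stepV i) (fun i : 'I_n => step i) v t.
Hypothesis sgA : A_system n sg.
Variable f : H -> G.
Hypotheses (fM : {morph f : y z / y * z}).
Hypotheses (f0 : 0 < n -> f (s 0) = sg 0 ^+ 2) (fS : forall k, k.+1 < n -> f (s k.+1) = sg k.+1).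

Let stepK' k : k < n -> cancel (step k) (stepV k). Proof. by move=> _; exact: stepK. Qed.
Let stepVK' k : k < n -> cancel (stepV k) (step k). Proof. by move=> _; exact: stepVK. Qed.

(** The steps multiply on the right, so the generators act by [stepV], and [act g^-1] plays the part
    of right multiplication by [g]. *)
Let act : G -> nat * H -> nat * H := gen_act stepV step.
Let actM y z t : act (y * z) t = act y (act z t).
Proof. exact: (gen_actM stepK' stepVK' stepR). Qed.
Let act1 t : act 1 t = t. Proof. exact: (gen_act1 stepK' stepVK' stepR). Qed.
Let actE k t : k < n -> act (sg k) t = stepV k t.
Proof. exact: (gen_actE stepK' stepVK' stepR). Qed.
Let actVE k t : k < n -> act (sg k)^-1 t = step k t.
Proof. exact: (gen_actVE stepK' stepVK' stepR). Qed.

Lemma step_mul i j h k : step i (j, k * h) = ((step i (j, h)).1, k * (step i (j, h)).2).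
Proof. by rewrite /schreier_step /=; do ?[case: ifP => _]; rewrite ?mulgA. Qed.

Lemma stepV_mul i j h k : stepV i (j, k * h) = ((stepV i (j, h)).1, k * (stepV i (j, h)).2).
Proof. by rewrite /schreier_stepV /=; do ?[case: ifP => _]; rewrite ?mulgA. Qed.

Lemma act_mul g j h k : act g (j, k * h) = ((act g (j, h)).1, k * (act g (j, h)).2).
Proof.
elim/gen_ind: g => [|i g lti IH|i g lti IH]; first by rewrite !act1.
- rewrite !actM !actE // IH stepV_mul; by case: (act g _).
- rewrite !actM !actVE // IH step_mul; by case: (act g _).
Qed.

Lemma stepV_le i t : i < n -> t.1 <= n -> (stepV i t).1 <= n.
Proof.
by move=> lti letn; rewrite /schreier_stepV; do ?[case: ifP => _ //=]; rewrite (ltnW lti).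
Qed.

Lemma step_le i t : i < n -> t.1 <= n -> (step i t).1 <= n.
Proof.
by move=> lti letn; rewrite /schreier_step; do ?[case: ifP => _ //=]; rewrite (ltnW lti).
Qed.

Lemma act_le g t : t.1 <= n -> (act g t).1 <= n.
Proof.
move=> let_n; elim/gen_ind: g => [|i g lti IH|i g lti IH]; first by rewrite act1.
- by rewrite actM actE // stepV_le.
- by rewrite actM actVE // step_le.
Qed.

Local Notation P l := (\prod_(i < l) sg i).

Lemma f_orbit i : i < n -> f (x i) * P i = P i.+1 * sg i.
Proof.
have [c3 b3] := sgA.
elim: i => [n0|i IH lti].
  by rewrite orbit_elt0 f0 // big_ord0 big_ord1 mulg1 expg2.
have br := b3 i lti.
have cP : commute (sg i.+1) (P i).
  by apply: (commute_prod_ord (f := sg)) => k ltk; apply/commute_sym/c3.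
rewrite orbit_eltE !fM (morphVg fM) fS // [P i.+1]big_ord_recr /= !mulgA.
rewrite (commuteAC _ cP) -(mulgA (sg i.+1)^-1) IH ?(ltnW lti) //.
apply: (@mulgI _ (sg i.+1)); rewrite !big_ord_recr /= !mulgA mulgV mul1g cP.
rewrite -!mulgA; congr (_ * _); rewrite /braid3 in br.
rewrite !mulgA -br -!mulgA; congr (_ * _); rewrite !mulgA.
exact: br.
Qed.

Definition untrace (t : nat * H) : G := f t.2 * P t.1.

Lemma untrace_step i t : i < n -> t.1 <= n -> untrace (step i t) = untrace t * sg i.
Proof.
have [c3 b3] := sgA.
case: t => j h lti /= lejn; rewrite /untrace; case: (ltngtP j i) => [lt_ji|lt_ij|->].
- rewrite step_below //= fM -!mulgA; congr (_ * _).
  have -> : f (s i) = sg i by case: i lti lt_ji => // i lti _; exact: fS.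
  by apply: (commute_prod_ord (f := sg)) => k ltk; apply/commute_sym/c3; lia.
- case: (ltngtP j i.+1) => [|lt_Sij|->]; first by lia.
    rewrite step_above //= fM -!mulgA fS; last by lia.
    by rewrite (A_system_cox sgA).
  by rewrite step_next /= fM -!mulgA f_orbit.
- by rewrite step_at /= big_ord_recr /= mulgA.
Qed.

Lemma untrace_act g t : t.1 <= n -> untrace (act g t) = untrace t * g^-1.
Proof.
move=> let_n; elim/gen_ind: g => [|i g lti IH|i g lti IH].
- by rewrite act1 invg1 mulg1.
- rewrite actM actE // invgM mulgA -IH; apply: (@mulIg _ (sg i)).
  by rewrite mulgVK -untrace_step ?stepVK // stepV_le // act_le.
- by rewrite actM actVE // invgM invgK mulgA -IH untrace_step // act_le.
Qed.

(** [tr g] is the Schreier rewriting of [g] from position 0, and [trK] recovers [g] from it. Up to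
    the [n.+1] possible positions, a difference of elements and that of their rewritings determine
    each other within finite sets, so the second component is a coarse embedding of [G] in [H]. *)
Lemma dim_le_marked_strand d : dim_le [set: H] d -> dim_le [set: G] d.
Proof.
pose tr g := act g^-1 (0%N, 1).
have tr_le g : (tr g).1 <= n by exact: act_le.
have trK g : f (tr g).2 * P (tr g).1 = g.
  rewrite -/(untrace (tr g)) untrace_act // invgK.
  by rewrite /untrace (morph1g fM) big_ord0 !mul1g.
have fV := morphVg fM.
pose states := `I_n.+1.
apply: (dim_le_coarse (f := fun g => (tr g).2)) => //.
- move=> E finE; exists [set (act e^-1 (j, 1)).2 | e in E & j in states].
    by apply: finite_image2 => //; exact: finite_II.
  move=> y z _ _ Eyz; exists (y^-1 * z) => //; exists (tr y).1; first exact: tr_le.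
  suff -> : tr z = ((act (y^-1 * z)^-1 ((tr y).1, 1)).1,
      (tr y).2 * (act (y^-1 * z)^-1 ((tr y).1, 1)).2) by rewrite /= mulKg.
  by rewrite -act_mul mulg1 -surjective_pairing /tr -actM invgM invgK mulgK.
- move=> E finE.
  exists [set a * b | a in [set (P j)^-1 * f e | j in states & e in E] &
                      b in [set P j | j in states]].
    apply: finite_image2; first by apply: finite_image2 => //; exact: finite_II.
    by apply: finite_image; exact: finite_II.
  move=> y z _ _ Eyz.
  exists ((P (tr y).1)^-1 * f ((tr y).2^-1 * (tr z).2)).
    exists (tr y).1; first exact: tr_le.
    by exists ((tr y).2^-1 * (tr z).2).
  exists (P (tr z).1); first by exists (tr z).1 => //; exact: tr_le.
  by rewrite -[y in RHS](trK y) -[z in RHS](trK z) invgM fM fV !mulgA.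
Qed.

End MarkedStrandEmbedding.

Section StepRelations.
Variables (H : groupType) (n : nat) (s : nat -> H).
Hypothesis sB : B_system n s.
Local Notation step := (schreier_step n s).
Local Notation stepV := (schreier_stepV n s).
Local Notation actw := (act_word (fun i : 'I_n => stepV i) (fun i : 'I_n => step i)).

Lemma step_A_rel u v : artin_rel (coxeter_A n) u v -> forall t, actw u t = actw v t.
Proof.
move: u v; apply: path_relP => //.
- by move=> k _; left.
- move=> i j lt_ij t; rewrite /act_word /= /act_letter /=.
  have {1}-> : t = step i (step j (stepV j (stepV i t))) by rewrite !stepVK.
  by rewrite (step_comm sB) // !stepK.
- move=> i j Eij _ t; rewrite /act_word /= /act_letter /= Eij.
  have {1}-> : t = step i.+1 (step i (step i.+1 (stepV i.+1 (stepV i (stepV i.+1 t))))).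
    by rewrite !stepVK.
  by rewrite -(step_braid3 sB) -?Eij ?ltn_ord // !stepK.
Qed.

Lemma step_cox_power_word k t :
  actw (cox_power_word n k) (iter k (steps n s n) t) = t.
Proof.
have stepw (w : seq 'I_n) t0 :
    actw (positive_word w) (foldl (fun t i => step i t) t0 (map val w)) = t0.
  elim: w t0 => //= a w IH t0.
  by rewrite /act_letter /= -/(act_word _ _ _ _) IH stepK.
rewrite /cox_power_word; elim: k t => // k IH t.
by rewrite iterSr /= act_word_cat IH /steps -val_enum_ord stepw.
Qed.

End StepRelations.

Section FoldedGenerators.
Variables (G : groupType) (n : nat) (s : nat -> G).
Hypothesis sA : A_system n s.

(** The strand at position 0 becomes the puncture: its neighbour can only go all the way round it,
    which is the square of the crossing. *)
Definition fold_first k := if k == 0%N then s 0 ^+ 2 else s k.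

Lemma braid4_fold (a b : G) : braid3 a b -> braid4 (a ^+ 2) b.
Proof.
rewrite /braid3 /braid4 expg2 => ab.
have -> : a * a * b * (a * a) * b = a * (a * b * a) * a * b by rewrite !mulgA.
have -> : b * (a * a) * b * (a * a) = b * a * (a * b * a) * a by rewrite !mulgA.
rewrite ab; have -> : a * (b * a * b) * a * b = (a * b * a) * (b * a * b) by rewrite !mulgA.
have -> : b * a * (b * a * b) * a = (b * a * b) * (a * b * a) by rewrite !mulgA.
by rewrite ab.
Qed.

Lemma fold_first_B_system : B_system n fold_first.
Proof.
have [c3 b3] := sA; split=> [i j lt_ij lt_j|[//|i] _|n1].
- case: i j lt_ij lt_j => [|i] [|j] //= lt_ij lt_j; last exact: c3.
  by apply: commute_sym; apply: commuteX; apply: commute_sym; exact: c3.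
- exact: b3.
- exact/braid4_fold/b3.
Qed.

(** Since the Coxeter element [d] shifts indices, moving the factors [s 0] to the left gives
    [(s 0 * d) ^+ l = s_0 ... s_(l-1) d ^+ l]; for [l = n] the right side is [d ^+ n.+1]. *)
Lemma fold_first_power :
  (\prod_(i < n) s i) ^+ n.+1 = 1 -> (\prod_(i < n) fold_first i) ^+ n = 1.
Proof.
case: n sA => [|m] sA' d1; first by rewrite expg0.
have Ed : \prod_(i < m.+1) fold_first i = s 0 * \prod_(i < m.+1) s i.
  by rewrite !big_ord_recl mulgA -expg2.
rewrite Ed; set d := \prod_(i < m.+1) s i in d1 *.
suff H l : l <= m.+1 -> (s 0 * d) ^+ l = (\prod_(i < l) s i) * d ^+ l.
  by rewrite H // -/d -expgS.
elim: l => [_|l IH ltl]; first by rewrite big_ord0 mulg1.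
rewrite expgSr IH ?(ltnW ltl) // big_ord_recr /= -!mulgA; congr (_ * _).
rewrite expgSr !mulgA; congr (_ * _).
elim: l {IH} ltl => [|l IH] ltl; first by rewrite expg0 mulg1 mul1g.
rewrite expgS -!mulgA IH ?(ltnW ltl) // !mulgA; congr (_ * _).
exact: A_system_cox sA' _ _.
Qed.

End FoldedGenerators.

Theorem dim_le_braid_quot n d :
  dim_le [set: annular_quot n] d -> dim_le [set: braid_quot n] d.
Proof.
pose R := cox_quot_rel (coxeter_B0 n) n; pose R' := cox_quot_rel (coxeter_A n) n.+1.
have sB : B_system n (gen R) by apply: gen_B_system => ? ? ?; left.
have sA : A_system n (gen R') by apply: gen_A_system => ? ? ?; left.
pose f : annular_quot n -> braid_quot n := gen_hom (fold_first (gen R')).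
have fR u v : R u v -> eval_word (fun i : 'I_n => fold_first (gen R') i) u =
    eval_word (fun i : 'I_n => fold_first (gen R') i) v.
  apply: cox_quot_eval; first exact/B_system_eval/fold_first_B_system.
  exact/fold_first_power/cox_quot_power.
have fE k : k < n -> f (gen R k) = fold_first (gen R') k by exact: gen_homE.
have fM : {morph f : x y / x * y} by exact: gen_homM.
have stepR u v : R' u v -> forall t,
    act_word (fun i : 'I_n => schreier_stepV n (gen R) i)
      (fun i : 'I_n => schreier_step n (gen R) i) u t =
    act_word (fun i : 'I_n => schreier_stepV n (gen R) i)
      (fun i : 'I_n => schreier_step n (gen R) i) v t.
  move=> [/(step_A_rel sB) //|[-> ->]] t.
  rewrite -[t in LHS](iter_steps (n := n) (s := gen R)) //; last exact: cox_quot_power.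
  exact: step_cox_power_word.
have fS k : k.+1 < n -> f (gen R k.+1) = gen R' k.+1 by move=> ltk; rewrite fE.
exact: (dim_le_marked_strand stepR sA fM (fE 0%N) fS).
Qed.

(** [coxeter_B] has its label 4 on the last edge, a [B_system] on the first: hence the reversal. *)
Lemma gen_rev_B_system n (R : seq (letter 'I_n) -> seq (letter 'I_n) -> Prop) :
  (forall u v, artin_rel (coxeter_B n) u v -> R u v) ->
  B_system n (fun k => gen R (n.-1 - k)).
Proof.
move=> eR; split=> [i j lt_ij lt_j|i i0 lt_i|n1].
- apply/commute_sym; apply: (gen_path_commute eR); lia.
- have -> : (n.-1 - i = (n.-1 - i.+1).+1)%N by lia.
  apply/esym; apply: (gen_path_braid3 eR); first by lia.
  by rewrite /edges_B; case: eqP => //; lia.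
- have -> : (n.-1 - 0 = (n.-1 - 1).+1)%N by lia.
  apply/esym; apply: (gen_path_braid4 eR); first by lia.
  by rewrite /edges_B; case: eqP => //; lia.
Qed.

Lemma B_system_rev_eval (H : groupType) n (s : nat -> H) : B_system n s ->
  forall u v, artin_rel (coxeter_B n) u v ->
    eval_word (fun i : 'I_n => s (n.-1 - i)) u =
    eval_word (fun i : 'I_n => s (n.-1 - i)) v.
Proof.
move=> [c3 b3 b4].
have Ew (w : seq 'I_n) : eval_word (fun i : 'I_n => s (n.-1 - i)) (positive_word w) =
  \prod_(i <- w) s (n.-1 - i) by exact: (eval_positive_word (fun i => s (n.-1 - i))).
apply: path_relP => //.
- by move=> k _; rewrite /edges_B; case: ifP; [right | left].
- move=> i j lt_ij; rewrite !Ew !big_cons !big_nil !mulg1.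
  by apply/esym/c3; have := ltn_ord j; lia.
- move=> i j Eij; rewrite /edges_B; case: eqP => // i0 _.
  rewrite !Ew !big_cons !big_nil !mulg1 !mulgA Eij.
  have lt_j := ltn_ord j; have -> : (n.-1 - i = (n.-1 - i.+1).+1)%N by lia.
  by apply/esym/b3; lia.
- move=> i j Eij; rewrite /edges_B; case: eqP => // i0 _.
  rewrite !Ew !big_cons !big_nil !mulg1 !mulgA Eij.
  have -> : (n.-1 - i = 1)%N by lia.
  have -> : (n.-1 - i.+1 = 0)%N by lia.
  by apply/esym/b4; lia.
Qed.

(** The marked strand again, now before dividing by the centres. *)
Theorem dim_le_artin_A n d :
  dim_le [set: artin_group (coxeter_B n)] d -> dim_le [set: artin_group (coxeter_A n)] d.
Proof.
pose R := artin_rel (coxeter_B n); pose R' := artin_rel (coxeter_A n).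
pose s k := gen R (n.-1 - k).
have sB : B_system n s by exact: gen_rev_B_system.
have sA : A_system n (gen R') by exact: gen_A_system.
pose f : artin_group (coxeter_B n) -> artin_group (coxeter_A n) :=
  gen_hom (fun k => fold_first (gen R') (n.-1 - k)).
have fR := B_system_rev_eval (fold_first_B_system sA).
have fE k : k < n -> f (s k) = fold_first (gen R') k.
  move=> ltk; rewrite /f (gen_homE fR); last by lia.
  by congr fold_first; lia.
have fM : {morph f : x y / x * y} by exact: gen_homM.
have fS k : k.+1 < n -> f (s k.+1) = gen R' k.+1 by move=> ltk; rewrite fE.
exact: (dim_le_marked_strand (step_A_rel sB) sA fM (fE 0%N) fS).
Qed.

Lemma intertwine_braid3 (H : groupType) (r a a' b b' : H) :
  r * a = a' * r -> r * b = b' * r -> braid3 a b -> braid3 a' b'.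
Proof.
rewrite /braid3 => ra rb ab; apply: (@mulIg _ r).
rewrite -(intertwineM (intertwineM ra rb) ra) ab.
exact: intertwineM (intertwineM rb ra) rb.
Qed.

(** * Affine type A inside annular braid groups *)

Section Cyclic.
Variable n : nat.
Hypothesis n2 : 2 < n.
Local Notation R := (artin_rel (coxeter_affine_A n)).
Local Notation H := (artin_group (coxeter_affine_A n)).
Let n0 : 0 < n := ltnW (ltnW n2).

Definition cyc k : H := gen R (k %% n).

Lemma cyc_mod k : cyc (k %% n) = cyc k. Proof. by rewrite /cyc modn_mod. Qed.

Lemma cyc_add k : cyc (k + n) = cyc k. Proof. by rewrite /cyc modnDr. Qed.

Lemma gen_cycle_rel (i j : 'I_n) m : i < j ->
  m = (if (j == i.+1 :> nat) || ((i == 0 :> nat) && (j.+1 == n)) then 3 else 2) ->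
  \prod_(k <- alternating i j m) gen R k = \prod_(k <- alternating j i m) gen R k.
Proof.
move=> lt_ij Em; apply: gen_rel; exists i, j, m; split=> //.
  by rewrite neq_ltn lt_ij.
rewrite /= /cycle_coxeter_fun -val_eqE (ltn_eqF lt_ij) -!val_eqE /= Em; congr Some.
have ltSi : i.+1 < n by exact: leq_ltn_trans lt_ij _.
rewrite (modn_small ltSi); congr (if _ || _ then _ else _).
case: (ltnP j.+1 n) => [ltSj|geSj].
  by rewrite (modn_small ltSj) (ltn_eqF ltSj) andbF ltn_eqF // leqW.
have ESj : j.+1 = n by apply/eqP; rewrite eqn_leq ltn_ord.
by rewrite ESj modnn eqxx andbT.
Qed.

Lemma gen_cycle_commute i j : i.+1 < j -> j < n -> (0 < i) || (j.+1 < n) ->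
  commute (gen R i) (gen R j).
Proof.
move=> lt_ij lt_j cond; have lt_i : i < n by exact: ltn_trans (ltnW lt_ij) lt_j.
have := @gen_cycle_rel (Ordinal lt_i) (Ordinal lt_j) 2 (ltnW lt_ij).
rewrite /= gtn_eqF //= !big_cons !big_nil !mulg1; apply.
by case: andP => // -[/eqP i0 /eqP j1]; move: cond; rewrite i0 j1 !ltnn.
Qed.

Lemma cyc_commute i d : 1 < d -> d.+1 < n -> commute (cyc i) (cyc (i + d)).
Proof.
move=> d1 dn; rewrite /cyc -modnDml; set r := i %% n.
have ltr : r < n by rewrite ltn_mod.
case: (ltnP (r + d) n) => [lt_rd|ge_rd].
  by rewrite (modn_small lt_rd); apply: gen_cycle_commute => //; lia.
have -> : (r + d = (r + d - n) + n)%N by lia.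
rewrite modnDr modn_small; last by lia.
by apply: commute_sym; apply: gen_cycle_commute; lia.
Qed.

Lemma cyc_braid3 i : braid3 (cyc i) (cyc i.+1).
Proof.
rewrite /cyc -(addn1 i) -modnDml addn1; set r := i %% n.
have ltr : r < n by rewrite ltn_mod.
case: (ltnP r.+1 n) => [lt_r|ge_r].
  rewrite (modn_small lt_r).
  have := @gen_cycle_rel (Ordinal ltr) (Ordinal lt_r) 3 (ltnSn r).
  by rewrite /= eqxx !big_cons !big_nil !mulg1 !mulgA; apply.
have Er : r.+1 = n by lia.
rewrite Er modnn; have r0 : 0 < r by lia.
have := @gen_cycle_rel (Ordinal n0) (Ordinal ltr) 3 r0.
by rewrite /= Er !eqxx orbT !big_cons !big_nil !mulg1 !mulgA /braid3 => ->.
Qed.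

Lemma cyc_A_system a : A_system n.-1 (fun i => cyc (a + i)).
Proof.
split=> [i j lt_ij lt_j|i _]; last by rewrite addnS; exact: cyc_braid3.
have -> : (a + j = a + i + (j - i))%N by lia.
by apply: cyc_commute; lia.
Qed.

Local Notation T := ('I_n * H)%type.

(** At rotation [j] the generator [s_(k+1)] stands for [cyc (j + k)]. Since [s_0] is the full
    rotation step times the inverse of [s_1 ... s_(n-1)], read after the turn to [j + 1], it
    contributes the inverse of this product. *)
Definition cyc_cox (j : 'I_n) := \prod_(k < n.-1) cyc (j.+1 + k).

(* The quotient of the annular braid group permutes the [n] points of a base
   fibre cyclically; this is the induced right action on pairs of a rotation
   and an element of the subgroup of index [n]. *)
Definition turn (i : nat) (t : T) : T :=
  if i is k.+1 then (t.1, t.2 * cyc (t.1 + k))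
  else (ordS t.1, t.2 * (cyc_cox t.1)^-1).

Definition turnV (i : nat) (t : T) : T :=
  if i is k.+1 then (t.1, t.2 * (cyc (t.1 + k))^-1)
  else (ord_pred t.1, t.2 * cyc_cox (ord_pred t.1)).

Lemma turnK i : cancel (turn i) (turnV i).
Proof. by case: i => [|k] [j h] /=; rewrite ?ordSK ?mulgVK ?mulgK. Qed.
Lemma turnVK i : cancel (turnV i) (turn i).
Proof. by case: i => [|k] [j h] /=; rewrite ?ord_predK ?mulgVK ?mulgK. Qed.

Lemma cyc_ordS (j : 'I_n) k : cyc (ordS j + k) = cyc (j.+1 + k).
Proof. by rewrite /cyc /= modnDml. Qed.

Lemma turn_comm i j t : i.+1 < j -> j < n -> turn i (turn j t) = turn j (turn i t).
Proof.
case: t => q h; case: i j => [|i] [|j] //= lt_ij lt_j.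
  congr pair; rewrite cyc_ordS -!mulgA; congr (_ * _).
  case: j lt_ij lt_j => // j _ lt_j.
  set D := cyc_cox q; apply: (@mulgI _ D); apply: (@mulIg _ D).
  rewrite !mulgA mulgV mul1g mulgVK.
  have -> : (q + j.+1 = q.+1 + j)%N by lia.
  by apply: (A_system_cox (cyc_A_system q.+1)) => //; lia.
congr pair; apply: commuteAC.
have -> : (q + j = q + i + (j - i))%N by lia.
by apply/commute_sym/cyc_commute; lia.
Qed.

Lemma turn_braid3 i t : 0 < i -> turn i (turn i.+1 (turn i t)) = turn i.+1 (turn i (turn i.+1 t)).
Proof.
case: t i => q h [//|i] _ /=; congr pair.
by rewrite -!mulgA; congr (_ * _); rewrite !mulgA addnS; exact: cyc_braid3.
Qed.

Lemma turn_braid4 t :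
  turn 1 (turn 0 (turn 1 (turn 0 t))) = turn 0 (turn 1 (turn 0 (turn 1 t))).
Proof.
case: t => q h /=; congr pair; rewrite !addn0.
set D := cyc_cox q; set D1 := cyc_cox (ordS q).
have [m Em] : exists m, n.-1 = m.+1 by exists n.-2; lia.
pose s i := cyc (q.+2 + i); pose E := \prod_(i < m) s i; pose g := cyc q.
have sA : A_system m.+1 s by have := cyc_A_system q.+2; rewrite Em.
have Ds : D = cyc q.+1 * E.
  rewrite /D /cyc_cox Em /= big_ord_recl /= addn0; congr (_ * _); apply: eq_bigr => i _.
  by rewrite /s /bump /= add1n; congr cyc; lia.
have Eg : s m = g.
  rewrite /s; have -> : (q.+2 + m = q + n)%N by lia.
  exact: cyc_add.
have D1s : D1 = E * g.
  rewrite /D1 /cyc_cox Em /= big_ord_recr /= -Eg; congr (_ * _).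
    by apply: eq_bigr => i _; rewrite addSnnS cyc_ordS -addSnnS.
  by rewrite /s addSnnS cyc_ordS -addSnnS.
have c1 : cyc (q.+1 %% n) = cyc q.+1 by exact: cyc_mod.
have c2 : cyc ((q.+1 %% n).+1 %% n) = s 0.
  by rewrite cyc_mod /s addn0 -addn1 /cyc modnDml addn1.
rewrite c1 c2 -/g.
(* After cancellation the relation of length 4 comes down to this identity, an instance of
   [A_system_cox_cox] for the [m.+1] consecutive generators starting at [q.+2]. *)
have EgEg : E * g * E * g = s 0 * (E * g * E).
  have P1 : \prod_(i < m.+1) s i = E * g by rewrite big_ord_recr /= Eg.
  have := A_system_cox_cox sA (ltnSn m); rewrite P1 => PE.
  have P0 : s 0 * \prod_(i < m) s i.+1 = E * g by rewrite -P1 big_ord_recl.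
  by rewrite [in RHS]PE [RHS]mulgA P0 !mulgA.
have Da : D^-1 * cyc q.+1 = E^-1 by rewrite Ds invgM mulgVK.
rewrite -!(mulgA _ D^-1) Da D1s -!mulgA; congr (_ * _).
apply: (@mulgI _ (E * g * E)); rewrite !mulgA EgEg.
by rewrite !invgM !mulgA !mulgK mulgV mul1g.
Qed.

Definition turns (t : T) : T := foldl (fun t i => turn i t) t (iota 0 n).

Lemma turnsE t : turns t = (ordS t.1, t.2).
Proof.
case: t => q h; rewrite /turns.
have -> : iota 0 n = 0%N :: iota 1 n.-1 by rewrite -{1}(prednK n0).
rewrite /=.
suff -> l : foldl (fun t i => turn i t) (ordS q, h * (cyc_cox q)^-1) (iota 1 l) =
    (ordS q, h * (cyc_cox q)^-1 * \prod_(k < l) cyc (q.+1 + k)).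
  by rewrite mulgVK.
elim: l => [|l IH]; first by rewrite big_ord0 mulg1.
have -> : iota 1 l.+1 = iota 1 l ++ [:: l.+1] by rewrite -(addn1 l) iotaD add1n addn1.
rewrite foldl_cat IH /= big_ord_recr /= mulgA.
by rewrite -[(q.+1 %% n + l)%N]/(ordS q + l)%N cyc_ordS.
Qed.

Lemma iter_turns k q h : iter k turns (q, h) = (iter k (@ordS n) q, h).
Proof. by elim: k => //= k ->; rewrite turnsE. Qed.

Lemma val_iter_ordS k (q : 'I_n) : val (iter k (@ordS n) q) = ((q + k) %% n)%N.
Proof.
elim: k => [|k IH] /=; first by rewrite addn0 modn_small.
by rewrite IH -addn1 modnDml addn1 addnS.
Qed.

Lemma iter_turns_full t : iter n turns t = t.
Proof.
case: t => q h; rewrite iter_turns; congr pair; apply: val_inj.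
by rewrite val_iter_ordS modnDr modn_small.
Qed.

Local Notation actw := (act_word (fun i : 'I_n => turnV i) (fun i : 'I_n => turn i)).
Local Notation R0 := (cox_quot_rel (coxeter_B0 n) n).

Lemma turn_rel u v : R0 u v -> forall t, actw u t = actw v t.
Proof.
case=> [|[-> ->] t].
  move: u v; apply: path_relP => //.
  - by move=> k _; rewrite /edges_B0; case: ifP; [right | left].
  - move=> i j lt_ij t; rewrite /act_word /= /act_letter /=.
    have {1}-> : t = turn i (turn j (turnV j (turnV i t))) by rewrite !turnVK.
    by rewrite turn_comm // !turnK.
  - move=> i j Eij; rewrite /edges_B0; case: eqP => // i0 _ t.
    rewrite /act_word /= /act_letter /= Eij.
    have {1}-> : t = turn i.+1 (turn i (turn i.+1 (turnV i.+1 (turnV i (turnV i.+1 t))))).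
      by rewrite !turnVK.
    by rewrite -turn_braid3 ?lt0n ?(introN eqP) // !turnK.
  - move=> i j Eij; rewrite /edges_B0; case: eqP => // i0 _ t.
    rewrite /act_word /= /act_letter /= Eij i0.
    have {1}-> : t = turn 0 (turn 1 (turn 0 (turn 1
        (turnV 1 (turnV 0 (turnV 1 (turnV 0 t))))))) by rewrite !turnVK.
    by rewrite -turn_braid4 !turnK.
have turnw (w : seq 'I_n) t0 :
    actw (positive_word w) (foldl (fun t i => turn i t) t0 (map val w)) = t0.
  elim: w t0 => //= a w IH t0.
  by rewrite /act_letter /= -/(act_word _ _ _ _) IH turnK.
have pw k t0 : actw (cox_power_word n k) (iter k turns t0) = t0.
  rewrite /cox_power_word; elim: k t0 => // k IH t0.
  by rewrite iterSr /= act_word_cat IH /turns -val_enum_ord turnw.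
by rewrite -{1}[t]iter_turns_full pw.
Qed.

Local Notation G := (annular_quot n).
Local Notation s := (gen R0).
Let rho : G := cox_elt n s.
Let sB : B_system n s. Proof. by apply: gen_B_system => ? ? ?; left. Qed.
Let rhon : rho ^+ n = 1. Proof. exact: cox_quot_power. Qed.

(** The rotated copies of [s 1]. They are the generators [s k.+1] for [k.+1 < n]; the next one, the
    crossing of the last point with the first, closes the cycle. *)
Definition cyc_conj : nat -> G := locked (fun k => rho ^+ k * s 1%N * rho ^- k).

Lemma cyc_conj_def k : cyc_conj k = rho ^+ k * s 1%N * rho ^- k.
Proof. by rewrite /cyc_conj -lock. Qed.

Lemma cyc_conj_add k d : rho ^+ k * cyc_conj d = cyc_conj (k + d) * rho ^+ k.
Proof. by rewrite !cyc_conj_def !expgnDr invgM !mulgA mulgVK. Qed.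

Lemma cyc_conjE k : k.+1 < n -> cyc_conj k = s k.+1.
Proof. by move=> ltk; rewrite cyc_conj_def (cox_iter sB ltk) mulgK. Qed.

Lemma cyc_conj_n : cyc_conj n = cyc_conj 0.
Proof. by rewrite !cyc_conj_def rhon expg0. Qed.

Lemma cyc_conj_braid3 k : braid3 (cyc_conj k) (cyc_conj k.+1).
Proof.
rewrite -[k in cyc_conj k]addn0 -addn1.
apply: intertwine_braid3 (cyc_conj_add k 0) (cyc_conj_add k 1) _.
rewrite !cyc_conjE //; last exact: ltnW.
by case: sB => _ + _; apply.
Qed.

Lemma cyc_conj_rel u v : R u v ->
  eval_word (fun i : 'I_n => cyc_conj i) u = eval_word (fun i : 'I_n => cyc_conj i) v.
Proof.
move: u v; apply: cycle_relP => //.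
- move=> i j lt_ij cond; rewrite !eval_positive_word !big_cons !big_nil !mulg1.
  have lt_j := ltn_ord j.
  have Ej : nat_of_ord j = (i + (j - i))%N by lia.
  suff : commute (cyc_conj (i + 0)) (cyc_conj (i + (j - i))) by rewrite addn0 -Ej.
  apply: intertwine_commute (cyc_conj_add i 0) (cyc_conj_add i (j - i)) _.
  by rewrite !cyc_conjE; [case: sB => + _ _; apply; lia | lia | lia].
- move=> i j Eij; rewrite !eval_positive_word !big_cons !big_nil !mulg1 !mulgA Eij.
  exact: cyc_conj_braid3.
- move=> i j i0 Ej; rewrite !eval_positive_word !big_cons !big_nil !mulg1 !mulgA i0.
  have -> : cyc_conj 0 = cyc_conj j.+1 by rewrite Ej cyc_conj_n.
  exact/esym/cyc_conj_braid3.
Qed.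

Definition affine_A_emb : H -> G := gen_hom cyc_conj.

(** The inverse of the image of [x] sends [(o, h)] to [(o, h * x)], so [x] can be read off from its
    image. *)
Lemma affine_A_embeds : injective affine_A_emb.
Proof.
pose act : G -> T -> T := gen_act turnV turn.
have K k : k < n -> cancel (turn k) (turnV k) by move=> _; exact: turnK.
have VK k : k < n -> cancel (turnV k) (turn k) by move=> _; exact: turnVK.
have actM x y t : act (x * y) t = act x (act y t) by exact: (gen_actM K VK turn_rel).
have act1 t : act 1 t = t by exact: (gen_act1 K VK turn_rel).
have actVE k t : k < n -> act (s k)^-1 t = turn k t by exact: (gen_actVE K VK turn_rel).
have act_rho t : act rho^-1 t = turns t.
  suff prodE l : l <= n -> act (\prod_(i < l) s i)^-1 t =
      foldl (fun t i => turn i t) t (iota 0 l) by exact: prodE.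
  elim: l => [|l IH] ltl; first by rewrite big_ord0 invg1 act1.
  have -> : iota 0 l.+1 = iota 0 l ++ [:: l] by rewrite -(addn1 l) iotaD.
  by rewrite foldl_cat big_ord_recr /= invgM actM IH ?(ltnW ltl) // actVE.
have act_rhoX k t : act (rho ^+ k)^-1 t = iter k turns t.
  elim: k t => [|k IH] t; first by rewrite invg1 act1.
  by rewrite expgSr invgM actM IH act_rho iterS.
pose o := Ordinal n0.
have act_conj k h : k < n -> act (cyc_conj k)^-1 (o, h) = (o, h * cyc k).
  move=> ltk; rewrite cyc_conj_def !invgM invgK !actM act_rhoX iter_turns actVE //=; last exact: ltnW.
  apply: (can_inj (f := act (rho ^+ k)^-1) (g := act (rho ^+ k))).
    by move=> t; rewrite -actM mulgV act1.
  by rewrite -actM mulVg act1 act_rhoX iter_turns addn0 val_iter_ordS add0n cyc_mod.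
have iotaM : {morph affine_A_emb : x y / x * y} by exact: (gen_homM cyc_conj_rel).
have iotaE k : k < n -> affine_A_emb (gen R k) = cyc_conj k by exact: (gen_homE cyc_conj_rel).
have actV_inj g t : act g (act g^-1 t) = t by rewrite -actM mulgV act1.
suff tr x h : act (affine_A_emb x)^-1 (o, h) = (o, h * x).
  by move=> x y Exy; have := tr x 1; rewrite Exy tr !mul1g => -[].
move: h; elim/gen_ind: x => [|k x ltk IH|k x ltk IH] h.
- by rewrite (morph1g iotaM) invg1 act1 mulg1.
- rewrite iotaM invgM actM iotaE // act_conj // IH.
  rewrite -mulgA; congr (_, _ * (_ * _)).
  by rewrite /cyc modn_small.
- rewrite iotaM (morphVg iotaM) invgM invgK actM iotaE //.
  have -> : act (cyc_conj k) (o, h) = (o, h * (gen R k)^-1).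
    rewrite -[RHS](actV_inj (cyc_conj k)) act_conj //.
    by rewrite /cyc modn_small // mulgVK.
  by rewrite IH mulgA.
Qed.

Theorem dim_le_affine_A d : dim_le [set: annular_quot n] d -> dim_le [set: H] d.
Proof.
apply: dim_le_inj affine_A_embeds.
exact: gen_homM cyc_conj_rel.
Qed.

End Cyclic.

Fixpoint rprod (H : groupType) (x : nat -> H) k :=
  if k is l.+1 then x l * rprod x l else 1.

Lemma rprod_pred (H : groupType) (x : nat -> H) k :
  0 < k -> rprod x k = x k.-1 * rprod x k.-1.
Proof. by case: k. Qed.

Lemma prod_rprod (H : groupType) (x : nat -> H) k :
  \prod_(i < k) x (k - i.+1)%N = rprod x k.
Proof.
elim: k => [|k IH]; first by rewrite big_ord0.
by rewrite big_ord_recl /= subn1 -IH.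
Qed.

(** * Affine type C over annular braid groups *)

Section ArtinActionTotal.
Variable n : nat.
Local Notation f := (gen (fun _ _ : seq (letter 'I_n) => False)).

Lemma aut_rprod_le i k : i.+1 < n -> k <= i -> aut i.+1 (rprod f k) = rprod f k.
Proof.
move=> lti; elim: k => [|k IH] ltk; first by rewrite (morph1g (@autM _ _)).
by rewrite /= autM IH ?(ltnW ltk) // aut_other //; lia.
Qed.

(** Artin's automorphisms fix the loop around the first [k] points. With the formulas chosen, its
    factors come in decreasing order, whence [rprod]. *)
Lemma aut_rprod i k : i.+1 < k -> k <= n -> aut i.+1 (rprod f k) = rprod f k.
Proof.
elim: k => // k IH; rewrite ltnS leq_eqVlt => /predU1P[<-|lt_ik] ltk.
  rewrite /= !autM aut_rprod_le // aut_at // aut_pred // !mulgA.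
  by rewrite mulgV mul1g.
by rewrite /= autM IH ?(ltnW ltk) // aut_other //; lia.
Qed.

Lemma aut_rprod_gt0 i k : 0 < i -> i < k -> k <= n -> aut i (rprod f k) = rprod f k.
Proof. by case: i => // i _; exact: aut_rprod. Qed.

Lemma aut_rprod_lt i k : k < i -> i < n -> aut i (rprod f k) = rprod f k.
Proof. by case: i => // i ltk lti; exact: aut_rprod_le. Qed.

Lemma aut_at_gt0 i : 0 < i -> i < n -> aut i (f i) = f i.-1.
Proof. by case: i => // i _; exact: aut_at. Qed.

Lemma aut_pred_gt0 i : 0 < i -> i < n -> aut i (f i.-1) = (f i.-1)^-1 * f i * f i.-1.
Proof. by case: i => // i _; exact: aut_pred. Qed.

End ArtinActionTotal.

Section AffineC.
Variable m : nat.
Hypothesis m1 : 1 < m.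
Local Notation n := m.+1.
Local Notation R := (artin_rel (coxeter_affine_C n)).
Local Notation G := (artin_group (coxeter_affine_C n)).
Local Notation r := (gen R).
Local Notation F := (free_group n).
Local Notation f := (gen (fun _ _ : seq (letter 'I_n) => False)).
Local Notation x := (orbit_elt r).

Let r_comm i j : i.+1 < j -> j < n -> commute (r i) (r j).
Proof. exact: (gen_path_commute (e2 := edges_affine_C_ge2 n)). Qed.

Let r_braid3 i : 0 < i -> i.+1 < m -> braid3 (r i) (r i.+1).
Proof.
move=> i0 lti; apply: (gen_path_braid3 (e2 := edges_affine_C_ge2 n)) => //; first by lia.
by rewrite /edges_affine_C; case: ifP => //; lia.
Qed.

Let r_braid4 : braid4 (r 0) (r 1%N).
Proof. by apply: (gen_path_braid4 (e2 := edges_affine_C_ge2 n)) => //; lia. Qed.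

Let r_braid4' : braid4 (r m.-1) (r m).
Proof.
have -> : r m = r m.-1.+1 by congr gen; lia.
apply: (gen_path_braid4 (e2 := edges_affine_C_ge2 n)) => //.
  by lia.
by rewrite /edges_affine_C; case: ifP => //; lia.
Qed.

Lemma affine_C_B_system : B_system m r.
Proof. by split=> [i j lt_ij lt_j|i|_]; [apply: r_comm; lia | exact: r_braid3 | exact: r_braid4]. Qed.

(** The diagram read from its other end: [lam 0 = r m] winds around the puncture that is kept when
    the one of [r 0] is filled in. The full rotation [z] around it is central among the [lam] and
    dies in [annular_quot m], so it has to lie in the kernel. *)
Let lam k := r (m - k).

Lemma affine_C_rev_B_system : B_system m lam.
Proof.
split=> [i j lt_ij lt_j|i i0 lt_i|_].
- by apply/commute_sym/r_comm; lia.
- rewrite /lam; have -> : (m - i = (m - i.+1).+1)%N by lia.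
  by apply/esym/r_braid3; lia.
- by rewrite /lam subn0 subn1; exact/esym/r_braid4'.
Qed.

Let rB := affine_C_B_system.
Let lamB := affine_C_rev_B_system.
Let rho := cox_elt m lam.
Let z := rho ^+ m.

Lemma affine_C_cox : rho = rprod (fun i => r i.+1) m.
Proof.
rewrite -prod_rprod /rho /cox_elt; apply: eq_bigr => i _.
by rewrite /lam; congr (gen _ _); have := ltn_ord i; lia.
Qed.

Lemma affine_C_cox_orbit k : k.+1 < m -> rho * x k.+1 = x k * rho.
Proof.
elim: k => [_|k IH ltk].
  rewrite affine_C_cox orbit_eltE orbit_elt0.
  suff H0 l : l < m -> rprod (fun i => r i.+1) l.+1 * ((r 1%N)^-1 * r 0 * r 1%N) =
      r 0 * rprod (fun i => r i.+1) l.+1.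
    have := H0 m.-1; have -> : m.-1.+1 = m by lia.
    by apply; lia.
  elim: l => [|l IHl] ltl; first by rewrite /= !mulg1 !mulgA mulgV mul1g.
  rewrite [rprod _ l.+2]/= -mulgA IHl ?(ltnW ltl) // !mulgA.
  have c : commute (r 0) (r l.+2) by apply: r_comm; lia.
  by rewrite c.
have sh : rho * r k.+2 = r k.+1 * rho.
  have := cox_shift lamB (i := m - k.+2); rewrite /lam.
  have -> : (m - (m - k.+2) = k.+2)%N by lia.
  have -> : (m - (m - k.+2).+1 = k.+1)%N by lia.
  by apply; lia.
rewrite [x k.+2]orbit_eltE [x k.+1 in RHS]orbit_eltE.
apply: intertwineM (sh); exact: intertwineM (intertwineV sh) (IH (ltnW ltk)).
Qed.

Lemma affine_C_cox_pow_orbit j k : j + k < m -> rho ^+ j * x (k + j) = x k * rho ^+ j.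
Proof.
elim: j k => [|j IH] k ltjk; first by rewrite addn0 mul1g mulg1.
rewrite expgSr -mulgA addnS affine_C_cox_orbit; last by lia.
by rewrite !mulgA IH; last by lia.
Qed.

(* The loops of the last puncture around the moving points, and around infinity. *)
Definition affine_C_loop k : G := if k < m then x k else z^-1 * (rprod x m)^-1.

Let psi : F -> G := gen_hom affine_C_loop.

Lemma psiM : {morph psi : u v / u * v}. Proof. exact: gen_homM. Qed.

Lemma psi_orbit k : k < m -> psi (f k) = x k.
Proof. by move=> ltk; rewrite /psi gen_homE ?(leqW ltk) // /affine_C_loop ltk. Qed.

Lemma psi_last : psi (f m) = z^-1 * (rprod x m)^-1.
Proof. by rewrite /psi gen_homE // /affine_C_loop ltnn. Qed.

(** A point winds around the kept puncture as around a fixed extra strand [m], so [r m] acts as the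
    square of the crossing [aut m], as in [fold_first]. *)
Definition affine_C_aut i : F -> F := if i < m then aut i else aut m \o aut m.
Definition affine_C_autV i : F -> F := if i < m then autV i else autV m \o autV m.

Lemma affine_C_autK i : i < n -> cancel (affine_C_aut i) (affine_C_autV i).
Proof.
move=> lti w; rewrite /affine_C_aut /affine_C_autV; case: ifP => _; first exact: autK.
by rewrite /= !autK.
Qed.

Lemma affine_C_autVK i : i < n -> cancel (affine_C_autV i) (affine_C_aut i).
Proof.
move=> lti w; rewrite /affine_C_aut /affine_C_autV; case: ifP => _; first exact: autVK.
by rewrite /= !autVK.
Qed.

Lemma affine_C_autM i : {morph affine_C_aut i : u v / u * v}.
Proof. by move=> u v; rewrite /affine_C_aut; case: ifP => _; rewrite /= !autM. Qed.

Lemma affine_C_aut_rel u v : R u v -> forall t : F,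
  act_word (fun i : 'I_n => affine_C_aut i) (fun i : 'I_n => affine_C_autV i) u t =
  act_word (fun i : 'I_n => affine_C_aut i) (fun i : 'I_n => affine_C_autV i) v t.
Proof.
move: u v; apply: path_relP => //.
- by move=> k _; rewrite /edges_affine_C; case: ifP; [right | left].
- move=> i j lt_ij t; rewrite /act_word /= /act_letter /=.
  have lt_j := ltn_ord j; have lt_im : i < m by lia.
  rewrite /affine_C_aut lt_im; case: ifP => ltjm /=; first exact: aut_comm.
  have ltim : i.+1 < m by lia.
  by rewrite (aut_comm (i := i) (j := m)) // (aut_comm (i := i) (j := m)).
- move=> i j Eij; rewrite /edges_affine_C; case: ifP => // /negbT.
  rewrite negb_or => /andP[i0 im] _ t.
  have lt_j := ltn_ord j; have lt_jm : i.+1 < m by lia.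
  rewrite /act_word /= /act_letter /= Eij /affine_C_aut lt_jm (ltnW lt_jm).
  by rewrite -(prednK (_ : 0 < i)) ?lt0n //; apply: aut_braid3; lia.
- move=> i j Eij; rewrite /edges_affine_C; case: ifP => // + _ t.
  rewrite /act_word /= /act_letter /= Eij /affine_C_aut => /orP[/eqP i0|/eqP Ei].
    by rewrite i0 (ltnW m1) m1 aut_braid4 // ltnW.
  have Ei1 : i.+1 = m by lia.
  have lt_im : i < m by lia.
  rewrite lt_im Ei1 ltnn /=.
  (* The relation of length 4 between [aut i] and the square of [aut m] follows from the braid
     relation between [aut i] and [aut m]. *)
  have br w : aut i (aut m (aut i w)) = aut m (aut i (aut m w)) :> F.
    have := @aut_braid3 n i.-1 w; have -> : i.-1.+2 = m by lia.
    have -> : i.-1.+1 = i by lia.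
    by apply.
  by rewrite -br -[in RHS]br (br (aut m (aut i (aut m t)))) (br t).
Qed.

Let Phi : G -> F -> F := gen_act affine_C_aut affine_C_autV.

Let PhiM y y' w : Phi (y * y') w = Phi y (Phi y' w).
Proof. exact: (gen_actM affine_C_autVK affine_C_autK affine_C_aut_rel). Qed.
Let Phi1 w : Phi 1 w = w.
Proof. exact: (gen_act1 affine_C_autVK affine_C_autK affine_C_aut_rel). Qed.
Let Phi_morph : forall g, {morph Phi g : u v / u * v}.
Proof.
by apply: (gen_act_morph affine_C_autVK affine_C_autK affine_C_aut_rel) => k _; exact: affine_C_autM.
Qed.
Let PhiE k : k < n -> Phi (r k) =1 affine_C_aut k.
Proof. by move=> ltk w; exact: (gen_actE affine_C_autVK affine_C_autK affine_C_aut_rel). Qed.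
Let Phi_aut k : k < m -> Phi (r k) =1 @aut n k.
Proof. by move=> ltk w; rewrite PhiE ?(leqW ltk) // /affine_C_aut ltk. Qed.
Let Phi_x k : k < m -> forall v, Phi (x k) v = f k * v * (f k)^-1.
Proof. exact: (Phi_orbit PhiM Phi1 Phi_morph (leqnSn m) Phi_aut). Qed.
(* Locked, lest it be unfolded to a product. *)
Let X := locked (rprod f n).
Let XE : X = rprod f n. Proof. by rewrite /X -lock. Qed.
Let Phi_V g := morphVg (Phi_morph g).

Lemma Phi_rprod_orbit k : k <= m -> forall v,
  Phi (rprod x k) v = rprod f k * v * (rprod f k)^-1.
Proof.
elim: k => [_ v|k IH ltk v]; first by rewrite Phi1 invg1 mulg1 mul1g.
by rewrite /= PhiM IH ?(ltnW ltk) // Phi_x // invgM !mulgA.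
Qed.

Lemma Phi_cox_X : Phi rho X = X.
Proof.
rewrite affine_C_cox XE; suff H0 l : l <= m -> Phi (rprod (fun i => r i.+1) l) (rprod f n) = rprod f n by exact: H0.
elim: l => [_|l IH ltl]; first exact: Phi1.
rewrite [rprod _ l.+1]/= PhiM IH ?(ltnW ltl) // PhiE // /affine_C_aut; case: ifP => _.
  by rewrite aut_rprod //; lia.
by rewrite /comp !aut_rprod_gt0 // ltnW.
Qed.

Lemma Phi_cox_f0 : Phi rho (f 0) = X^-1 * f m.-1 * X.
Proof.
have m0 := ltnW m1.
have H0 l : l < m -> Phi (rprod (fun i => r i.+1) l) (f 0) = (rprod f l)^-1 * f l * rprod f l.
  elim: l => [_|l IH ltl]; first by rewrite Phi1 invg1 mulg1 mul1g.
  have ltl' : l.+1 < n by lia.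
  rewrite [rprod _ l.+1]/= PhiM IH ?(ltnW ltl) // Phi_aut //.
  rewrite !autM aut_inv aut_rprod_le // aut_pred //.
  by rewrite /= invgM !mulgA.
have E : rprod (fun i => r i.+1) m = r m * rprod (fun i => r i.+1) m.-1.
  by rewrite rprod_pred // prednK.
rewrite affine_C_cox E PhiM H0 ?PhiE //; last by lia.
rewrite /affine_C_aut ltnn /=.
have Xm : aut m X = X by rewrite XE; exact: aut_rprod_gt0.
have Ym : aut m (rprod f m.-1) = rprod f m.-1 by apply: aut_rprod_lt; lia.
have fm : aut m (f m.-1) = (f m.-1)^-1 * f m * f m.-1.
  exact: aut_pred_gt0.
have EX : X = f m * (f m.-1 * rprod f m.-1) by rewrite XE -rprod_pred.
have -> : aut m ((rprod f m.-1)^-1 * f m.-1 * rprod f m.-1) = X^-1 * f m * X.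
  rewrite !autM aut_inv Ym fm EX !invgM !mulgA.
  by rewrite mulgVK.
by rewrite 2!autM aut_inv Xm aut_at_gt0.
Qed.

(** Both sides have the same inner automorphism, by [affine_C_cox_orbit]; this spares computing
    [Phi rho] on words. *)
Lemma Phi_cox_fS k : k.+1 < m -> Phi rho (f k.+1) = f k.
Proof.
move=> ltk; apply: free_group_inner_inj => [|v]; first by lia.
rewrite -(Phi_inner_conj PhiM Phi1 Phi_morph _ (Phi_x ltk)) -Phi_x ?(ltnW ltk) //.
by rewrite affine_C_cox_orbit // mulgK.
Qed.

Lemma Phi_coxX_f j k : k + j < m -> Phi (rho ^+ j) (f (k + j)) = f k.
Proof.
elim: j k => [|j IH] k ltkj; first by rewrite addn0 Phi1.
rewrite expgSr PhiM addnS Phi_cox_fS; last by lia.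
by apply: IH; lia.
Qed.

Lemma Phi_coxX_X j : Phi (rho ^+ j) X = X.
Proof. by elim: j => [|j IH]; rewrite ?Phi1 // expgSr PhiM Phi_cox_X. Qed.

(** [rho] lowers the index of [f] and sends [f 0] to [f m.-1] conjugated by the invariant [X]. In
    [m] turns each [f k] with [k < m] passes 0 once and picks up one such conjugation; the value at
    [f m] follows because [X] is fixed. *)
Lemma Phi_z v : Phi z v = X^-1 * v * X.
Proof.
have zf k : k < m -> Phi z (f k) = X^-1 * f k * X.
  move=> ltk; have -> : z = rho ^+ (m.-1 - k) * (rho * rho ^+ k).
    by rewrite -expgS -expgnDr /z; congr (_ ^+ _); lia.
  have fk : Phi (rho ^+ k) (f k) = f 0 by have := @Phi_coxX_f k 0 ltk; rewrite add0n.
  rewrite !PhiM fk Phi_cox_f0 2!Phi_morph Phi_V Phi_coxX_X.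
  have -> : Phi (rho ^+ (m.-1 - k)) (f m.-1) = f k; last by [].
  have := @Phi_coxX_f (m.-1 - k) k; have -> : (k + (m.-1 - k) = m.-1)%N by lia.
  by apply; lia.
have zY : Phi z (rprod f m) = X^-1 * rprod f m * X.
  suff H0 l : l <= m -> Phi z (rprod f l) = X^-1 * rprod f l * X by exact: H0.
  elim: l => [_|l IH ltl]; first by rewrite (morph1g (Phi_morph z)) mulg1 mulVg.
  by rewrite /= Phi_morph IH ?(ltnW ltl) // zf // !mulgA mulgK.
move: v; apply: gen_morph_ext; first exact: Phi_morph.
  by move=> u v; rewrite !mulgA mulgK.
move=> k; rewrite ltnS leq_eqVlt => /predU1P[->|]; last exact: zf.
have -> : f m = X * (rprod f m)^-1 by rewrite XE /= mulgK.
by rewrite Phi_morph Phi_V Phi_coxX_X zY !invgM invgK !mulgA mulgV mul1g mulVg mul1g.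
Qed.

(** This dictates [affine_C_loop]: since [z] acts as the inner automorphism of [X^-1], its last
    value acts as that of [X * (rprod f m)^-1], which is [f m]. *)
Lemma Phi_psi_inner w v : Phi (psi w) v = w * v * w^-1.
Proof.
move: w v; apply: (Phi_psi PhiM Phi1 (x := affine_C_loop)) => k ltk v.
rewrite /affine_C_loop; case: ifP => [|/negbT gek]; first by move=> ltkm; exact: Phi_x.
have -> : k = m by lia.
have PhiVI g u : (forall w, Phi g w = u * w * u^-1) -> forall w, Phi g^-1 w = u^-1 * w * u.
  move=> Phig w; have {1}-> : w = Phi g (u^-1 * w * u).
    by rewrite Phig !mulgA mulgV mul1g mulgK.
  by rewrite -PhiM mulVg Phi1.
rewrite PhiM (PhiVI _ _ (Phi_rprod_orbit (leqnn m))).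
have -> w : Phi z^-1 w = X * w * X^-1.
  by rewrite (PhiVI z X^-1) ?invgK // => u; rewrite Phi_z.
by rewrite XE /= invgM !mulgA !mulgK.
Qed.

Let N : set G := range psi.

Lemma N_1 : N 1. Proof. by exists 1; rewrite ?(morph1g psiM). Qed.
Lemma N_M y y' : N y -> N y' -> N (y * y').
Proof. by move=> [w _ <-] [w' _ <-]; exists (w * w'); rewrite ?psiM. Qed.
Lemma N_V y : N y -> N y^-1.
Proof. by move=> [w _ <-]; exists w^-1; rewrite ?(morphVg psiM). Qed.
Lemma N_x k : k < m -> N (x k).
Proof. by move=> ltk; exists (f k); rewrite ?psi_orbit. Qed.
Lemma N_z : N z.
Proof.
have NY : N (rprod x m).
  suff H0 l : l <= m -> N (rprod x l) by exact: H0.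
  elim: l => [_|l IH ltl]; first exact: N_1.
  by apply: N_M; [exact: N_x | exact/IH/ltnW].
have Nl : N (z^-1 * (rprod x m)^-1) by exists (f m); rewrite ?psi_last.
by rewrite -[z]invgK; apply: N_V; rewrite -[z^-1](mulgVK (rprod x m)); exact: N_M.
Qed.

(** An inclusion only, stable under products but not obviously under inverses; hence each generator
    is treated together with its inverse. *)
Definition normalizes (g : G) := forall y, N y -> N (g * y * g^-1).

Lemma normalizesM g h : normalizes g -> normalizes h -> normalizes (g * h).
Proof.
move=> Ng Nh y Ny; have := Ng _ (Nh _ Ny).
by rewrite invgM !mulgA.
Qed.

Lemma N_normalizes g : N g -> normalizes g.
Proof. by move=> Ng y Ny; apply: N_M; [exact: N_M | exact: N_V]. Qed.

Lemma normalizes_gens g : (forall k, k < m -> N (g * x k * g^-1)) -> N (g * z * g^-1) ->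
  normalizes g.
Proof.
move=> gx gz _ [w _ <-].
have cM y y' : g * (y * y') * g^-1 = (g * y * g^-1) * (g * y' * g^-1) by rewrite !mulgA mulgVK.
have cV y : g * y^-1 * g^-1 = (g * y * g^-1)^-1 by rewrite !invgM invgK mulgA.
have gY : N (g * rprod x m * g^-1).
  suff H0 l : l <= m -> N (g * rprod x l * g^-1) by exact: H0.
  elim: l => [_|l IH ltl]; first by rewrite mulg1 mulgV; exact: N_1.
  by rewrite /= cM; apply: N_M; [exact: gx | exact/IH/ltnW].
have gpsi k : k < n -> N (g * psi (f k) * g^-1).
  rewrite ltnS leq_eqVlt => /predU1P[->|ltk]; last by rewrite psi_orbit //; exact: gx.
  by rewrite psi_last cM !cV; apply: N_M; exact: N_V.
elim/gen_ind: w => [|k w ltk IH|k w ltk IH].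
- by rewrite (morph1g psiM) mulg1 mulgV; exact: N_1.
- by rewrite psiM cM; apply: N_M => //; exact: gpsi.
- by rewrite psiM cM (morphVg psiM) cV; apply: N_M => //; apply: N_V; exact: gpsi.
Qed.

Lemma normalizes_cox : normalizes rho /\ normalizes rho^-1.
Proof.
have m0 := ltnW m1.
have xS k : k.+1 < m -> rho * x k.+1 * rho^-1 = x k.
  by move=> ltk; rewrite affine_C_cox_orbit // mulgK.
have zr : rho * z = z * rho by rewrite /z -expgS expgSr.
(* [rho ^+ m.-1] takes [x m.-1] to [x 0], so one more turn completes [z]. *)
have x0 : rho * x 0 * rho^-1 = z * x m.-1 * z^-1.
  have := affine_C_cox_pow_orbit (j := m.-1) (k := 0); rewrite add0n addn0 => E.
  have {}E : x 0 = rho ^+ m.-1 * x m.-1 * (rho ^+ m.-1)^-1 by rewrite E ?mulgK //; lia.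
  have -> : z = rho * rho ^+ m.-1 by rewrite -expgS /z; congr (_ ^+ _); lia.
  by rewrite E invgM !mulgA.
split; apply: normalizes_gens.
- move=> [_|k ltk]; last by rewrite xS //; exact/N_x/ltnW.
  rewrite x0; apply: N_M; last exact/N_V/N_z.
  by apply: N_M; [exact: N_z | apply: N_x; lia].
- by rewrite zr mulgK; exact: N_z.
- move=> k; case: (ltnP k.+1 m) => [ltk _|gek ltk].
    have -> : rho^-1 * x k * rho^-1^-1 = x k.+1.
      by rewrite invgK -(xS k ltk) !mulgA mulVg mul1g mulgVK.
    exact: N_x.
  have -> : k = m.-1 by lia.
  have -> : rho^-1 * x m.-1 * rho^-1^-1 = z^-1 * x 0 * z.
    have -> : x m.-1 = z^-1 * (rho * x 0 * rho^-1) * z.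
      by rewrite x0 !mulgA mulVg mul1g mulgVK.
    have zrV : rho^-1 * z^-1 = z^-1 * rho^-1 by rewrite -!invgM zr.
    by rewrite invgK !mulgA zrV mulgVK -(mulgA _ z rho) -zr !mulgA mulgVK.
  apply: N_M; last exact: N_z.
  by apply: N_M; [exact/N_V/N_z | exact: N_x].
- by rewrite invgK -mulgA -zr mulKg; exact: N_z.
Qed.

Lemma normalizes_r i : i.+1 < m -> normalizes (r i.+1) /\ normalizes (r i.+1)^-1.
Proof.
move=> lti; have lti' := ltnW lti.
have zr : commute z (r i.+1).
  have := cox_pow_central lamB (k := m - i.+1); rewrite /lam.
  have -> : (m - (m - i.+1) = i.+1)%N by lia.
  by apply; lia.
have rx k : k < m -> k != i -> k != i.+1 -> commute (r i.+1) (x k).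
  move=> ltk ki kSi; case: (ltngtP k i) => [ltki|ltik|Eki]; last by rewrite Eki eqxx in ki.
    exact: (orbit_commute_above rB).
  by apply: (orbit_commute_below rB) => //; lia.
have rxi := orbit_braid_conj rB lti.
have rxSi : r i.+1 * x i.+1 * (r i.+1)^-1 = x i by rewrite orbit_eltS mulgK.
split; apply: normalizes_gens.
- move=> k ltk; case: (eqVneq k i) => [->|ki]; last case: (eqVneq k i.+1) => [->|kSi].
  + by rewrite rxi; apply: N_M; [apply: N_M; [apply: N_V|] |]; exact: N_x.
  + by rewrite rxSi; exact: N_x.
  + by rewrite rx // mulgK; exact: N_x.
- by rewrite -zr mulgK; exact: N_z.
- rewrite invgK; move=> k ltk; case: (eqVneq k i) => [->|ki]; last case: (eqVneq k i.+1) => [->|kSi].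
  + by rewrite -orbit_eltE; exact: N_x.
  + have -> : (r i.+1)^-1 * x i.+1 * r i.+1 = x i.+1 * x i * (x i.+1)^-1.
      have c := orbit_pair_commute rB lti.
      apply: (@mulgI _ (r i.+1)); apply: (@mulIg _ (x i.+1)).
      rewrite !mulgA mulgV mul1g mulgVK -[LHS]mulgA orbit_eltS mulgA -c.
      by rewrite -orbit_eltS mulgA.
    by apply: N_M; [apply: N_M|apply: N_V]; exact: N_x.
  + by rewrite -mulgA -rx // mulKg; exact: N_x.
- by rewrite invgK -mulgA zr mulKg; exact: N_z.
Qed.

Lemma affine_C_normal g y : N y -> N (g * y * g^-1).
Proof.
have m0 := ltnW m1.
have N0 : N (r 0) by rewrite -(orbit_elt0 r); exact: N_x.
have Nprod l : l < m -> normalizes (rprod (fun i => r i.+1) l) /\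
    normalizes (rprod (fun i => r i.+1) l)^-1.
  elim: l => [_|l IH ltl].
    by split; apply: N_normalizes; rewrite ?invg1; exact: N_1.
  have [IH1 IH2] := IH (ltnW ltl); have [r1 r2] := normalizes_r ltl.
  by split; rewrite /= ?invgM; exact: normalizesM.
have [P1 P2] := Nprod m.-1 ltac:(by rewrite prednK).
have [c1 c2] := normalizes_cox.
(* [r 0] lies in [N] and the middle generators are settled, so [r m] is reached through [rho]. *)
have rmE : r m = rho * (rprod (fun i => r i.+1) m.-1)^-1.
  by rewrite affine_C_cox [rprod _ m]rprod_pred // mulgK prednK.
have rN k : k < n -> normalizes (r k) /\ normalizes (r k)^-1.
  rewrite ltnS leq_eqVlt => /predU1P[->|].
    rewrite rmE; split; first exact: normalizesM.
    by rewrite invgM invgK; exact: normalizesM.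
  case: k => [_|k ltk]; last exact: normalizes_r.
  by split; apply: N_normalizes => //; exact: N_V.
suff: normalizes g by exact.
elim/gen_ind: g => [|k g ltk IH|k g ltk IH].
- by apply: N_normalizes; exact: N_1.
- by apply: normalizesM => //; case: (rN k ltk).
- by apply: normalizesM => //; case: (rN k ltk).
Qed.

Local Notation R0 := (cox_quot_rel (coxeter_B0 m) m).
Local Notation S := (gen R0).

Definition affine_C_fill k : annular_quot m := if k is l.+1 then S (m - k) else 1.

Let p : G -> annular_quot m := gen_hom affine_C_fill.

Let SB : B_system m S. Proof. by apply: gen_B_system => ? ? ?; left. Qed.

Lemma affine_C_fill_rel u v : R u v ->
  eval_word (fun i : 'I_n => affine_C_fill i) u = eval_word (fun i : 'I_n => affine_C_fill i) v.
Proof.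
have [c3 b3 b4] := SB.
move: u v; apply: path_relP => //.
- by move=> k _; rewrite /edges_affine_C; case: ifP; [right | left].
- move=> i j lt_ij; rewrite !eval_positive_word !big_cons !big_nil !mulg1.
  have lt_j := ltn_ord j.
  case: (nat_of_ord i) (nat_of_ord j) lt_ij lt_j => [|i'] [|j'] // lt_ij lt_j.
    by rewrite /= mul1g mulg1.
  by apply/esym/c3; lia.
- move=> i j Eij; rewrite /edges_affine_C; case: ifP => // /negbT.
  rewrite negb_or => /andP[i0 im] _.
  rewrite !eval_positive_word !big_cons !big_nil !mulg1 !mulgA Eij.
  have lt_j := ltn_ord j; case: (nat_of_ord i) Eij i0 im => // i' Eij _ im /=.
  have -> : (m - i'.+1 = (m - i'.+2).+1)%N by lia.
  by apply/esym/b3; lia.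
- move=> i j Eij; rewrite /edges_affine_C; case: ifP => // + _.
  rewrite !eval_positive_word !big_cons !big_nil !mulg1 !mulgA Eij => /orP[/eqP -> |/eqP Ei].
    by rewrite /= !mul1g !mulg1.
  have lt_j := ltn_ord j; case: (nat_of_ord i) Eij Ei => [|i'] Eij Ei; first by lia.
  rewrite /=; have -> : (m - i'.+2 = 0)%N by lia.
  have -> : (m - i'.+1 = 1)%N by lia.
  exact/esym/b4.
Qed.

(* Forgetting the second puncture of the plane, modulo the rotations around the
   first one, which become central: the kernel is free. *)
Theorem dim_le_affine_C_fibre d :
  dim_le [set: annular_quot m] d -> dim_le [set: G] (d + 1).
Proof.
have m0 := ltnW m1.
have pM : {morph p : y y' / y * y'} by exact: (gen_homM affine_C_fill_rel).
have pE k : k < n -> p (r k) = affine_C_fill k by exact: (gen_homE affine_C_fill_rel).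
have p_lam k : k < m -> p (lam k) = S k.
  move=> ltk; rewrite /lam pE; last by lia.
  have -> : (m - k = (m - k).-1.+1)%N by lia.
  by rewrite /=; congr gen; lia.
have p_x k : k < m -> p (x k) = 1.
  elim: k => [_|k IH ltk]; first by rewrite orbit_elt0 pE.
  by rewrite orbit_eltE !pM IH ?(ltnW ltk) // mulg1 -pM mulVg (morph1g pM).
have p_z : p z = 1.
  rewrite /z /rho /cox_elt (morphXg pM) (morph_prodg pM) -[RHS](@cox_quot_power m (coxeter_B0 m) m).
  by congr (_ ^+ _); apply: eq_bigr => i _; exact: p_lam.
have pN y : N y -> p y = 1.
  move=> [w _ <-]; move: w; apply: (gen_morph_ext (g := fun=> 1)).
  - by move=> u v; rewrite psiM pM.
  - by move=> u v; rewrite mulg1.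
  move=> k; rewrite ltnS leq_eqVlt => /predU1P[->|ltk]; last by rewrite psi_orbit // p_x.
  rewrite psi_last pM !(morphVg pM) p_z.
  suff H0 l : l <= m -> p (rprod x l) = 1 by rewrite H0 // invg1 mulg1.
  elim: l => [_|l IH ltl]; first by rewrite (morph1g pM).
  by rewrite /= pM p_x // IH ?(ltnW ltl) // mulg1.
(* The Artin relations hold among the [lam] in [G]; the additional relator lifts to [z], which is
   why the range of [psi] must contain it. *)
have lamR u v : R0 u v ->
    N (eval_word (fun i : 'I_m => lam i) u * (eval_word (fun i : 'I_m => lam i) v)^-1).
  move=> [/(B_system_eval lamB) ->|[-> ->]]; first by rewrite mulgV; exact: N_1.
  rewrite eval_cox_power_word [eval_word _ [::]]big_nil invg1 mulg1.
  exact: N_z.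
have lift g : liftable m N lam g.
  have Lr k : k < n -> liftable m N lam (r k).
    case: k => [_|k ltk].
      exists [::]; rewrite /eval_word big_nil invg1 mulg1 -(orbit_elt0 r).
      exact: N_x.
    have lt_mk : m - k.+1 < m by lia.
    exists [:: (Ordinal lt_mk, false)].
    rewrite /eval_word big_seq1 /= /lam; have -> : (m - (m - k.+1) = k.+1)%N by lia.
    by rewrite mulgV; exact: N_1.
  elim/gen_ind: g => [|k g ltk Lg|k g ltk Lg].
  - by apply: liftable1; exact: N_1.
  - by apply: (liftableM N_M affine_C_normal) => //; exact: Lr.
  - apply: (liftableM N_M affine_C_normal) => //.
    by apply: (liftableV N_V affine_C_normal); exact: Lr.
move=> dimQ; have dimN : dim_le N 1 by apply: dim_le_free_range psiM Phi_psi_inner.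
exact: (dim_le_presented_quotient pM pN p_lam N_1 N_M N_V affine_C_normal lamR lift dimQ dimN).
Qed.

End AffineC.

(** * The upper bounds by induction *)

Lemma dim_le_trivial (G : groupType) : (forall x : G, x = 1) -> dim_le [set: G] 0.
Proof.
move=> G1 E _; exists (fun=> [set: 'I_1]%SET), [set 1]; split=> [|x _|i x y _].
- exact: finite_set1.
- by rewrite cardsT card_ord.
- by rewrite /= [_^-1 * _]G1.
Qed.

(** The two families feed each other: filling a puncture adds one, and marking a strand passes from
    annular to braid groups at equal dimension. The start is an infinite cyclic group modulo its
    generator. *)
Lemma dim_le_quotients m :
  dim_le [set: annular_quot m.+1] m /\ dim_le [set: braid_quot m.+1] m.
Proof.
suff H k : dim_le [set: annular_quot k.+1] k by split=> //; exact: dim_le_braid_quot.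
elim: k => [|k IH]; last first.
  by have := dim_le_annular_quot (ltn0Sn k) (dim_le_braid_quot IH); rewrite addn1.
apply: dim_le_trivial.
have g1 : gen (cox_quot_rel (coxeter_B0 1) 1) 0 = 1.
  by have := @cox_quot_power 1 (coxeter_B0 1) 1; rewrite big_ord1 expg1.
by apply: gen_ind => // -[|//] x _ ->; rewrite g1 ?invg1 mulg1.
Qed.

Section BInAffineC.
Variable n : nat.
Hypothesis n1 : 1 < n.
Local Notation RB := (artin_rel (coxeter_B n)).
Local Notation RC := (artin_rel (coxeter_affine_C n.+1)).
Local Notation b := (gen RB).
Local Notation c := (gen RC).

Lemma B_to_affine_C_rel u v : RB u v ->
  eval_word (fun i : 'I_n => c i.+1) u = eval_word (fun i : 'I_n => c i.+1) v.
Proof.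
have Ew (w : seq 'I_n) : eval_word (fun i : 'I_n => c i.+1) (positive_word w) =
  \prod_(i <- w) c i.+1 by exact: (eval_positive_word (fun i => c i.+1)).
move: u v; apply: path_relP => //.
- by move=> k _; rewrite /edges_B; case: ifP; [right | left].
- move=> i j lt_ij; rewrite !Ew !big_cons !big_nil !mulg1.
  by apply: (gen_path_commute (e2 := edges_affine_C_ge2 n.+1)) => //; rewrite ltnS ltn_ord.
- move=> i j Eij ei; rewrite !Ew !big_cons !big_nil !mulg1 !mulgA Eij.
  apply: (gen_path_braid3 (e2 := edges_affine_C_ge2 n.+1)) => //.
  by rewrite -Eij ltnS ltn_ord.
- move=> i j Eij ei; rewrite !Ew !big_cons !big_nil !mulg1 !mulgA Eij.
  apply: (gen_path_braid4 (e2 := edges_affine_C_ge2 n.+1)) => //.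
  by rewrite -Eij ltnS ltn_ord.
Qed.

(** The label of the first edge is even, so killing its end vertex respects the relations; this is
    the retraction onto type B. *)
Definition kill_first k : artin_group (coxeter_B n) := if k is l.+1 then b l else 1.

Lemma affine_C_to_B_rel u v : RC u v ->
  eval_word (fun i : 'I_n.+1 => kill_first i) u =
  eval_word (fun i : 'I_n.+1 => kill_first i) v.
Proof.
move: u v; apply: path_relP => //.
- by move=> k _; rewrite /edges_affine_C; case: ifP; [right | left].
- move=> i j lt_ij; rewrite !eval_positive_word !big_cons !big_nil !mulg1.
  have := ltn_ord j; case: (nat_of_ord i) (nat_of_ord j) lt_ij => [|i'] [|j'] // lt_ij lt_j /=.
    by rewrite mul1g mulg1.
  exact: (gen_path_commute (e2 := edges_B_ge2 n)).
- move=> i j Eij; rewrite /edges_affine_C; case: ifP => // /negbT.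
  rewrite negb_or => /andP[i0 im] _.
  rewrite !eval_positive_word !big_cons !big_nil !mulg1 !mulgA Eij.
  have lt_j := ltn_ord j; case: (nat_of_ord i) Eij i0 im => // i' Eij _ im /=.
  apply: (gen_path_braid3 (e2 := edges_B_ge2 n)) => //; first by lia.
  by rewrite /edges_B; case: ifP => //; lia.
- move=> i j Eij; rewrite /edges_affine_C; case: ifP => // + _.
  rewrite !eval_positive_word !big_cons !big_nil !mulg1 !mulgA Eij => /orP[/eqP -> |/eqP Ei].
    by rewrite /= !mul1g !mulg1.
  have lt_j := ltn_ord j; case: (nat_of_ord i) Eij Ei => [|i'] Eij Ei; first by lia.
  apply: (gen_path_braid4 (e2 := edges_B_ge2 n)) => //; first by lia.
  by rewrite /edges_B; case: ifP => //; lia.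
Qed.

Lemma dim_le_artin_B d : dim_le [set: artin_group (coxeter_affine_C n.+1)] d ->
  dim_le [set: artin_group (coxeter_B n)] d.
Proof.
pose f : artin_group (coxeter_B n) -> artin_group (coxeter_affine_C n.+1) :=
  gen_hom (fun k => c k.+1).
pose g : artin_group (coxeter_affine_C n.+1) -> artin_group (coxeter_B n) :=
  gen_hom kill_first.
have fM : {morph f : x y / x * y} by exact: (gen_homM B_to_affine_C_rel).
have gM : {morph g : x y / x * y} by exact: (gen_homM affine_C_to_B_rel).
apply: (dim_le_inj fM); apply: (can_inj (g := g)).
apply: (gen_morph_ext (f := g \o f) (g := id)) => //.
  by move=> x y; rewrite /= fM gM.
move=> k ltk; rewrite /= /f (gen_homE B_to_affine_C_rel) //.
by rewrite /g (gen_homE affine_C_to_B_rel).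
Qed.

End BInAffineC.

Lemma dim_le_artin_affine_C n : 2 < n ->
  dim_le [set: artin_group (coxeter_affine_C n)] n.-1.
Proof.
case: n => [|[|[|n]]] // _; have [dimG _] := dim_le_quotients n.+1.
by have := dim_le_affine_C_fibre (isT : 1 < n.+2) dimG; rewrite addn1.
Qed.

Lemma dim_le_artin_affine_A n : 2 < n ->
  dim_le [set: artin_group (coxeter_affine_A n)] n.-1.
Proof.
move=> n2; apply: dim_le_affine_A => //.
by case: n n2 => // n _; case: (dim_le_quotients n).
Qed.

(** * Lower bounds *)

From mathcomp Require Import all_algebra all_fingroup.

(* Kuhn's cubical Sperner lemma. Modulo 2, the number of simplices of the
   triangulated cube that carry all the labels is computed by determinants;
   expanding them, facets in the interior cancel, and those of the boundary
   contribute only on one face, where they give the same sum in dimension one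
   less. *)
Section Sperner.
Import GRing.Theory.
Local Open Scope ring_scope.
Variable M : nat.

Lemma addFF (x : 'F_2) : x + x = 0.
Proof. by rewrite addrr_pchar2 // pchar_Fp. Qed.

Lemma oppF (x : 'F_2) : - x = x.
Proof. by rewrite oppr_pchar2 // pchar_Fp. Qed.

Lemma signF k : (-1) ^+ k = 1 :> 'F_2.
Proof. by rewrite oppF expr1n. Qed.

(* The [i]-th vertex of the simplex of the Kuhn triangulation starting at [p]
   and adding the basis vectors in the order given by [s]. *)
Definition vertex N (p : 'I_N -> nat) (s : 'S_N) (i : nat) : 'I_N -> nat :=
  fun c => (p c + ((s^-1)%g c < i))%N.

(** Equal labels give equal rows, and rows with the labels [0, ..., m - 1] form a permuted
    unitriangular matrix, so the determinant detects a full set of labels. Thresholds instead of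
    equalities make the last column constant when all labels are below [m], and let boundary
    conditions appear as equal columns. *)
Definition label_mx N m (l : ('I_N -> nat) -> nat) (q : nat -> 'I_N -> nat) : 'M['F_2]_m :=
  \matrix_(i < m, j < m) (l (q i) <= j)%N%:R.

Definition box_point N (v : {ffun 'I_N -> 'I_M}) : 'I_N -> nat := fun c => v c.

Definition sperner_sum N l : 'F_2 :=
  \sum_(v : {ffun 'I_N -> 'I_M}) \sum_(s : 'S_N)
    \det (label_mx N.+1 l (vertex (box_point v) s)).

Definition sperner_label N (l : ('I_N -> nat) -> nat) :=
  [/\ forall p, (l p <= N)%N, forall p (j : 'I_N), p j = M -> l p != j &
      forall p (j : 'I_N), p j = 0%N -> (l p <= j)%N].

Lemma sum_perm_even N (t : 'S_N) (g : 'S_N -> 'F_2) : odd_perm t ->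
  (forall s, g (t * s)%g = g s) -> \sum_s g s = 0.
Proof.
move=> odd_t gt; rewrite (bigID (@odd_perm _)) /=.
rewrite (reindex_inj (mulgI t)) /=.
rewrite (eq_bigl (fun s : 'S_N => ~~ odd_perm s)); last first.
  by move=> s; rewrite odd_permM odd_t addTb.
by rewrite (eq_bigr g) ?addFF // => s _; exact: gt.
Qed.

Lemma det_row_eq m (A : 'M['F_2]_m) i1 i2 : i1 != i2 ->
  (forall j, A i1 j = A i2 j) -> \det A = 0.
Proof. by move=> ne E; apply: (determinant_alternate ne). Qed.

Lemma det_col_eq m (A : 'M['F_2]_m) j1 j2 : j1 != j2 ->
  (forall i, A i j1 = A i j2) -> \det A = 0.
Proof. by move=> ne E; rewrite -det_tr; apply: (det_row_eq ne) => i; rewrite !mxE. Qed.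

Definition facet_mx N (l : ('I_N -> nat) -> nat) (p : 'I_N -> nat) s (i : 'I_N.+1) :=
  label_mx N l (fun k => vertex p s (bump i k)).

(** Labels are at most [N], so the last column is constantly 1 and the expansion along it runs over
    the facets. *)
Lemma det_facets N l p (s : 'S_N) : (forall q, (l q <= N)%N) ->
  \det (label_mx N.+1 l (vertex p s)) = \sum_i \det (facet_mx l p s i).
Proof.
move=> lN; rewrite (expand_det_col _ ord_max); apply: eq_bigr => i _.
rewrite !mxE lN mul1r /cofactor signF mul1r; congr (\det _).
by apply/matrixP=> j k; rewrite !mxE /= /bump [(N <= k)%N]leqNgt ltn_ord add0n.
Qed.

(** Without its [i]-th vertex a simplex does not see the order of the directions [i - 1] and [i];
    exchanging them pairs off the permutations. *)
Lemma inner_facets N l p (i : 'I_N.+1) : (0 < i < N)%N ->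
  \sum_(s : 'S_N) \det (facet_mx l p s i) = 0.
Proof.
move=> /andP[i0 ltiN].
have lt1 : (i.-1 < N)%N by lia.
pose t := tperm (Ordinal lt1) (Ordinal ltiN).
apply: (@sum_perm_even _ t).
  by rewrite odd_tperm -val_eqE /=; lia.
move=> s; congr (\det _); apply/matrixP=> k j; rewrite !mxE; congr ((l _ <= j)%N%:R).
apply/funext=> c; rewrite /vertex; congr (_ + _)%N.
rewrite invMg permM /t tpermV; set d := (s^-1)%g c.
congr nat_of_bool; rewrite /bump; case: tpermP => [->|->|//] /=; lia.
Qed.

Definition shift_point N (p : 'I_N -> nat) (j : 'I_N) : 'I_N -> nat :=
  fun c => (p c + (c == j))%N.

Definition rot_perm N : 'S_N := perm (can_inj (@ordSK N)).

(** Dropping the first vertex leaves a facet of the simplex that starts at the second vertex and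
    adds the direction [s ord0] last. *)
Lemma first_facet N l p (s : 'S_N.+1) :
  facet_mx l p s ord0 = facet_mx l (shift_point p (s ord0)) (rot_perm N.+1 * s)%g ord_max.
Proof.
apply/matrixP=> k j; rewrite !mxE; congr ((l _ <= j)%N%:R); apply/funext=> c.
rewrite /vertex /shift_point -addnA; congr (_ + _)%N.
rewrite /bump /= [(N.+1 <= k)%N]leqNgt ltn_ord /= add0n add1n invMg permM.
set d := (s^-1)%g c.
have -> : (c == s ord0) = (d == ord0).
  by rewrite /d -(inj_eq (@perm_inj _ s)) permKV.
have -> : ((rot_perm N.+1)^-1)%g d = ord_pred d.
  by apply: (@perm_inj _ (rot_perm N.+1)); rewrite permKV permE ord_predK.
have ltk := ltn_ord k; have ltd := ltn_ord d.
rewrite -val_eqE /=.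
case: (posnP d) => [->|d0] /=.
  by rewrite ?add0n modn_small //; lia.
have -> : ((d + N.+1).-1 = d.-1 + N.+1)%N by lia.
rewrite modnDr modn_small; last by lia.
by rewrite ?add0n; congr nat_of_bool; lia.
Qed.

Definition set_coord N (p : 'I_N -> nat) (j : 'I_N) a : 'I_N -> nat :=
  fun c => if c == j then a else p c.

Lemma telescope_F2 m (f : nat -> 'F_2) : \sum_(t < m) (f t.+1 + f t) = f m + f 0%N.
Proof.
elim: m => [|m IH]; first by rewrite big_ord0 addFF.
by rewrite big_ord_recr IH /= addrC addrA -(addrA (f m.+1)) addFF addr0.
Qed.

Hypothesis M0 : (0 < M)%N.
Let o : 'I_M := Ordinal M0.

Lemma box_telescope N (g : ('I_N -> nat) -> 'F_2) (j : 'I_N) :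
  \sum_(v : {ffun 'I_N -> 'I_M}) (g (shift_point (box_point v) j) + g (box_point v)) =
  \sum_(v : {ffun 'I_N -> 'I_M} | v j == o)
    (g (set_coord (box_point v) j M) + g (box_point v)).
Proof.
pose upd (v : {ffun 'I_N -> 'I_M}) t := [ffun c => if c == j then t else v c].
rewrite (partition_big (fun v => upd v o) (fun v => v j == o)) /=; last first.
  by move=> v _; rewrite ffunE eqxx.
apply: eq_bigr => w /eqP wj.
rewrite (reindex_onto (upd w) (fun v => v j)) /=; last first.
  by move=> v /eqP <-; apply/ffunP=> c; rewrite !ffunE; case: eqP => [->|].
rewrite (eq_bigl xpredT) /=; last first.
  move=> t; rewrite ffunE !eqxx andbT; apply/eqP/ffunP=> c.
  by rewrite !ffunE; case: eqP => // ->.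
pose f t := g (set_coord (box_point w) j t).
rewrite (eq_bigr (fun t : 'I_M => f t.+1 + f t)); last first.
  move=> t _; congr (g _ + g _); apply/funext=> c.
    rewrite /shift_point /set_coord /box_point ffunE; case: eqP => _; last by rewrite addn0.
    by rewrite addn1.
  by rewrite /set_coord /box_point ffunE; case: eqP.
rewrite telescope_F2; congr (_ + g _); apply/funext=> c.
by rewrite /set_coord /box_point; case: eqP => // ->; rewrite wj.
Qed.

(** The facet lies in the face where the coordinate [j = s ord_max] is [M]. The label [j] is absent
    there, so the columns [j - 1] and [j] coincide, or column 0 vanishes when [j = 0]. *)
Lemma facet_far N (l : ('I_N.+1 -> nat) -> nat) p (s : 'S_N.+1) : sperner_label l ->
  p (s ord_max) = M -> \det (facet_mx l p s ord_max) = 0.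
Proof.
move=> [lN lM _] pM; set j := s ord_max.
have vM (k : 'I_N.+1) : vertex p s (bump (@ord_max N.+1) k) j = M.
  rewrite /vertex pM /j permK /bump /= [(N.+1 <= k)%N]leqNgt ltn_ord /=.
  by have := ltn_ord k; lia.
have lj (k : 'I_N.+1) : l (vertex p s (bump (@ord_max N.+1) k)) != j by apply: lM; exact: vM.
case: (posnP j) => [j0|j0].
  rewrite (expand_det_col _ j) big1 // => k _; rewrite mxE.
  by have := lj k; rewrite j0 leqn0 => /negPf->; rewrite mul0r.
have ltj : (j.-1 < N.+1)%N by have := ltn_ord j; lia.
apply: (@det_col_eq _ _ j (Ordinal ltj)).
  by rewrite -val_eqE /=; lia.
move=> k; rewrite !mxE /=; congr (nat_of_bool _)%:R.
by have := lj k; rewrite /=; lia.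
Qed.

(** On the face where the coordinate [j] is 0 the labels are at most [j], so the columns [j] and
    [ord_max] are both constantly 1. *)
Lemma facet_near N (l : ('I_N.+1 -> nat) -> nat) p (s : 'S_N.+1) : sperner_label l ->
  p (s ord_max) = 0%N -> s ord_max != ord_max -> \det (facet_mx l p s ord_max) = 0.
Proof.
move=> [lN _ l0] p0 jN; set j := s ord_max in jN *.
have v0 (k : 'I_N.+1) : vertex p s (bump (@ord_max N.+1) k) j = 0%N.
  rewrite /vertex p0 /j permK /bump /= [(N.+1 <= k)%N]leqNgt ltn_ord /=.
  by have := ltn_ord k; lia.
have lj (k : 'I_N.+1) : (l (vertex p s (bump (@ord_max N.+1) k)) <= j)%N by apply: l0; exact: v0.
apply: (det_col_eq jN) => k; rewrite !mxE lj /=.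
by rewrite (leq_trans (lj k)) // -ltnS.
Qed.

Definition ext_point N (p : 'I_N -> nat) : 'I_N.+1 -> nat :=
  fun c => if unlift ord_max c is Some c' then p c' else 0%N.

Lemma sperner_label_face N (l : ('I_N.+1 -> nat) -> nat) : sperner_label l -> sperner_label (l \o @ext_point N).
Proof.
move=> [lN lM l0]; split=> [p|p j pj|p j pj].
- by apply: (l0 _ ord_max); rewrite /ext_point unlift_none.
- have := lM (ext_point p) (lift ord_max j); rewrite /ext_point liftK => /(_ pj).
  by rewrite lift_max.
- have := l0 (ext_point p) (lift ord_max j); rewrite /ext_point liftK => /(_ pj).
  by rewrite lift_max.
Qed.

Lemma lift_perm_max_surj N (s : 'S_N.+1) : s ord_max = ord_max ->
  exists s', lift_perm ord_max ord_max s' = s.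
Proof.
move=> smax; pose g k := odflt k (unlift ord_max (s (lift ord_max k))).
have gE k : lift ord_max (g k) = s (lift ord_max k).
  rewrite /g; case: unliftP => [j -> //|Es].
  by have := neq_lift ord_max k; rewrite -(inj_eq (@perm_inj _ s)) smax Es eqxx.
have g_inj : injective g.
  by move=> j k /(congr1 (lift ord_max)); rewrite !gE => /perm_inj/lift_inj.
exists (perm g_inj); apply/permP=> k; case: (unliftP ord_max k) => [j ->|->].
  by rewrite lift_perm_lift permE gE.
by rewrite lift_perm_id smax.
Qed.

Lemma lift_perm_max_inj N : injective (@lift_perm N ord_max ord_max).
Proof.
move=> s s' E; apply/permP=> k; apply: (@lift_inj _ ord_max).
by rewrite -!(lift_perm_lift ord_max) E.
Qed.

(** Inner facets cancel, and the first and last ones telescope to the boundary of the cube. Only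
    those in the face where the last coordinate is 0 survive, and they triangulate the cube of one
    dimension less. *)
Lemma sperner_sumS N (l : ('I_N.+1 -> nat) -> nat) : sperner_label l ->
  sperner_sum l = sperner_sum (l \o @ext_point N).
Proof.
move=> lS; have [lN lM l0] := lS.
rewrite /sperner_sum.
pose d0 (p : 'I_N.+1 -> nat) (s : 'S_N.+1) := \det (facet_mx l p s ord_max).
have -> : \sum_v \sum_(s : 'S_N.+1) \det (label_mx N.+2 l (vertex (box_point v) s)) =
    \sum_v \sum_(s : 'S_N.+1) (d0 (shift_point (box_point v) (s ord_max)) s + d0 (box_point v) s).
  apply: eq_bigr => v _.
  under eq_bigr do rewrite det_facets //.
  rewrite exchange_big /= big_ord_recl big_ord_recr /= [X in _ + (X + _)]big1 ?add0r; last first.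
    by move=> i _; apply: inner_facets => /=; have := ltn_ord i; rewrite /bump /=; lia.
  rewrite big_split /=; congr (_ + _).
  rewrite [RHS](reindex_inj (mulgI (rot_perm N.+1))) /=.
  apply: eq_bigr => s _; rewrite first_facet /d0 permM permE.
  congr (\det (facet_mx l (shift_point _ (s _)) _ _)).
  by apply: val_inj; rewrite /= modnn.
rewrite exchange_big /=.
under eq_bigr do rewrite (box_telescope (d0^~ _)).
rewrite (bigID (fun s : 'S_N.+1 => s ord_max == ord_max)) /= [X in _ + X]big1 ?addr0; last first.
  move=> s /eqP sN; apply: big1 => v /eqP v0.
  rewrite /d0 facet_far ?add0r //; last by rewrite /set_coord eqxx.
  by apply: facet_near => //; [rewrite /box_point v0 | exact/eqP].
rewrite (eq_bigl (mem (lift_perm ord_max ord_max @: [set: 'S_N]%SET))); last first.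
  move=> s; apply/eqP/imsetP => [/lift_perm_max_surj[s' <-]|[s' _ ->]]; first by exists s'.
  by rewrite lift_perm_id.
rewrite big_imset /=; last by move=> s s' _ _; exact: lift_perm_max_inj.
rewrite [RHS]exchange_big; apply: eq_big => [s|s _]; first by rewrite inE.
pose ext (v : {ffun 'I_N -> 'I_M}) : {ffun 'I_N.+1 -> 'I_M} :=
  [ffun c => if unlift ord_max c is Some c' then v c' else o].
rewrite (reindex_onto ext (fun v => [ffun c => v (lift ord_max c)])) /=; last first.
  move=> v /eqP v0; apply/ffunP=> c; rewrite !ffunE; case: unliftP => [c' ->|->].
    by rewrite ffunE.
  by move: v0; rewrite lift_perm_id => ->.
apply: eq_big => [v|v _].
  rewrite lift_perm_id ffunE unlift_none eqxx /=.
  by apply/eqP/ffunP=> c; rewrite !ffunE liftK.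
rewrite /d0 lift_perm_id facet_far ?add0r //; last by rewrite lift_perm_id /set_coord eqxx.
congr (\det _); apply/matrixP=> k j; rewrite !mxE; congr ((l _ <= j)%N%:R).
apply/funext=> c; rewrite /vertex /box_point /ext_point ffunE /= /bump.
rewrite [(N.+1 <= k)%N]leqNgt ltn_ord /= add0n.
case: (unliftP ord_max c) => [c' ->|->].
  rewrite -[X in _ = (_ + (X < _))%N](lift_max); congr (_ + _)%N; congr nat_of_bool.
  congr (nat_of_ord _ < _)%N; apply: (@perm_inj _ (lift_perm ord_max ord_max s)).
  by rewrite permKV lift_perm_lift permKV.
have -> : ((lift_perm ord_max ord_max s)^-1)%g ord_max = ord_max.
  by apply: (@perm_inj _ (lift_perm ord_max ord_max s)); rewrite permKV lift_perm_id.
by rewrite /= ltnNge -ltnS ltn_ord.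
Qed.

Lemma sperner_sum1 N (l : ('I_N -> nat) -> nat) : sperner_label l -> sperner_sum l = 1.
Proof.
elim: N l => [|N IH] l lS; last by rewrite sperner_sumS // IH //; exact: sperner_label_face.
have [lN _ _] := lS; rewrite /sperner_sum.
have one_ffun (v : {ffun 'I_0 -> 'I_M}) : v = [ffun=> o] by apply/ffunP=> -[].
have one_perm (s : 'S_0) : s = 1%g by apply/permP=> -[].
have inner (v : {ffun 'I_0 -> 'I_M}) :
    \sum_(s : 'S_0) \det (label_mx 1 l (vertex (box_point v) s)) = 1.
  rewrite (bigD1 1%g) //= big1 ?addr0; last by move=> s; rewrite (one_perm s) eqxx.
  by rewrite det_mx11 mxE lN.
under eq_bigr do rewrite inner.
by rewrite (bigD1 [ffun=> o]) //= big1 ?addr0 // => v; rewrite (one_ffun v) eqxx.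
Qed.

Theorem cubical_sperner N (l : ('I_N -> nat) -> nat) : sperner_label l ->
  exists (p : 'I_N -> nat) (s : 'S_N), forall i j : 'I_N.+1,
    l (vertex p s i) = l (vertex p s j) -> i = j.
Proof.
move=> lS; apply: contrapT => no_simplex.
have := oner_neq0 'F_2; rewrite -(sperner_sum1 lS) /sperner_sum => /eqP; apply.
apply: big1 => v _; apply: big1 => s _; apply: contrapT => det_n0; apply: no_simplex.
exists (box_point v), s => i j Eij; apply: contrapT => /eqP ij; apply: det_n0.
by apply: (det_row_eq ij) => k; rewrite !mxE Eij.
Qed.

End Sperner.

(** * From Sperner's lemma to asymptotic dimension *)

Section Grid.
Variables (G : groupType) (T : generating_set G) (N : nat).
Variable f : ('I_N -> nat) -> G.

(** Labels depend only on the piece of the cover, so the [N.+1] vertices of a simplex with all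
    labels lie in as many pieces, and all of these meet the ball around [f p]. *)
Lemma grid_asdim k (E : set G) : finite_set E ->
  (forall p s i, E ((f p)^-1 * f (vertex p s i))) ->
  (forall B, finite_set B -> exists M, forall p q j,
     B ((f p)^-1 * f q) -> p j = 0%N -> q j < M) ->
  metric_asdim_le (word_metric T) k -> N <= k.
Proof.
move=> finE fE fB dimG; have [r leE] := word_length_bounded T finE.
have [I [U [cov [D bndU] mult]]] := dimG r.
have [M ltM] := fB _ (finite_word_ball T D).
pose idx p := projT1 (cid (cov (f p))).
have idxP p : U (idx p) (f p) by rewrite /idx; case: cid.
pose touches p j := `[< exists q (i : 'I_N), [/\ i = j :> nat, q i = 0%N & idx q = idx p] >].
(* [find] returns [N] if the piece touches none of the faces, which supplies the last label. *)
pose l p := find (touches p) (iota 0 N).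
have l_idx p q : idx p = idx q -> l p = l q.
  by rewrite /l /touches => ->.
(* [l p] is the first [j] such that the piece of [f p] meets the face [p j = 0];
   by the bound on diameters it cannot meet the opposite face as well. *)
have lS : sperner_label M.+1 l.
  split=> [p|p j pj|p j pj].
  - by rewrite -[leqRHS](size_iota 0) find_size.
  - apply/eqP=> Elj; have : has (touches p) (iota 0 N).
      by rewrite has_find size_iota -/(l p) Elj.
    move/(nth_find 0%N); rewrite -/(l p) nth_iota ?Elj // add0n.
    move/asboolP=> [q [i [/val_inj -> qj Eidx]]].
    have := ltM q p j _ qj; rewrite pj => ltMM.
    suff : M.+1 < M by rewrite ltnNge leqnSn.
    apply: ltMM; apply: (bndU (idx p)) (idxP p).
    by rewrite -Eidx.
  - rewrite leqNgt; apply/negP=> /(before_find 0%N); rewrite nth_iota // add0n.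
    by move/asboolP; apply; exists p, j.
have [p [s full]] := cubical_sperner (ltn0Sn M) lS.
pose g (i : nat) := idx (vertex p s i).
have /pcard_leP/injfunPex[h hk h_inj] := mult (f p).
have gA (i : 'I_N.+1) : [set a | exists2 y, U a y & word_metric T (f p) y <= r] (g i).
  by exists (f (vertex p s i)); [exact: idxP | exact/leE/fE].
have hg_lt (i : 'I_N.+1) : h (g i) < k.+1 by exact: hk (gA i).
have : injective (fun i => Ordinal (hg_lt i)).
  move=> i j /(congr1 val) /= Eh; apply: full; apply: l_idx.
  by apply: h_inj Eh; apply/mem_set; exact: gA.
by move/leq_card; rewrite !card_ord ltnS.
Qed.

End Grid.

Section FreeAbelian.
Variables (G : groupType) (N : nat) (L : nat -> G).
Hypothesis LC : forall i j, i < N -> j < N -> commute (L i) (L j).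
Variables (S : Type) (c : nat) (act : G -> S * int -> S * int) (st : nat -> S).
Hypotheses (c0 : 0 < c) (actM : forall x y t, act (x * y) t = act x (act y t)).
Hypothesis act1 : forall t, act 1 t = t.
Hypothesis actL : forall i j t, i < N -> j < N ->
  act (L i) (st j, t) = (st j, t + Posz (c * (i == j)))%R.

(** Natural exponents suffice: the grid lies in the positive orthant, and inverses occur only in
    differences. *)
Definition monomial (p : 'I_N -> nat) := \prod_(i < N) L i ^+ p i.

Lemma monomialD p q : monomial (fun i => p i + q i) = monomial p * monomial q.
Proof.
rewrite /monomial -prodgM_commute.
  by apply: eq_bigr => i _; rewrite expgnDr.
by move=> i j *; apply: commuteX2; exact: LC.
Qed.

Lemma act_LX i j t k : i < N -> j < N ->
  act (L i ^+ k) (st j, t) = (st j, t + Posz (c * (i == j) * k))%R.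
Proof.
move=> lti ltj; elim: k t => [|k IH] t; first by rewrite act1 muln0 GRing.addr0.
by rewrite expgS actM IH actL // -GRing.addrA -PoszD mulnSr.
Qed.

Lemma act_monomial p (j : 'I_N) t :
  act (monomial p) (st j, t) = (st j, t + Posz (c * p j))%R.
Proof.
rewrite /monomial.
have H (r : seq 'I_N) : act (\prod_(i <- r) L i ^+ p i) (st j, t) =
    (st j, t + Posz (\sum_(i <- r) c * (i == j) * p i))%R.
  elim: r => [|i r IH]; first by rewrite !big_nil act1 GRing.addr0.
  by rewrite !big_cons actM IH act_LX // -GRing.addrA -PoszD addnC.
rewrite H; congr (_, _ + Posz _)%R.
rewrite (bigD1 j) //= eqxx muln1 big1 ?addn0 // => i /negPf->.
by rewrite muln0.
Qed.

Lemma monomial_inv_act p q (j : 'I_N) :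
  (act ((monomial p)^-1 * monomial q) (st j, 0%R)).2 = (Posz (c * q j) - Posz (c * p j))%R.
Proof.
have E : act (monomial p) (st j, Posz (c * q j) - Posz (c * p j))%R = (st j, Posz (c * q j)).
  by rewrite act_monomial GRing.subrK.
by rewrite actM act_monomial GRing.add0r -E -actM mulVg act1.
Qed.

(** The counters started at the [st j] depend only on the group element, so a finite set of
    differences bounds them and hence the exponents: this is the properness asked by [grid_asdim].
    The unit [c] is 1 for winding numbers and 2 for linked strands, which cross twice in a loop. *)
Theorem free_abelian_asdim (T : generating_set G) k :
  metric_asdim_le (word_metric T) k -> N <= k.
Proof.
pose E := [set monomial (fun i => e i : nat) | e in [set: {ffun 'I_N -> bool}]].
apply: (@grid_asdim _ T N monomial k E).
- by apply: finite_image; exact: finite_finset.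
- move=> p s i; exists [ffun j => (s^-1)%g j < i] => //.
  apply: (@mulgI _ (monomial p)); rewrite mulVKg -monomialD.
  by congr monomial; apply/funext=> j; rewrite /vertex ffunE.
move=> B /finite_seqP[r ->].
pose w (g : G) := (\max_(j < N) `|(act g (st j, 0%R)).2|%N)%N.
exists (\max_(g <- r) w g)%N.+1 => p q j /= rB pj; rewrite ltnS.
have le1 : w ((monomial p)^-1 * monomial q) <= \max_(g <- r) w g by exact: leq_bigmax_seq.
apply: leq_trans le1; apply: leq_trans (leq_bigmax j); rewrite monomial_inv_act pj muln0.
by rewrite GRing.subr0 /= leq_pmull.
Qed.

End FreeAbelian.

Section JucysMurphy.
Variables (H : groupType) (n : nat) (s : nat -> H).
Hypothesis sB : B_system n s.

(** Geometrically, the point [k] goes once around the puncture and all the points before it. *)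
Fixpoint jm_rec k := if k is l.+1 then s k * jm_rec l * s k else s 0.
(* Jucys-Murphy elements, locked lest rewriting with [mulgA] unfold them. *)
Definition jm := locked jm_rec.

Lemma jm0 : jm 0 = s 0. Proof. by rewrite /jm -lock. Qed.
Lemma jmS k : jm k.+1 = s k.+1 * jm k * s k.+1. Proof. by rewrite /jm -lock. Qed.

Let c3 i j : i.+1 < j -> j < n -> commute (s i) (s j). Proof. by case: sB => + _ _; apply. Qed.
Let b3 i : 0 < i -> i.+1 < n -> braid3 (s i) (s i.+1). Proof. by case: sB => _ + _; apply. Qed.

Lemma jm_commute_above i k : k.+1 < i -> i < n -> commute (s i) (jm k).
Proof.
elim: k => [|k IH] lt_ki lti; first by rewrite jm0; apply/commute_sym/c3.
have c := commute_sym (c3 lt_ki lti).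
rewrite jmS; apply: commuteM => //; apply: commuteM => //.
by apply: IH => //; exact: ltnW.
Qed.

(** A loop around the first points does not see their crossings. The critical case is [i = k - 1],
    settled by the relation of length 4 for [k = 1] and by the braid relation otherwise. *)
Lemma jm_commute_below i k : i < k -> k < n -> commute (s i) (jm k).
Proof.
elim: k => // k IH; rewrite ltnS leq_eqVlt => /predU1P[->|ltik] ltk; last first.
  have c : commute (s i) (s k.+1) by exact: c3.
  by rewrite jmS; apply: commuteM => //; apply: commuteM => //; apply: IH => //; exact: ltnW.
case: k ltk {IH} => [|k] ltk.
  rewrite jmS jm0 /commute; have [_ _ /(_ ltk)] := sB.
  by rewrite /braid4 !mulgA.
have br : braid3 (s k.+1) (s k.+2) by exact: b3.
have c : commute (s k.+2) (jm k) by exact: jm_commute_above.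
rewrite /braid3 in br; rewrite /commute !jmS !mulgA br.
rewrite (commuteAC _ c) -!mulgA; congr (_ * (_ * (_ * _))).
by rewrite !mulgA br.
Qed.

Lemma jm_commute i j : i < n -> j < n -> commute (jm i) (jm j).
Proof.
wlog lt_ij : i j / i < j => [th|] lti ltj.
  case: (ltngtP i j) => [ltij|ltji|->]; last exact: commute_refl.
    exact: th.
  by apply/commute_sym/th.
apply: commute_sym; elim: i lt_ij {lti} => [|i IH] lt_ij.
  by rewrite jm0; apply/commute_sym/jm_commute_below.
have c : commute (jm j) (s i.+1) by apply/commute_sym/jm_commute_below.
by rewrite jmS; apply: commuteM => //; apply: commuteM => //; apply: IH; exact: ltnW.
Qed.

End JucysMurphy.

(** * Linking and winding numbers *)

Section LinkingNumbers.
Variable X : finType.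
Implicit Types (x y z w : X) (t : X * X * int).

(* Exchange the strands at [x] and [y], and count the crossings of two marked
   strands. *)
Definition cross x y t : X * X * int :=
  (tperm x y t.1.1, tperm x y t.1.2,
   t.2 + (t.1 \in [:: (x, y); (y, x)])%:Z)%R.

Definition uncross x y t : X * X * int :=
  (tperm x y t.1.1, tperm x y t.1.2,
   t.2 - (t.1 \in [:: (x, y); (y, x)])%:Z)%R.

Lemma cross_ind x y a b :
  ((tperm x y a, tperm x y b) \in [:: (x, y); (y, x)]) = ((a, b) \in [:: (x, y); (y, x)]).
Proof.
have E u v : (tperm x y u == v) = (u == tperm x y v).
  by rewrite -(inj_eq (@perm_inj _ (tperm x y))) tpermK.
by rewrite !inE !xpair_eqE !E tpermL tpermR orbC.
Qed.

Lemma crossK x y : cancel (cross x y) (uncross x y).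
Proof.
by move=> [[a b] t]; rewrite /cross /uncross /= cross_ind !tpermK GRing.addrK.
Qed.

Lemma uncrossK x y : cancel (uncross x y) (cross x y).
Proof.
by move=> [[a b] t]; rewrite /cross /uncross /= cross_ind !tpermK GRing.subrK.
Qed.

Lemma cross_comm x y z w t : x != z -> x != w -> y != z -> y != w ->
  cross x y (cross z w t) = cross z w (cross x y t).
Proof.
move=> xz xw yz yw; case: t => [[a b] t].
have [zx wx zy wy] : [/\ z != x, w != x, z != y & w != y].
  by rewrite !(eq_sym z) !(eq_sym w).
have tC u : tperm x y (tperm z w u) = tperm z w (tperm x y u).
  case: (tpermP z w u) => [->|->|/eqP uz /eqP uw].
  - by rewrite (tpermD xw yw) (tpermD xz yz) tpermL.
  - by rewrite (tpermD xz yz) (tpermD xw yw) tpermR.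
  - by case: (tpermP x y u) => [_|_|_ _]; rewrite tpermD // eq_sym.
have iC x' y' z' w' : z' != x' -> w' != x' -> z' != y' -> w' != y' ->
    ((tperm z' w' a, tperm z' w' b) \in [:: (x', y'); (y', x')]) = ((a, b) \in [:: (x', y'); (y', x')]).
  move=> ne1 ne2 ne3 ne4.
  have E u v : (tperm z' w' u == v) = (u == tperm z' w' v).
    by rewrite -(inj_eq (@perm_inj _ (tperm z' w'))) tpermK.
  by rewrite !inE !xpair_eqE !E !tpermD.
rewrite /cross /= !tC iC // iC //.
by rewrite -!GRing.addrA [X in (_ + X)%R]GRing.addrC.
Qed.

Lemma cross_braid x y z t : x != y -> y != z -> x != z ->
  cross x y (cross y z (cross x y t)) = cross y z (cross x y (cross y z t)).
Proof.
move=> xy yz xz; case: t => [[a b] t].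
have [yx zy zx] : [/\ y != x, z != y & z != x] by rewrite !(eq_sym z) (eq_sym y).
have tB u : tperm x y (tperm y z (tperm x y u)) = tperm y z (tperm x y (tperm y z u)).
  case: (eqVneq u x) => [->|ux].
    by rewrite tpermL tpermL (tpermD xz yz) (tpermD yx zx) tpermL tpermL.
  case: (eqVneq u y) => [->|uy].
    by rewrite tpermR (tpermD yx zx) !tpermL (tpermD xz yz) tpermR.
  case: (eqVneq u z) => [->|uz].
    by rewrite (tpermD xz yz) !tpermR (tpermD yx zx).
  by rewrite !tpermD // eq_sym.
rewrite /cross /= !tB; congr (_, _, _); rewrite -!GRing.addrA; congr (_ + _)%R.
have E x' y' u v : (tperm x' y' u == v) = (u == tperm x' y' v).
  by rewrite -(inj_eq (@perm_inj _ (tperm x' y'))) tpermK.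
rewrite !inE !xpair_eqE !E !(tpermL, tpermR, tpermD yx zx, tpermD xz yz).
move: (a == x) (a == y) (a == z) (b == x) (b == y) (b == z).
by do 6!case.
Qed.

End LinkingNumbers.

Section Winding.
Implicit Types (t : nat * int) (k p : nat).

(* Track one marked strand, whose position is below [n.-1]; the first generator
   winds the strand at position 0 around the puncture. *)
Definition wind_strand (s : int) n k t : nat * int :=
  if k == 0%N then (t.1, t.2 + if t.1 == 0%N then s else 0)%R
  else if k.+1 == n then t
  else (if t.1 == k.-1 then k else if t.1 == k then k.-1 else t.1, t.2).

Lemma windK s n k : cancel (wind_strand s n k) (wind_strand (- s)%R n k).
Proof.
move=> [p t]; rewrite /wind_strand; case: eqP => [_|k0] /=;
  first by case: ifP; rewrite GRing.addrK ?GRing.oppr0 ?GRing.addr0.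
case: eqP => // _ /=; congr pair.
by do ![case: eqP => //]; lia.
Qed.

End Winding.

Section WindingRelations.
Variables (s : int) (n : nat).
Local Notation wind := (wind_strand s n).

Lemma wind0 p t : wind 0 (p, t) = (p, t + if p == 0%N then s else 0)%R.
Proof. by []. Qed.

Lemma wind_last t : 1 < n -> wind n.-1 t = t.
Proof. by rewrite /wind_strand => n1; rewrite prednK ?eqxx ?(ltnW n1) //; case: ifP => //; lia. Qed.

Definition swap k p := if p == k then k.+1 else if p == k.+1 then k else p.

Lemma windS k p t : k.+2 < n -> wind k.+1 (p, t) = (swap k p, t).
Proof. by move=> ltk; rewrite /wind_strand /= ltn_eqF. Qed.

Lemma wind_comm i j t : i.+1 < j -> j < n -> wind i (wind j t) = wind j (wind i t).
Proof.
case: t => p t; case: j => // j; rewrite ltnS => ltij ltj.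
case: (eqVneq j.+2 n) => [Ej|nej].
  have -> : j.+1 = n.-1 by lia.
  by rewrite !wind_last //; lia.
have ltj' : j.+2 < n by lia.
case: i ltij => [|i] ltij; last first.
  have lti : i.+2 < n by lia.
  rewrite !windS //; congr pair; rewrite /swap.
  by do ![case: eqP => //=]; lia.
rewrite wind0 !windS // wind0; congr (_, _ + _)%R.
by rewrite /swap; do ![case: eqP => //=]; lia.
Qed.

Lemma wind_braid3 i t : i.+3 < n ->
  wind i.+1 (wind i.+2 (wind i.+1 t)) = wind i.+2 (wind i.+1 (wind i.+2 t)).
Proof.
case: t => p t lti; have lti' := ltnW lti; rewrite !windS //; congr pair.
by rewrite /swap; do ![case: eqP => //=]; lia.
Qed.

Lemma wind_braid4 t : 2 < n ->
  wind 0 (wind 1 (wind 0 (wind 1 t))) = wind 1 (wind 0 (wind 1 (wind 0 t))).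
Proof.
case: t => p t n2; rewrite !(windS, wind0) //.
by rewrite /swap; do ![case: eqP => //=]; rewrite ?GRing.addr0 //; lia.
Qed.

Lemma wind_braid4_last t : 2 < n ->
  wind n.-2 (wind n.-1 (wind n.-2 (wind n.-1 t))) =
  wind n.-1 (wind n.-2 (wind n.-1 (wind n.-2 t))).
Proof. by move=> n2; rewrite !wind_last //; lia. Qed.

End WindingRelations.

Section AffineCLower.
Variable n : nat.
Hypothesis n2 : 2 < n.
Local Notation R := (artin_rel (coxeter_affine_C n)).
Local Notation G := (artin_group (coxeter_affine_C n)).

Let windK1 k : k < n -> cancel (wind_strand 1%R n k) (wind_strand (-1)%R n k).
Proof. by move=> _; exact: windK. Qed.
Let windVK1 k : k < n -> cancel (wind_strand (-1)%R n k) (wind_strand 1%R n k).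
Proof. by move=> _ t; rewrite -[in wind_strand 1%R](GRing.opprK 1%R) windK. Qed.

Lemma wind_rel u v : R u v -> forall t,
  act_word (fun i : 'I_n => wind_strand 1%R n i) (fun i : 'I_n => wind_strand (-1)%R n i) u t =
  act_word (fun i : 'I_n => wind_strand 1%R n i) (fun i : 'I_n => wind_strand (-1)%R n i) v t.
Proof.
move: u v; apply: path_relP => //.
- by move=> k _; rewrite /edges_affine_C; case: ifP; [right | left].
- by move=> i j lt_ij t; exact: wind_comm.
- move=> i j Eij; rewrite /edges_affine_C; case: ifP => // /negbT.
  rewrite negb_or => /andP[i0 im] _ t.
  have lt_j := ltn_ord j; rewrite /act_word /= /act_letter /= Eij.
  case: (nat_of_ord i) Eij i0 im => // i' Eij _ im.
  by apply: wind_braid3; lia.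
- move=> i j Eij; rewrite /edges_affine_C; case: ifP => // + _ t.
  rewrite /act_word /= /act_letter /= Eij => /orP[/eqP -> |/eqP Ei].
    exact: wind_braid4.
  have -> : nat_of_ord i = n.-2 by lia.
  have -> : n.-2.+1 = n.-1 by lia.
  exact: wind_braid4_last.
Qed.

(** The counter started at strand [j] records how often that strand winds around the puncture of the
    first generator, and among the Jucys-Murphy elements only [jm j] takes it there. *)
Lemma affine_C_asdim_lower (T : generating_set G) k :
  metric_asdim_le (word_metric T) k -> n.-1 <= k.
Proof.
pose act : G -> nat * int -> nat * int := gen_act (wind_strand 1%R n) (wind_strand (-1)%R n).
have sB : B_system n.-1 (gen R).
  by case: n n2 => // m m2; apply: affine_C_B_system.
have actM x y u : act (x * y) u = act x (act y u) by exact: (gen_actM windVK1 windK1 wind_rel).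
have act1 u : act 1 u = u by exact: (gen_act1 windVK1 windK1 wind_rel).
have LC i j : i < n.-1 -> j < n.-1 -> commute (jm (gen R) i) (jm (gen R) j).
  exact: jm_commute.
apply: (@free_abelian_asdim _ n.-1 (jm (gen R)) LC _ 1%N act id isT actM act1).
move=> i j t lti ltj; rewrite mul1n /=.
have actE l u : l < n -> act (gen R l) u = wind_strand 1%R n l u by exact: (gen_actE windVK1 windK1 wind_rel).
elim: i j lti {ltj} => [|i IH] j lti.
  by rewrite jm0 actE ?(leq_trans lti) //; [rewrite wind0 eq_sym; case: eqP | lia].
have lti' : i.+2 < n by lia.
rewrite jmS !actM !(actE i.+1) ?(ltnW lti') // windS // IH ?(ltnW lti) // windS //.
by congr (_, _ + Posz _)%R; rewrite /swap; do ![case: eqP => //=]; lia.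
Qed.

End AffineCLower.

Section AffineALower.
Variable n : nat.
Hypothesis n2 : 2 < n.
Local Notation R := (artin_rel (coxeter_affine_A n)).
Local Notation G := (artin_group (coxeter_affine_A n)).
Let n0 : 0 < n := ltnW (ltnW n2).

Definition pos k : 'I_n := Ordinal (ltn_pmod k n0).

Lemma pos_eq j k : j < n -> k < n -> (pos j == pos k) = (j == k).
Proof. by move=> ltj ltk; rewrite -val_eqE /= !modn_small. Qed.

Lemma pos_n : pos n = pos 0.
Proof. by apply: val_inj; rewrite /= modnn mod0n. Qed.

Definition link k := cross (pos k) (pos k.+1).
Definition linkV k := uncross (pos k) (pos k.+1).

Let linkK k : k < n -> cancel (link k) (linkV k). Proof. by move=> _; exact: crossK. Qed.
Let linkVK k : k < n -> cancel (linkV k) (link k). Proof. by move=> _; exact: uncrossK. Qed.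

Lemma pos_neq j k : j < k < j + n -> pos j != pos k.
Proof.
move=> /andP[ltjk ltkn]; rewrite -val_eqE /= eq_sym eqn_mod_dvd ?(ltnW ltjk) //.
by rewrite gtnNdvd //; lia.
Qed.

Lemma link_rel u v : R u v -> forall t,
  act_word (fun i : 'I_n => link i) (fun i : 'I_n => linkV i) u t =
  act_word (fun i : 'I_n => link i) (fun i : 'I_n => linkV i) v t.
Proof.
move: u v; apply: cycle_relP => //.
- move=> i j lt_ij cond t; have lt_j := ltn_ord j.
  apply: cross_comm; apply: pos_neq => /=; lia.
- move=> i j Eij t; have lt_j := ltn_ord j.
  rewrite /act_word /= /act_letter /= Eij.
  apply: cross_braid; apply: pos_neq => /=; lia.
- move=> i j i0 Ej t; have lt_j := ltn_ord j.
  rewrite /act_word /= /act_letter /= i0 /link Ej pos_n.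
  by symmetry; apply: cross_braid; [rewrite eq_sym | | rewrite eq_sym]; apply: pos_neq; lia.
Qed.

Lemma link_far i j t : i.+2 < n -> j.+1 < n ->
  link i.+1 ((pos 0, pos j.+1), t) = ((pos 0, pos (swap i j).+1), t).
Proof.
move=> lti ltj; rewrite /link /cross /= !inE !xpair_eqE !pos_eq //; try lia.
rewrite /= GRing.addr0 tpermD ?pos_eq //; try lia.
congr (_, _, _); rewrite /swap; case: (eqVneq j i) => [->|ji]; first exact: tpermL.
case: (eqVneq j i.+1) => [->|jSi]; first exact: tpermR.
by rewrite tpermD // pos_eq //; lia.
Qed.

(** The strand at position 0 serves as puncture: folding the first of [n - 1] consecutive generators
    gives a [B_system]. The state [st j] marks it together with the strand at [j + 1]; their two
    crossings in a loop give the unit 2. *)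
Lemma affine_A_asdim_lower (T : generating_set G) k :
  metric_asdim_le (word_metric T) k -> n.-1 <= k.
Proof.
pose act : G -> 'I_n * 'I_n * int -> 'I_n * 'I_n * int := gen_act link linkV.
have actM x y u : act (x * y) u = act x (act y u) by exact: (gen_actM linkVK linkK link_rel).
have act1 u : act 1 u = u by exact: (gen_act1 linkVK linkK link_rel).
have actE l u : l < n -> act (cyc n l) u = link l u.
  by move=> ltl; rewrite /cyc modn_small //; exact: (gen_actE linkVK linkK link_rel).
pose s := fold_first (cyc n).
have sB : B_system n.-1 s by apply: fold_first_B_system; exact: (cyc_A_system n2 0).
have LC i j : i < n.-1 -> j < n.-1 -> commute (jm s i) (jm s j) by exact: jm_commute.
pose st j := (pos 0, pos j.+1).
apply: (@free_abelian_asdim _ n.-1 (jm s) LC _ 2 act st isT actM act1).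
have near t : link 0 ((pos 0, pos 1), t) = ((pos 1, pos 0), (t + 1)%R).
  by rewrite /link /cross /= tpermL tpermR !inE eqxx.
have near' t : link 0 ((pos 1, pos 0), t) = ((pos 0, pos 1), (t + 1)%R).
  by rewrite /link /cross /= tpermL tpermR !inE eqxx orbT.
have far j t : 0 < j -> j.+1 < n ->
    link 0 (link 0 ((pos 0, pos j.+1), t)) = ((pos 0, pos j.+1), t).
  move=> j0 ltj; have [n0' n1 n01] : [/\ pos 0 != pos j.+1, pos 1 != pos j.+1 & pos 0 != pos 1].
    by split; apply: pos_neq; lia.
  rewrite /link /cross /= !tpermK tpermL (tpermD n0' n1) !inE !xpair_eqE.
  by rewrite ![pos j.+1 == _]eq_sym (negPf n0') (negPf n1) !andbF !GRing.addr0.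
move=> i j t lti ltj; rewrite /st.
elim: i j lti ltj t => [|i IH] j lti ltj t.
  rewrite jm0 /s /fold_first /= expg2 actM !actE //.
  case: (posnP j) => [->|j0]; last first.
    by rewrite far //; [rewrite eq_sym (gtn_eqF j0) GRing.addr0 | lia].
  by rewrite near near' -GRing.addrA.
have lti' : i.+2 < n by lia.
have Es : s i.+1 = cyc n i.+1 by [].
rewrite jmS Es !actM !actE ?(ltnW lti') // link_far //; last by lia.
rewrite (IH _ (ltnW lti)); last by (rewrite /swap; do ![case: eqP => //=]; lia).
rewrite link_far //; last by rewrite /swap; do ![case: eqP => //=]; lia.
by congr (_, pos _, _ + Posz _)%R; rewrite /swap; do ![case: eqP => //=]; lia.
Qed.

End AffineALower.

Theorem corollary7 (n : nat) (hn : 3 <= n) :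
  [/\ asdim_le (artin_group (coxeter_A n)) n,
      asdim_le (artin_group (coxeter_B n)) n,
      asdim_eq (artin_group (coxeter_affine_A n)) n.-1 &
      asdim_eq (artin_group (coxeter_affine_C n)) n.-1].
Proof.
(* Type B on [n] vertices is a retract of affine type C on [n + 1], whose dimension is at most
   [n]. *)
have dimB := dim_le_artin_B (ltnW hn) (dim_le_artin_affine_C (ltnW hn : 2 < n.+1)).
split=> [||T|T].
- exact: dim_le_asdim (dim_le_artin_A dimB).
- exact: dim_le_asdim dimB.
- split; first exact: dim_le_asdim (dim_le_artin_affine_A hn) T.
  exact: affine_A_asdim_lower.
- split; first exact: dim_le_asdim (dim_le_artin_affine_C hn) T.
  exact: affine_C_asdim_lower.
Qed.
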